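(* Let $p\ge2$ be an integer, $h>0$, and $0<\beta<\beta_p$, where $\beta_p>0$ is defined by $8p^2\beta_p^2\exp(16\beta_p^2p)=\frac12$. Let $q$, $A^2$, $B^2$, $C^2$ be the constants (depending on $p,\beta,h$) defined in the context, and let $a(k)=\mathbf E[g^k]$ for a standard Gaussian random variable $g$. Then for every $\hat k\in\mathbb N$ there is a constant $L(\hat k)$, not depending on $N$, such that for all $N\ge p$ $$\left|\nu\Big(\big(R_{1,2}-q\big)^{\hat k}\Big)-\frac{1}{N^{\hat k/2}}\,a(\hat k)\,\frac{\big(A^2+2B^2+C^2\big)^{\hat k/2}}{\big((p-1)q^{p-2}\big)^{\hat k}}\right|\le\frac{L(\hat k)}{N^{(\hat k+1)/2}} .$$
   Context: $p$-spin model with external field. Let $\Sigma_N=\{-1,1\}^N$, $A_N^p=\{(i_1,\dots,i_p)\in\mathbb N^p:1\le i_1<\dots<i_p\le N\}$, $u_N=\big(\frac{p!}{2N^{p-1}}\big)^{1/2}$, and let $\{g_{i_1,\dots,i_p}:(i_1,\dots,i_p)\in A_N^p\}$ be independent standard Gaussian random variables (the disorder). The Hamiltonian is $$-H_{N,\beta,h}(\sigma)=\beta u_N\sum_{(i_1,\dots,i_p)\in A_N^p}g_{i_1,\dots,i_p}\sigma_{i_1}\cdots\sigma_{i_p}+h\sum_{i=1}^N\sigma_i,\quad \sigma\in\Sigma_N,$$ and $Z_N=\sum_{\sigma\in\Sigma_N}\exp(-H_{N,\beta,h}(\sigma))$. For $f:\Sigma_N^n\to\mathbb R$, $$\langle f\rangle=Z_N^{-n}\sum_{(\sigma^1,\dots,\sigma^n)\in\Sigma_N^n}f(\sigma^1,\dots,\sigma^n)\exp\Big(-\sum_{l\le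 n}H_{N,\beta,h}(\sigma^l)\Big),\qquad \nu(f)=\mathbf E\langle f\rangle,$$ with $\mathbf E$ the expectation over the disorder. The overlap is $R_{1,2}=\frac1N\sum_{i=1}^N\sigma_i^1\sigma_i^2$. Constants. With $Y$ a standard Gaussian random variable, $q\in[0,1]$ is the (unique) solution of $q=\mathbf E\big[\tanh^2\big(\beta(\frac p2)^{1/2}q^{\frac{p-1}{2}}Y+h\big)\big]$, $\hat q_4=\mathbf E\big[\tanh^4\big(\beta(\frac p2)^{1/2}q^{\frac{p-1}{2}}Y+h\big)\big]$, and $$A^2=\frac{(p-1)^2q^{2(p-2)}(1-2q+\hat q_4)}{1-\frac{p(p-1)}{2}q^{p-2}(1-2q+\hat q_4)\beta^2},$$ $$B^2=(p-1)q^{p-2}(q-\hat q_4)\,\frac{(p-1)q^{p-2}+\beta^2\frac p2A^2}{1-\beta^2\frac{p(p-1)}{2}q^{p-2}(1-4q+3\hat q_4)},$$ $$C^2=(p-1)q^{p-2}\,\frac{(\hat q_4-q^2)\big[(p-1)q^{p-2}+\beta^2\frac p2A^2\big]+\beta^2p(2q+q^2-3\hat q_4)B^2}{1-\beta^2\frac{p(p-1)}{2}q^{p-2}(1-4q+3\hat q_4)}.$$ *)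

(* Defs.v *)
From HB Require Import structures.
From mathcomp Require Import all_boot all_order all_algebra.
From mathcomp Require Import all_classical all_reals all_analysis.

Set Implicit Arguments.
Unset Strict Implicit.
Unset Printing Implicit Defensive.

Import Order.TTheory GRing.Theory Num.Theory.
Import numFieldNormedType.Exports.
Local Open Scope classical_set_scope.
Local Open Scope ring_scope.

Definition tanh (R : realType) (x : R) : R :=
  (expR x - expR (- x)) / (expR x + expR (- x)).

(* The second parameter of [normal_prob] is the standard deviation. *)
Definition gaussE (R : realType) (f : R -> R) : R :=
  fine ('E_(normal_prob (0 : R) 1)[f])%E.

Definition mutually_independent (d : measure_display) (T : measurableType d)
    (R : realType) (P : probability T R) (I : finType)
    (X : I -> {RV P >-> R}) : Prop :=
  forall (J : {set I}) (B : I -> set R), (forall i, measurable (B i)) ->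
    P (\bigcap_(i in [set` J]) (X i @^-1` B i)) =
    (\prod_(i in J) P (X i @^-1` B i))%E.

Definition iid_standard_gaussian (d : measure_display) (T : measurableType d)
    (R : realType) (P : probability T R) (I : finType)
    (X : I -> {RV P >-> R}) : Prop :=
  mutually_independent X /\
  forall (i : I) (B : set R), measurable B ->
    distribution P (X i) B = normal_prob (0 : R) 1 B.

Notation config N := {ffun 'I_N -> bool}.

Definition spin (R : realType) (N : nat) (s : config N) (i : 'I_N) : R :=
  (-1) ^+ s i.
Arguments spin R {N} s i.

(* The index set A_N^p, with sites numbered from 0 to N - 1. *)
Notation increasing_tuple N p :=
  {i : p.-tuple 'I_N | sorted ltn [seq nat_of_ord j | j <- i]}.

Definition u (R : realType) (N p : nat) : R :=
  Num.sqrt (p`!%:R / (2 * N%:R ^+ p.-1)).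

(* This is - H, the exponent in the Gibbs weight, for a realization [x] of the
   disorder. *)
Definition negH (R : realType) (N p : nat) (beta h : R)
    (x : increasing_tuple N p -> R) (s : config N) : R :=
  beta * u R N p *
    (\sum_(i : increasing_tuple N p) x i * \prod_(j <- val i) spin R s j)
  + h * \sum_(i < N) spin R s i.

Definition partition_function (R : realType) (N p : nat) (beta h : R)
    (x : increasing_tuple N p -> R) : R :=
  \sum_(s : config N) expR (negH beta h x s).

Definition gibbs (R : realType) (N p : nat) (beta h : R)
    (x : increasing_tuple N p -> R) (n : nat)
    (f : {ffun 'I_n -> config N} -> R) : R :=
  (partition_function beta h x ^+ n)^-1 *
  \sum_(s : {ffun 'I_n -> config N})
     f s * expR (\sum_(l < n) negH beta h x (s l)).

Definition nu (d : measure_display) (T : measurableType d) (R : realType)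
    (P : probability T R) (N p : nat) (beta h : R)
    (g : increasing_tuple N p -> {RV P >-> R}) (n : nat)
    (f : {ffun 'I_n -> config N} -> R) : R :=
  fine ('E_P[fun w => gibbs beta h (fun i => g i w) f])%E.

Definition overlap (R : realType) (N : nat) (s t : config N) : R :=
  N%:R^-1 * \sum_(i < N) spin R s i * spin R t i.
Arguments overlap R {N} s t.

Definition tanh_moment (R : realType) (p : nat) (beta h q : R) (m : nat) : R :=
  gaussE (fun y => tanh (beta * (p%:R / 2) `^ (1 / 2)
                         * q `^ ((p%:R - 1) / 2) * y + h) ^+ m).

Definition q_equation (R : realType) (p : nat) (beta h q : R) : Prop :=
  0 <= q <= 1 /\ q = tanh_moment p beta h q 2.

Definition q4 (R : realType) (p : nat) (beta h q : R) : R :=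
  tanh_moment p beta h q 4.

(* [Asq], [Bsq], [Csq] are the constants written A^2, B^2, C^2: only the
   squares are defined, and their signs are not part of the definition. *)
Definition Asq (R : realType) (p : nat) (beta h q : R) : R :=
  let r := q4 p beta h q in
  (p%:R - 1) ^+ 2 * q ^+ (2 * (p - 2)) * (1 - 2 * q + r) /
  (1 - p%:R * (p%:R - 1) / 2 * q ^+ (p - 2) * (1 - 2 * q + r) * beta ^+ 2).

Definition Bsq (R : realType) (p : nat) (beta h q : R) : R :=
  let r := q4 p beta h q in
  (p%:R - 1) * q ^+ (p - 2) * (q - r) *
  (((p%:R - 1) * q ^+ (p - 2) + beta ^+ 2 * (p%:R / 2) * Asq p beta h q) /
   (1 - beta ^+ 2 * (p%:R * (p%:R - 1) / 2) * q ^+ (p - 2)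
        * (1 - 4 * q + 3 * r))).

Definition Csq (R : realType) (p : nat) (beta h q : R) : R :=
  let r := q4 p beta h q in
  (p%:R - 1) * q ^+ (p - 2) *
  (((r - q ^+ 2) *
      ((p%:R - 1) * q ^+ (p - 2) + beta ^+ 2 * (p%:R / 2) * Asq p beta h q)
    + beta ^+ 2 * p%:R * (2 * q + q ^+ 2 - 3 * r) * Bsq p beta h q) /
   (1 - beta ^+ 2 * (p%:R * (p%:R - 1) / 2) * q ^+ (p - 2)
        * (1 - 4 * q + 3 * r))).

(* Main.v *)
Require Import Defs.
From HB Require Import structures.
From mathcomp Require Import all_boot all_order all_algebra.
From mathcomp Require Import all_classical all_reals all_analysis.
From mathcomp Require Import measurable_realfun.
From mathcomp Require Import ring lra.

Set Implicit Arguments.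
Unset Strict Implicit.
Unset Printing Implicit Defensive.

Import Order.TTheory GRing.Theory Num.Theory.
Import numFieldNormedType.Exports.
Local Open Scope classical_set_scope.
Local Open Scope ring_scope.

(** The proof is the cavity method, run at every site i of the N-spin system and averaged over i.
    For fixed i an interpolation joins the model, at t = 1, to a model, at t = 0, in which the
    couplings containing i are removed and the spin at i sees, besides h, only an independent
    Gaussian field of variance [cov_limit] = beta^2 (p/2) q^(p-1). At t = 0 a product of the spins
    at i in m distinct replicas has mean [tau m] = E tanh^m and separates from the other sites
    ([cmean0_spins]); the equation for q says that eps_i^a eps_i^b - q is then centered
    ([cm0_centered]). By Gaussian integration by parts, the t-derivative of an n-replica average is
    an (n+2)-replica average against [kernel] ([quad_path_cmean]). The off-diagonal entries of
    [kernel] are small with the overlap deviations, because the couplings at i have covariance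
    beta^2 (p/2) R^(p-1) + O(1/N) up to the two spins at i ([cavity_cov_asymp], [Wcov_dev_le]).

    Expand one factor of nu((R-q)^(2m+2)) as the average over i of eps_i^1 eps_i^2 - q. After
    removal of site i from the other factors, at cost 1/N, the value at t = 0 vanishes, and since 8
    p^2 beta^2 <= 1/2 the derivative is at most 2/3 of the moment itself plus a term of lower order.
    Absorption and induction give nu((R-q)^(2m)) = O(N^(-m)) ([even_moment]). Each deviation thus
    counts as N^(-1/2), and expansions at t = 0 can be truncated by counting factors.

    Such an expansion of the mean of (R_ab - q) (R_01 - q)^j ([cavity_equation]) closes, by
    exchangeability of replicas, into a linear system for the pairs (0,1), (0,2) and (2,3). The
    system is triangular in suitable combinations ([cavity_system_solution]), and its solution is
    nu((R-q)^(j+1)) = V (j/N) nu((R-q)^(j-1)) + O(N^(-(j+2)/2)) ([moment_recursion]), where V is A^2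
    + 2 B^2 + C^2 divided by ((p-1) q^(p-2))^2 ([constants_Vlim]). Gaussian moments satisfy a(k+2) =
    (k+1) a(k), so induction on k gives the limit ([limit_moment]).

    Expectations over the disorder are computed as iterated one-dimensional Gaussian integrals,
    [gmean]; [expectation_gmean] and [nu_fmean] identify them with [nu]. *)

(** * Integrals against the standard Gaussian law *)

Section GaussianMean.
Context {R : realType}.
Local Notation mu := (@lebesgue_measure R).
Local Notation gam := (normal_prob (0 : R) 1).
Implicit Types (f g : R -> R).

Definition gint f := gam.-integrable [set: R] (EFin \o f).

Lemma gaussEE f : gaussE f = (\int[gam]_x f x)%R.
Proof. by rewrite /gaussE unlock. Qed.

Lemma gintD f g : gint f -> gint g -> gint (fun x => f x + g x).
Proof. exact: integrableD. Qed.

Lemma gintZ (c : R) f : gint f -> gint (fun x => c * f x).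
Proof. exact: integrableZl. Qed.

Lemma gintB f g : gint f -> gint g -> gint (fun x => f x - g x).
Proof. exact: integrableB. Qed.

Lemma gint_cst (c : R) : gint (fun=> c).
Proof. exact: finite_measure_integrable_cst. Qed.

Lemma gint_sum (I : Type) (r : seq I) (F : I -> R -> R) :
  (forall i, gint (F i)) -> gint (fun x => \sum_(i <- r) F i x).
Proof.
move=> gF; elim: r => [|i r IH].
  by under eq_fun do rewrite big_nil; exact: gint_cst.
by under eq_fun do rewrite big_cons; exact: gintD.
Qed.

Lemma gint_norm f : gint f -> gint (fun x => `|f x|).
Proof. exact: integrable_norm. Qed.

Lemma gint_le f g : continuous f -> gint g -> (forall x, `|f x| <= g x) -> gint f.
Proof.
move=> cf gg fg; apply: (le_integrable _ _ _ gg) => //.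
  by apply/measurable_EFinP; exact: continuous_measurable_fun.
by move=> x _ /=; rewrite lee_fin (le_trans (fg x))// ler_norm.
Qed.

Lemma gint_bounded f (B : R) : continuous f -> (forall x, `|f x| <= B) -> gint f.
Proof. by move=> cf fB; apply: (gint_le cf (gint_cst B)). Qed.

Lemma gaussED f g : gint f -> gint g ->
  gaussE (fun x => f x + g x) = gaussE f + gaussE g.
Proof. by move=> *; rewrite !gaussEE RintegralD. Qed.

Lemma gaussEB f g : gint f -> gint g ->
  gaussE (fun x => f x - g x) = gaussE f - gaussE g.
Proof. by move=> *; rewrite !gaussEE RintegralB. Qed.

Lemma gaussEZ (c : R) f : gint f -> gaussE (fun x => c * f x) = c * gaussE f.
Proof. by move=> *; rewrite !gaussEE RintegralZl. Qed.

Lemma gaussE_cst (c : R) : gaussE (fun=> c) = c.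
Proof.
by rewrite /gaussE -[X in 'E_gam[X]%E]/(cst c) expectation_cst.
Qed.

Lemma gaussE_sum (I : Type) (r : seq I) (F : I -> R -> R) :
  (forall i, gint (F i)) ->
  gaussE (fun x => \sum_(i <- r) F i x) = \sum_(i <- r) gaussE (F i).
Proof.
move=> gF; elim: r => [|i r IH].
  by under eq_fun do rewrite big_nil; rewrite gaussE_cst big_nil.
under eq_fun do rewrite big_cons.
by rewrite gaussED//; [rewrite IH big_cons | exact: gint_sum].
Qed.

Lemma gaussE_le f g : gint f -> gint g -> (forall x, f x <= g x) ->
  gaussE f <= gaussE g.
Proof. by move=> *; rewrite !gaussEE le_Rintegral. Qed.

Lemma gaussE_norm_le f g : gint f -> gint g -> (forall x, `|f x| <= g x) ->
  `|gaussE f| <= gaussE g.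
Proof.
move=> gf gg fg; rewrite ler_norml; apply/andP; split.
  rewrite -mulN1r -gaussEZ//; apply: gaussE_le => //; first exact: gintZ.
  by move=> x; have := fg x; rewrite ler_norml mulN1r => /andP[].
by apply: gaussE_le => // x; have := fg x; rewrite ler_norml => /andP[].
Qed.

Lemma gaussE_bound f (B : R) : gint f -> (forall x, `|f x| <= B) ->
  `|gaussE f| <= B.
Proof.
by move=> gf fB; rewrite -(gaussE_cst B); apply: gaussE_norm_le => //; exact: gint_cst.
Qed.

(** The Radon-Nikodym derivative of the Gaussian law and [normal_pdf] have the same integral over
    every measurable set, so they agree almost everywhere. *)
Lemma gauss_integralE f : gint f ->
  (\int[gam]_x (f x)%:E = \int[mu]_x ((f x)%:E * (normal_pdf 0 1 x)%:E))%E.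
Proof.
move=> gf; have dom := @normal_prob_dominates R 0 1.
rewrite -(Radon_Nikodym_change_of_variables dom)//=.
apply: ae_eq_integral => //.
- apply: emeasurable_funM; first by case/integrableP: gf.
  by apply: (measurable_int mu); exact: Radon_Nikodym_integrable.
- apply: emeasurable_funM; first by case/integrableP: gf.
  by apply/measurable_EFinP; exact: measurable_normal_pdf.
- apply: ae_eqe_mul2l => /=.
  rewrite Radon_NikodymE//=.
  case: cid => /= h [h1 h2 h3].
  apply: integral_ae_eq => //=.
  + by apply/measurable_EFinP; exact: measurable_normal_pdf.
  + by move=> E E01 mE; rewrite -h3.
Qed.

(** Multiplying the density by exp(x^2/4) gives sqrt 2 times the density of standard deviation sqrt
    2. This function dominates all polynomials below. *)
Lemma gint_expR_sqr : gint (fun x => expR (x ^+ 2 / 4)).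
Proof.
have dom := @normal_prob_dominates R 0 1.
have cf : continuous (fun x : R => expR (x ^+ 2 / 4)).
  move=> x; apply: (@continuous_comp _ _ _ (fun x : R => x ^+ 2 / 4) (@expR R)); last exact: continuous_expR.
  by apply: cvgM; [exact: exprn_continuous|exact: cvg_cst].
have mf : measurable_fun [set: R] (fun x : R => expR (x ^+ 2 / 4)).
  exact: continuous_measurable_fun.
apply/integrableP; split; first exact/measurable_EFinP.
rewrite -(Radon_Nikodym_SigmaFinite.change_of_variables dom)//=; last first.
  by apply/measurable_EFinP; exact: measurableT_comp.
have s2 : Num.sqrt 2 != 0 :> R by rewrite gt_eqF// sqrtr_gt0.
apply: (@le_lt_trans _ _ (\int[mu]_x ((Num.sqrt 2)%:E * (normal_pdf 0 (Num.sqrt 2) x)%:E))%E); last first.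
  rewrite integralZl//; last exact: integrable_normal_pdf.
  by rewrite integral_normal_pdf mule1 ltry.
have ae : ae_eq mu [set: R] (Radon_Nikodym_SigmaFinite.f gam mu) (EFin \o normal_pdf 0 1).
  apply: integral_ae_eq => //=.
  + exact: Radon_Nikodym_SigmaFinite.f_integrable.
  + by apply/measurable_EFinP; exact: measurable_normal_pdf.
  + by move=> E _ mE; rewrite -Radon_Nikodym_SigmaFinite.f_integral.
rewrite le_eqVlt; apply/orP; left; apply/eqP.
apply: ae_eq_integral => //.
- apply: emeasurable_funM; first by apply/measurable_EFinP; exact: measurableT_comp.
  apply: (measurable_int mu); exact: Radon_Nikodym_SigmaFinite.f_integrable.
- apply: emeasurable_funM => //; apply/measurable_EFinP; exact: measurable_normal_pdf.
apply: ae_eq_trans; first exact: (ae_eqe_mul2l _ ae).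

apply: aeW => /= x _; rewrite -!EFinM; congr EFin.
rewrite ger0_norm ?expR_ge0// !normal_pdfE// /normal_peak /normal_fun !subr0 sqr_sqrtr//.
rewrite mulrCA -expRD mulrA; congr (_ * expR _); last by field.
rewrite expr1n mul1r -mulrnAr sqrtrM// invfM mulrA divff// mul1r.
by [].
Qed.

(** Apply 1 + y <= exp y at y = x^2 / (4 (k+1)) and raise to the power k+1. *)
Lemma norm_expr_le (k : nat) (x : R) :
  `|x| ^+ k <= (4 * k.+1%:R) ^+ k.+1 * expR (x ^+ 2 / 4).
Proof.
have k0 : 0 < 4 * k.+1%:R :> R by rewrite mulr_gt0.
have kN : 1 <= k.+1%:R :> R by rewrite ler1n.
have -> : expR (x ^+ 2 / 4) = expR (x ^+ 2 / (4 * k.+1%:R)) ^+ k.+1.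
  by rewrite -expRM_natl -mulr_natl; congr expR; field; rewrite gt_eqF// ltr0n.
rewrite -exprMn.
have h1 : 1 <= 1 + x ^+ 2 by rewrite lerDl sqr_ge0.
have h2 : `|x| <= 1 + x ^+ 2.
  by rewrite -real_normK ?num_real//; have := normr_ge0 x; move: `|x| => y y0; nra.
have h3 : 1 + x ^+ 2 <= 4 * k.+1%:R * expR (x ^+ 2 / (4 * k.+1%:R)).
  apply: (@le_trans _ _ (4 * k.+1%:R * (1 + x ^+ 2 / (4 * k.+1%:R)))).
    by rewrite mulrDr mulr1 mulrCA mulfV ?gt_eqF// mulr1 lerD2r; lra.
  by rewrite ler_pM2l// expR_ge1Dx.
apply: (@le_trans _ _ ((1 + x ^+ 2) ^+ k)).
  by apply: lerXn2r => //; rewrite nnegrE// (le_trans _ h1).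
apply: (@le_trans _ _ ((1 + x ^+ 2) ^+ k.+1)).
  by rewrite [leRHS]exprS ler_peMl// exprn_ge0// (le_trans _ h1).
by apply: lerXn2r => //; rewrite nnegrE ?mulr_ge0 ?expR_ge0 ?(le_trans _ h1)// ltW.
Qed.

Lemma gint_exprn (k : nat) : gint (fun x => x ^+ k).
Proof.
apply: gint_le (gintZ _ gint_expR_sqr) _; first exact: exprn_continuous.
by move=> x; rewrite normrX; exact: norm_expr_le.
Qed.

End GaussianMean.

(** * Derivatives read off quadratic Taylor bounds *)

Section Calculus.
Context {R : realType}.
Implicit Types (f : R -> R).

Lemma is_derive_taylor f (x d C e : R) : 0 < e ->
  (forall h, `|h| < e -> `|f (x + h) - f x - h * d| <= C * h ^+ 2) ->
  is_derive x 1 f d.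
Proof.
move=> e0 fC.
have cv : (fun h => h^-1 *: ((f \o shift x) (h *: (1:R)) - f x)) @ 0^' --> d.
  apply/cvgrPdist_le => eps eps0.
  pose dl := Num.min e (eps / (`|C| + 1)).
  have C1 : 0 < `|C| + 1 by rewrite ltr_wpDl.
  have dl0 : 0 < dl by rewrite lt_min e0 divr_gt0.
  near=> h.
  have h0 : h != 0 by near: h; exact: nbhs_dnbhs_neq.
  have hdl : `|h| < dl.
    near: h; apply: dnbhs0_lt => //.
  rewrite /= -[h%:A]/(h * 1) mulr1 [h + x]addrC.
  have -> : d - h^-1 *: (f (x + h) - f x) = - (h^-1 * (f (x + h) - f x - h * d)).
    by rewrite /GRing.scale/=; field.
  rewrite normrN normrM normfV ler_pdivrMl ?normr_gt0//.
  apply: (le_trans (fC _ _)); first by rewrite (lt_le_trans hdl)// ge_min lexx.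
  rewrite -(real_normK (num_real h)) expr2 mulrCA ler_pM2l ?normr_gt0//.
  have : `|h| < eps / (`|C| + 1) by rewrite (lt_le_trans hdl)// ge_min lexx orbT.
  rewrite ltr_pdivlMr// => /ltW; apply: le_trans.
  rewrite mulrDr mulr1; apply: (@le_trans _ _ (`|h| * `|C|)); last by rewrite lerDl.
  by rewrite mulrC ler_wpM2l// ler_norm.
split; first by apply/cvg_ex; exists d.
exact: cvg_lim.
Unshelve. all: by end_near. Qed.

Lemma continuous_dist_le f (C : R) : (forall x y, `|f x - f y| <= C * `|x - y|) ->
  continuous f.
Proof.
move=> fC x; apply/cvgrPdist_le => eps eps0.
have C1 : 0 < `|C| + 1 by rewrite ltr_wpDl.
near=> y.
have : `|x - y| < eps / (`|C| + 1).
  by near: y; apply: (@cvgr_dist_lt _ _ _ (nbhs x) _ id x); [exact: cvg_id|exact: divr_gt0].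
rewrite ltr_pdivlMr// => /ltW; apply: le_trans; apply: (le_trans (fC _ _)).
rewrite mulrDr mulr1 mulrC; apply: (@le_trans _ _ (`|x - y| * `|C|)).
  by rewrite ler_wpM2l// ler_norm.
by rewrite lerDl.
Unshelve. all: by end_near. Qed.

Lemma is_derive_continuous f (df : R -> R) : (forall x : R, is_derive x 1 f (df x)) ->
  continuous f.
Proof.
move=> dfE x; apply: differentiable_continuous; apply/derivable1_diffP.
by have [] := dfE x.
Qed.

End Calculus.

(** * Gaussian integration by parts *)

Section GaussianIBP.
Context {R : realType}.
Local Notation mu := (@lebesgue_measure R).
Local Notation gam := (normal_prob (0 : R) 1).
Local Notation phi := (normal_pdf (0 : R) 1).
Implicit Types (f g : R -> R).

Lemma is_derive_phi (x : R) : is_derive x 1 phi (- x * phi x).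
Proof.
have -> : phi = fun y : R => normal_peak 1 * expR (- y ^+ 2 / 2).
  apply/funext => y; rewrite normal_pdfE// /normal_fun subr0 expr1n.
  by rewrite -mulr_natl mulr1.
apply: is_derive_eq; rewrite /GRing.scale/= /GRing.scale/=.
by rewrite ?mulr0 ?mulr1 ?addr0; field.
Qed.

(** The derivative of f phi is (f1 - x f) phi, and f phi vanishes at infinity; the fundamental
    theorem on growing intervals then shows that f1 - x f has mean 0. *)
Lemma gauss_IBP f f1 (C : R) : (forall x : R, is_derive x 1 f (f1 x)) ->
  continuous f1 -> gint f1 -> gint (fun x => x * f x) ->
  (forall x, `|f x| <= C * expR (x ^+ 2 / 4)) ->
  gaussE (fun x => x * f x) = gaussE f1.
Proof.
move=> df cf1 gf1 gxf fC.
pose g x := f1 x - x * f x.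
have gg : gint g by exact: gintB.
suff : gaussE g = 0.
  by rewrite gaussEB// => /eqP; rewrite subr_eq0 => /eqP.
have cf := is_derive_continuous df.
have cphi : continuous phi by exact: continuous_normal_pdf.
have cg : continuous (fun x => g x * phi x).
  move=> x; apply: cvgM; last exact: cphi.
  by apply: cvgB; [exact: cf1|apply: cvgM; [exact: cvg_id|exact: cf]].
pose h x := f x * phi x.
have dh (x : R) : is_derive x 1 h (g x * phi x).
  have D := is_deriveM (df x) (is_derive_phi x).
  by apply: (is_derive_eq D); rewrite /GRing.scale/= /g; ring.
have ig : mu.-integrable setT (fun x => (g x * phi x)%:E).
  have dom := @normal_prob_dominates R 0 1.
  apply/integrableP; split.
    by apply/measurable_EFinP; exact: continuous_measurable_fun.
  have /integrableP[_] := gint_norm gg.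
  rewrite gauss_integralE; last exact: (gint_norm (gint_norm gg)).
  apply: le_lt_trans; rewrite le_eqVlt; apply/orP; left; apply/eqP.
  apply: eq_integral => x _; rewrite -EFinM/= normr_id normrM.
  by rewrite (ger0_norm (normal_pdf_ge0 _ _ _)).
pose I n : R := \int[mu]_(x in `[(- n.+1%:R), n.+1%:R]) (g x * phi x).
have IE n : (I n)%:E = (\int[mu]_(x in `[(- n.+1%:R)%R, n.+1%:R]) (g x * phi x)%:E)%E.
  rewrite /I /Rintegral fineK//; apply: integrable_fin_num => //.
  exact: (integrableS measurableT).
have Ih n : I n = h n.+1%:R - h (- n.+1%:R).
  apply: EFin_inj; rewrite IE EFinB; apply: continuous_FTC2.
  - by rewrite gtrN// ltr0n.
  - exact: continuous_subspaceT.
  - have ch := is_derive_continuous dh; split.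
    + by move=> x _; have [] := dh x.
    + exact/cvg_at_right_filter/ch.
    + exact/cvg_at_left_filter/ch.
  - by move=> x _; rewrite derive1E; have [_] := dh x.
(* The density contains exp(-x^2/4) twice: one factor absorbs the growth of f, the other is at most
   1 / (1 + x^2/4). *)
have hle x : `|h x| <= (C * normal_peak 1) / (1 + x ^+ 2 / 4).
  rewrite /h normrM (ger0_norm (normal_pdf_ge0 _ _ _)).
  have -> : phi x = normal_peak 1 * (expR (- (x ^+ 2 / 4)) * expR (- (x ^+ 2 / 4))).
    rewrite -expRD normal_pdfE// /normal_fun subr0 expr1n; congr (_ * expR _).
    by field.
  apply: (@le_trans _ _ (C * expR (x ^+ 2 / 4) * (normal_peak 1 * (expR (- (x ^+ 2 / 4)) * expR (- (x ^+ 2 / 4)))))).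
    by apply: ler_wpM2r => //; rewrite !mulr_ge0 ?expR_ge0// normal_peak_ge0.
  have -> : C * expR (x ^+ 2 / 4) * (normal_peak 1 * (expR (- (x ^+ 2 / 4)) * expR (- (x ^+ 2 / 4)))) = C * normal_peak 1 * expR (- (x ^+ 2 / 4)).
    have : expR (x ^+ 2 / 4) * expR (- (x ^+ 2 / 4)) = 1 by rewrite -expRD subrr expR0.
    move: (expR (x ^+ 2 / 4)) (expR (- _)) => a b ab.
    transitivity (C * normal_peak 1 * b * (a * b)); first by ring.
    by rewrite ab mulr1.
  apply: ler_wpM2l.
    apply: mulr_ge0; last exact: normal_peak_ge0.
    have := le_trans (normr_ge0 _) (fC 0).
    by rewrite expr0n/= mul0r expR0 mulr1.
  rewrite expRN lef_pV2 ?expR_ge1Dx// posrE ?expR_gt0//.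
  by rewrite ltr_wpDr// divr_ge0// sqr_ge0.
have I0 : I n @[n --> \oo] --> (0 : R).
  apply: norm_cvg0; apply: (@squeeze_cvgr _ _ _ _ (fun=> 0) (fun n => (2 * (C * normal_peak 1) * 4) * n.+1%:R^-1)); last 2 first.
  - exact: cvg_cst.
  - rewrite -[X in _ --> X](mulr0 (2 * (C * normal_peak 1) * 4)); apply: cvgM.
      exact: cvg_cst.
    exact: cvg_harmonic.
  apply: nearW => n; rewrite normr_ge0 Ih/=.
  have K0 : 0 <= C * normal_peak 1.
    have := le_trans (normr_ge0 _) (hle 0).
    by rewrite expr0n/= mul0r addr0 divr1.
  apply: (le_trans (ler_normB _ _)).
  apply: (le_trans (lerD (hle _) (hle _))); rewrite sqrrN.
  have n0 : 0 < n.+1%:R :> R by rewrite ltr0n.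
  have n1 : 1 <= n.+1%:R :> R by rewrite ler1n.
  have le4 : (1 + n.+1%:R ^+ 2 / 4)^-1 <= 4 * n.+1%:R^-1 :> R.
    have p1 : 0 < 1 + n.+1%:R ^+ 2 / 4 :> R by rewrite ltr_wpDr// divr_ge0// sqr_ge0.
    have p2 : 0 < n.+1%:R / 4 :> R by rewrite divr_gt0.
    by rewrite -[4 / _]invrK invf_div lef_pV2 ?posrE// expr2; nra.
  move: (C * normal_peak 1) K0 (_^-1) (_^-1) le4 => K K0 a b ab.
  by rewrite -mulrDr; nra.
have IT : (I n)%:E @[n --> \oo] --> (\int[mu]_x (g x * phi x)%:E)%E.
  pose fn (n : nat) : R -> \bar R := (fun x => (g x * phi x)%:E) \_ `[(- n.+1%:R), n.+1%:R].
  have [] := @dominated_convergence _ _ _ mu setT measurableT fn (fun x => (g x * phi x)%:E) (fun x => `|(g x * phi x)%:E|)%E.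
  - move=> n; apply/(measurable_restrictT _ _).1 => //.
    by apply: measurable_funTS; apply/measurable_EFinP; exact: continuous_measurable_fun.
  - by apply/measurable_EFinP; exact: continuous_measurable_fun.
  - apply: aeW => /= x _; apply: cvg_near_cst; near=> n.
    rewrite /fn patchE mem_set//= in_itv/= -ler_norml.
    apply: (@le_trans _ _ n%:R); last by rewrite ler_nat.
    by near: n; exact: nbhs_infty_ger.
  - exact: integrable_abse.
  - apply: aeW => /= x n _; rewrite /fn patchE; case: ifP => // _.
    by rewrite abse0.
  move=> _ _; under [X in X @ _ --> _]eq_fun do rewrite /= /fn -integral_mkcond -IE.
  by [].
have IE0 : (I n)%:E @[n --> \oo] --> (0 : R)%:E.
  by apply: cvg_EFin; [exact: nearW|exact: I0].
have E0 := cvg_unique (@ereal_hausdorff R) IE0 IT.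
by rewrite /gaussE unlock gauss_integralE//= -E0.
Unshelve. all: by end_near. Qed.

End GaussianIBP.

(** * Gaussian moments and the heat equation in the variance *)

Section GaussianHeat.
Context {R : realType}.

Lemma gaussE_id : gaussE (fun y : R => y) = 0.
Proof.
have -> : (fun y : R => y) = fun y => y * 1 by apply/funext => y; rewrite mulr1.
rewrite (@gauss_IBP _ (fun=> 1) (fun=> 0) 1).
- exact: gaussE_cst.
- by move=> x; exact: cvg_cst.
- exact: gint_cst.
- by under eq_fun do rewrite mulr1; exact: (gint_exprn 1).
- by move=> x; rewrite normr1 mul1r (le_trans _ (expR_ge1Dx _))// lerDl divr_ge0// sqr_ge0.
Qed.

(** Integration by parts of y times y^(k+1). The overlap moments satisfy the same recursion
    asymptotically. *)
Lemma gaussE_exprSS (k : nat) :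
  gaussE (fun y : R => y ^+ k.+2) = k.+1%:R * gaussE (fun y : R => y ^+ k).
Proof.
rewrite -gaussEZ; last exact: gint_exprn.
have -> : (fun y : R => y ^+ k.+2) = fun y => y * y ^+ k.+1.
  by apply/funext => y; rewrite exprS.
apply: (@gauss_IBP _ _ _ ((4 * k.+2%:R) ^+ k.+2)).
- move=> x; have D := @is_deriveX _ _ (@id R) k.+1 x 1 1 (is_derive_id _ _).
  move: D; rewrite exprfctE /GRing.scale/= mulr1; exact.
- by move=> y; apply: cvgM; [exact: cvg_cst|exact: exprn_continuous].
- exact/gintZ/gint_exprn.
- by under eq_fun do rewrite -exprS; exact: gint_exprn.
- by move=> x; rewrite normrX; exact: norm_expr_le.
Qed.

Lemma gaussE_sqr : gaussE (fun y : R => y ^+ 2) = 1.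
Proof.
rewrite gaussE_exprSS mul1r; under eq_fun do rewrite expr0.
exact: gaussE_cst.
Qed.

Lemma gaussE_odd (k : nat) : odd k -> gaussE (fun y : R => y ^+ k) = 0.
Proof.
elim/ltn_ind: k => -[//|[_ _|k IH ok]].
  by under eq_fun do rewrite expr1; exact: gaussE_id.
by rewrite gaussE_exprSS IH ?mulr0//; move: ok; rewrite /= negbK.
Qed.

Variables (g : nat -> R -> R) (b : nat -> R).
Hypothesis g_le : forall k y, `|g k y| <= b k.
Hypothesis g_taylor : forall k y h,
  `|g k (y + h) - g k y - h * g k.+1 y| <= b k.+2 * h ^+ 2.

(** As g (k+1) is the derivative of g k, this is the heat flow: psi k has derivative psi (k+2) / 2
    in the variance s. *)
Let psi k s := gaussE (fun y => g k (Num.sqrt s * y)).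

Let b_ge0 k : 0 <= b k.
Proof. exact: le_trans (normr_ge0 _) (g_le k 0). Qed.

Let dg k (y : R) : is_derive y 1 (g k) (g k.+1 y).
Proof. by apply: (@is_derive_taylor _ _ _ _ (b k.+2) 1) => // h _; exact: g_taylor. Qed.

Let cg k : continuous (g k).
Proof. exact: is_derive_continuous (dg k). Qed.

Let cg_scale k (c : R) : continuous (fun y : R => g k (c * y)).
Proof.
move=> y; apply: (@continuous_comp _ _ _ (fun y : R => c * y) (g k)); last exact: cg.
by apply: cvgM; [exact: cvg_cst|exact: cvg_id].
Qed.

Let gint_scale k (c : R) : gint (fun y : R => g k (c * y)).
Proof. by apply: (@gint_bounded _ _ (b k)) => // y; exact: g_le. Qed.

Let gint_yscale k (c : R) : gint (fun y : R => y * g k (c * y)).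
Proof.
apply: (gint_le _ (gintZ (b k) (gint_norm (gint_exprn 1)))).
  by move=> y; apply: cvgM; [exact: cvg_id|exact: cg_scale].
by move=> y; rewrite normrM mulrC expr1 ler_wpM2r.
Qed.

Let psi_le k s : `|psi k s| <= b k.
Proof. exact: gaussE_bound. Qed.

Let psi_step k r r' : `|gaussE (fun y => g k (r' * y)) - gaussE (fun y => g k (r * y))
   - (r' - r) * gaussE (fun y => y * g k.+1 (r * y))| <= b k.+2 * (r' - r) ^+ 2.
Proof.
rewrite -gaussEZ// -!gaussEB//; last 2 first.
- exact: gintB.
- exact: gintZ.
rewrite -[leRHS]mulr1 -gaussE_sqr -gaussEZ; last exact: gint_exprn.
apply: gaussE_norm_le.
- by apply: gintB; [exact: gintB|exact: gintZ].
- exact/gintZ/gint_exprn.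
- move=> y; have := g_taylor k (r * y) ((r' - r) * y).
  have -> : r * y + (r' - r) * y = r' * y by ring.
  by rewrite exprMn !mulrA.
Qed.

Let psi_IBP k r : gaussE (fun y => y * g k (r * y)) = r * gaussE (fun y => g k.+1 (r * y)).
Proof.
rewrite -gaussEZ//; apply: (@gauss_IBP _ _ _ (b k)) => //.
- move=> x; have D := @is_derive1_comp _ (g k) (fun y => r * y) x _ _ (dg k _) _.
  apply: (is_derive_eq (D r _)); last by rewrite mulrC.
  by apply: is_derive_eq; rewrite /GRing.scale/= mulr1; exact.
- by move=> x; apply: cvgM; [exact: cvg_cst|exact: cg_scale].
- exact: gintZ.
- move=> x; apply: (le_trans (g_le _ _)); rewrite ler_peMr//.
  by rewrite (le_trans _ (expR_ge1Dx _))// lerDl divr_ge0// sqr_ge0.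
Qed.

(** [psi_step] expands in dl, the increment of sqrt s, and integration by parts makes its linear
    term dl sqrt s psi (k+2). Here dl sqrt s = h/2 - dl^2/2 and dl^2 <= h^2 / s. *)
Let psi_derive k (s : R) : 0 < s -> is_derive s 1 (psi k) (psi k.+2 s / 2).
Proof.
move=> s0; apply: (@is_derive_taylor _ _ _ _ (2 * b k.+2 / s) s) => // h hs.
have sh0 : 0 <= s + h by move: hs; rewrite ltr_norml => /andP[]; lra.
have := psi_step k (Num.sqrt s) (Num.sqrt (s + h)).
rewrite psi_IBP -/(psi _ _) -/(psi _ _) -/(psi _ _).
set dl := Num.sqrt (s + h) - Num.sqrt s => step.
have r0 : 0 < Num.sqrt s by rewrite sqrtr_gt0.
have r1 : 0 <= Num.sqrt (s + h) by exact: sqrtr_ge0.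
have hE : h = dl * (2 * Num.sqrt s + dl).
  rewrite /dl; have := sqr_sqrtr (ltW s0); have := sqr_sqrtr sh0.
  move: (Num.sqrt _) (Num.sqrt _) => x y Hx Hy.
  by transitivity (y ^+ 2 - x ^+ 2); [rewrite Hx Hy; ring|ring].
have dle : dl ^+ 2 <= h ^+ 2 / s.
  rewrite ler_pdivlMr// {1}hE exprMn ler_wpM2l ?sqr_ge0//.
  have -> : 2 * Num.sqrt s + dl = Num.sqrt s + Num.sqrt (s + h) by rewrite /dl; ring.
  rewrite -{1}(sqr_sqrtr (ltW s0)) ler_pXn2r ?nnegrE ?addr_ge0 ?(ltW r0)//.
  by rewrite lerDl.
have -> : psi k (s + h) - psi k s - h * (psi k.+2 s / 2) =
   (psi k (s + h) - psi k s - dl * (Num.sqrt s * psi k.+2 s)) - dl ^+ 2 / 2 * psi k.+2 s.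
  by rewrite {2}hE; field.
apply: (le_trans (ler_normB _ _)).
apply: (@le_trans _ _ (b k.+2 * dl ^+ 2 + dl ^+ 2 / 2 * b k.+2)).
  apply: lerD => //; rewrite normrM ger0_norm ?divr_ge0 ?sqr_ge0//.
  by apply: ler_wpM2l; [rewrite divr_ge0 ?sqr_ge0|exact: psi_le].
apply: (@le_trans _ _ (2 * b k.+2 * dl ^+ 2)); last first.
  rewrite -[leRHS]mulrA; apply: ler_wpM2l; first by rewrite mulr_ge0.
  by rewrite mulrC.
by have := b_ge0 k.+2; have := sqr_ge0 dl; nra.
Qed.

(** The square root is singular at 0, but E Y = 0 kills the term in sqrt s and leaves a bound linear
    in s. *)
Let psi_0 k s : `|psi k s - psi k 0| <= b k.+2 * `|s|.
Proof.
have [s0|s0] := leP 0 s; last first.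
  by rewrite /psi !ler0_sqrtr ?(ltW s0)// subrr normr0 mulr_ge0.
have := psi_step k 0 (Num.sqrt s).
have -> : gaussE (fun y => y * g k.+1 (0 * y)) = 0.
  under eq_fun do rewrite mul0r mulrC.
  rewrite gaussEZ; first by rewrite gaussE_id mulr0.
  exact: (gint_exprn 1).
by rewrite mulr0 !subr0 sqr_sqrtr// /psi sqrtr0 (ger0_norm s0).
Qed.

Let psi_continuous k (s : R) : 0 <= s -> {for s, continuous (psi k)}.
Proof.
rewrite le_eqVlt => /predU1P[<-|s0]; last first.
  apply: differentiable_continuous; apply/derivable1_diffP.
  by have [] := psi_derive k s0.
apply/cvgrPdist_le => eps eps0.
have C1 : 0 < b k.+2 + 1 by rewrite ltr_wpDl.
near=> y.
have : `|0 - y| < eps / (b k.+2 + 1).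
  by near: y; apply: (@cvgr_dist_lt _ _ _ (nbhs (0 : R)) _ id 0); [exact: cvg_id|exact: divr_gt0].
rewrite sub0r normrN ltr_pdivlMr// => /ltW; apply: le_trans.
rewrite distrC; apply: (le_trans (psi_0 _ _)).
by rewrite mulrC ler_wpM2l// lerDl.
Unshelve. all: by end_near. Qed.

(** Differentiability for s > 0 and continuity at 0 suffice for the mean value theorem. Zero
    variance must be included, since the interpolations switch coordinates on and off. *)
Let psi_MVT k (s s' : R) : 0 <= s -> 0 <= s' ->
  exists c, [/\ 0 <= c, `|c - s| <= `|s' - s| &
    psi k s' - psi k s = (s' - s) * (psi k.+2 c / 2)].
Proof.
move=> s0 s'0.
have H (x y : R) : 0 <= x -> x < y -> exists2 c, c \in `]x, y[ &
    psi k y - psi k x = (psi k.+2 c / 2) * (y - x).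
  move=> x0 xy; apply: (@MVT _ (psi k) (fun c => psi k.+2 c / 2)) => //.
    move=> z; rewrite in_itv/= => /andP[xz zy]; apply: psi_derive.
    exact: le_lt_trans xz.
  apply: continuous_in_subspaceT => z; rewrite inE/= in_itv/= => /andP[xz _].
  by apply: psi_continuous; exact: le_trans xz.
case: (ltgtP s s') => [ss|ss|<-].
- have [c] := H _ _ s0 ss; rewrite in_itv/= => /andP[sc cs] E.
  exists c; split; first by rewrite (le_trans s0)// ltW.
    by rewrite !gtr0_norm ?subr_gt0// lerD2r ltW.
  by rewrite E mulrC.
- have [c] := H _ _ s'0 ss; rewrite in_itv/= => /andP[sc cs] E.
  exists c; split; first by rewrite (le_trans s'0)// ltW.
    by rewrite !ltr0_norm ?subr_lt0// lerN2 lerD2r ltW.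
  by rewrite -opprB E; ring.
- by exists s; split => //; rewrite !subrr ?mul0r.
Qed.

Lemma gauss_heat_lip k s s' : 0 <= s -> 0 <= s' ->
  `|gaussE (fun y => g k (Num.sqrt s' * y)) - gaussE (fun y => g k (Num.sqrt s * y))|
    <= b k.+2 * `|s' - s|.
Proof.
move=> s0 s'0; rewrite -/(psi k s) -/(psi k s').
have [c [_ _ ->]] := psi_MVT k s0 s'0.
rewrite normrM mulrC ler_wpM2r// normrM (@ger0_norm _ 2^-1)//.
by have := psi_le k.+2 c; have := normr_ge0 (psi k.+2 c); lra.
Qed.

(** The intermediate point of the mean value theorem is moved back to s by [gauss_heat_lip], at the
    cost of two more derivatives. *)
Lemma gauss_heat k s s' : 0 <= s -> 0 <= s' ->
  `|gaussE (fun y => g k (Num.sqrt s' * y)) - gaussE (fun y => g k (Num.sqrt s * y))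
    - (s' - s) / 2 * gaussE (fun y => g k.+2 (Num.sqrt s * y))|
    <= b k.+4 * (s' - s) ^+ 2.
Proof.
move=> s0 s'0; rewrite -/(psi k s) -/(psi k s') -/(psi k.+2 s).
have [c [c0 cs ->]] := psi_MVT k s0 s'0.
have := gauss_heat_lip k.+2 s0 c0; rewrite -/(psi _ _) -/(psi _ _) => L.
have -> : (s' - s) * (psi k.+2 c / 2) - (s' - s) / 2 * psi k.+2 s =
  (s' - s) * ((psi k.+2 c - psi k.+2 s) / 2) by ring.
rewrite normrM -(real_normK (num_real (s' - s))) expr2 mulrCA ler_wpM2l//.
rewrite normrM (@ger0_norm _ 2^-1)//.
have := ler_wpM2l (b_ge0 k.+4) cs.
by have := normr_ge0 (psi k.+2 c - psi k.+2 s); lra.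
Qed.

End GaussianHeat.

(** * Means over finitely many independent Gaussians, as iterated integrals *)

Section IteratedGaussianMean.
Context {R : realType} {I : eqType}.
Implicit Types (l : seq I) (v x : I -> R) (i k : I).

Definition upd (T : Type) (x : I -> T) i (y : T) : I -> T :=
  fun k => if k == i then y else x k.

Lemma upd_same (T : Type) (x : I -> T) i y : upd x i y i = y.
Proof. by rewrite /upd eqxx. Qed.

Lemma upd_other (T : Type) (x : I -> T) i k y : k != i -> upd x i y k = x k.
Proof. by rewrite /upd => /negbTE ->. Qed.

Lemma upd_upd (T : Type) (x : I -> T) i y z : upd (upd x i y) i z = upd x i z.
Proof. by apply/funext => k; rewrite /upd; case: (k == i). Qed.

Lemma upd_id (T : Type) (x : I -> T) i : upd x i (x i) = x.
Proof. by apply/funext => k; rewrite /upd; have [->|] := eqVneq k i. Qed.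

Lemma updC (T : Type) (x : I -> T) i k y z : i != k ->
  upd (upd x i y) k z = upd (upd x k z) i y.
Proof.
move=> ik; apply/funext => m; rewrite /upd; have [->|//] := eqVneq m k.
by rewrite eq_sym (negbTE ik).
Qed.

(** Expectation over independent centered Gaussians of variances v i for i in l, the other
    coordinates being frozen at x. The iterated form reduces everything to calculus in one
    variable. *)
Fixpoint gmean l v (F : (I -> R) -> R) x : R :=
  if l is i :: l' then
    gaussE (fun y => gmean l' v F (upd x i (Num.sqrt (v i) * y)))
  else F x.

(* [P] holds for the points visited by [gmean]; it is used to know that a
   coordinate of variance [0] vanishes. *)
Definition gmean_stable v (P : (I -> R) -> Prop) :=
  forall x i y, P x -> P (upd x i (Num.sqrt (v i) * y)).

Lemma gmean_stable_zero v : gmean_stable v (fun x => forall i, v i = 0 -> x i = 0).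
Proof.
move=> x i y x0 k vk; have [ki|ki] := eqVneq k i; last by rewrite upd_other// x0.
by rewrite ki upd_same -ki vk sqrtr0 mul0r.
Qed.

Lemma gmean_invariant l v P (F : (I -> R) -> R) x i y : gmean_stable v P -> P x ->
  i \notin l -> (forall x y, P x -> F (upd x i (Num.sqrt (v i) * y)) = F x) ->
  gmean l v F (upd x i (Num.sqrt (v i) * y)) = gmean l v F x.
Proof.
move=> sP + + Fi; elim: l x => [|k l IH] x Px /=; first by rewrite Fi.
rewrite inE negb_or => /andP[ik il]; congr gaussE; apply/funext => z.
by rewrite updC// IH//; exact: sP.
Qed.

Lemma gmean_eqF l v (F G : (I -> R) -> R) x : F =1 G -> gmean l v F x = gmean l v G x.
Proof. by move=> /funext ->. Qed.

Lemma gmean_eq_coef l v v' (F : (I -> R) -> R) x : {in l, v =1 v'} ->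
  gmean l v F x = gmean l v' F x.
Proof.
elim: l x => //= i l IH x vv; congr gaussE; apply/funext => y.
rewrite vv ?mem_head//; apply: IH => k kl; apply: vv.
by rewrite inE kl orbT.
Qed.

Variables (J : Type) (d : I -> J -> J) (B : J -> R).

(* [F (d i j)] plays the role of the derivative of [F j] in the coordinate [i]. *)
Definition smooth_family (D : pred I) (F : J -> (I -> R) -> R) :=
  (forall j x, `|F j x| <= B j) /\
  (forall i j x h, D i ->
     `|F j (upd x i (x i + h)) - F j x - h * F (d i j) x| <= B (d i (d i j)) * h ^+ 2).

Lemma smooth_family_slice D F i j x : smooth_family D F -> D i ->
  let g (k : nat) (y : R) := F (iter k (d i) j) (upd x i y) in
  let b (k : nat) := B (iter k (d i) j) in
  (forall (k : nat) y, `|g k y| <= b k) /\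
  (forall (k : nat) y h, `|g k (y + h) - g k y - h * g k.+1 y| <= b k.+2 * h ^+ 2).
Proof.
move=> [FB Fd] Di g b; split => [k y|k y h]; first exact: FB.
by have := Fd i (iter k (d i) j) (upd x i y) h Di; rewrite upd_upd upd_same.
Qed.

Lemma smooth_family_gint D F i j x (c : R) : smooth_family D F -> D i ->
  gint (fun y : R => F j (upd x i (c * y))).
Proof.
move=> sF Di; have [gb gt] := smooth_family_slice j x sF Di.
apply: (@gint_bounded _ _ (B j)); last by move=> y; exact: (gb 0).
move=> y; apply: (@continuous_comp _ _ _ (fun y : R => c * y) (fun y => F j (upd x i y))).
  by apply: cvgM; [exact: cvg_cst|exact: cvg_id].
apply: (is_derive_continuous (df := fun y => F (d i j) (upd x i y))) => z.
apply: (@is_derive_taylor _ _ _ _ (B (d i (d i j))) 1) => // h _.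
exact: (gt 0).
Qed.

(** The bounds are uniform in all coordinates, so they pass under the integrals over l; Taylor
    bounds survive in the directions not integrated. *)
Lemma smooth_family_gmean F l v : uniq l -> smooth_family predT F ->
  smooth_family [pred i | i \notin l] (fun j => gmean l v (F j)).
Proof.
move=> + sF; elim: l => [_|i l IH /= /andP[il ul]] /=.
  by case: sF => sb sd; split => // i j x h _; exact: sd.
have sl := IH ul; have [IHb IHd] := sl.
have Gi j x := @smooth_family_gint _ _ i j x (Num.sqrt (v i)) sl il.
split=> [j x|k j x h].
  by apply: gaussE_bound; [exact: Gi|move=> y; exact: IHb].
rewrite /= inE negb_or => /andP[ki kl].
have Gk : gint (fun y => gmean l v (F j) (upd (upd x k (x k + h)) i (Num.sqrt (v i) * y))).
  exact: Gi.
rewrite -gaussEZ; last exact: Gi.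
rewrite -!gaussEB; try by do ?[exact: Gk|exact: Gi|apply: gintB|apply: gintZ].
apply: gaussE_bound => [|y]; first by do ?[exact: Gk|exact: Gi|apply: gintB|apply: gintZ].
rewrite updC//; have := IHd k j (upd x i (Num.sqrt (v i) * y)) h kl.
by rewrite upd_other.
Qed.

Section Family.
Variables (F : J -> (I -> R) -> R).
Hypothesis sF : smooth_family predT F.

Let Gi l v i j x c : uniq (i :: l) -> gint (fun y => gmean l v (F j) (upd x i (c * y))).
Proof.
by move=> /= /andP[il ul]; exact: (smooth_family_gint _ _ _ (smooth_family_gmean v ul sF)).
Qed.

Lemma gmean_bound l v j x : uniq l -> `|gmean l v (F j) x| <= B j.
Proof. by move=> ul; have [] := smooth_family_gmean v ul sF. Qed.

Lemma gmean_lin l v (a b : R) j j1 j2 x : uniq l ->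
  (forall x, F j x = a * F j1 x + b * F j2 x) ->
  gmean l v (F j) x = a * gmean l v (F j1) x + b * gmean l v (F j2) x.
Proof.
move=> + H; elim: l x => [|i l IH] x ul //=.
under eq_fun do rewrite (IH _ (subseq_uniq (subseq_cons _ _) ul)).
rewrite gaussED ?gaussEZ//; try exact: Gi; by apply: gintZ; exact: Gi.
Qed.

Lemma gmean_le l v j j' x : uniq l -> (forall x, F j x <= F j' x) ->
  gmean l v (F j) x <= gmean l v (F j') x.
Proof.
move=> + H; elim: l x => [|i l IH] x ul //=.
apply: gaussE_le; [exact: Gi|exact: Gi|move=> y; apply: IH].
exact: (subseq_uniq (subseq_cons _ _) ul).
Qed.

(** Independence: when F j' is g of the i-th coordinate times a function that does not see this
    coordinate, the mean factors. The factorisation is asked on P alone, which the integration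
    preserves. *)
Lemma gmean_factor l v P (g : R -> R) i j j' x : gmean_stable v P -> P x ->
  uniq l -> i \in l -> gint (fun y => g (Num.sqrt (v i) * y)) ->
  (forall x, P x -> F j' x = g (x i) * F j x) ->
  (forall x y, P x -> F j (upd x i (Num.sqrt (v i) * y)) = F j x) ->
  gmean l v (F j') x = gaussE (fun y => g (Num.sqrt (v i) * y)) * gmean l v (F j) x.
Proof.
move=> sP + + + gg Hg Hi.
have out m : i \notin m -> uniq m -> forall x, P x ->
    gmean m v (F j') x = g (x i) * gmean m v (F j) x.
  elim: m => [_ _ z Pz|k m IHm] /=; first exact: Hg.
  rewrite inE negb_or => /andP[ik im] ukm z Pz.
  have um := subseq_uniq (subseq_cons _ _) ukm.
  under eq_fun => y.
    rewrite IHm//; last exact: sP.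
    rewrite upd_other//; over.
  by rewrite gaussEZ//; exact: Gi.
elim: l x => //= k m IHm x Px ukm; rewrite inE => /predU1P[E|im].
  have /andP[km um] := ukm; rewrite -{}E in km ukm *.
  have -> : (fun y => gmean m v (F j) (upd x i (Num.sqrt (v i) * y))) = fun=> gmean m v (F j) x.
    by apply/funext => y; rewrite (gmean_invariant _ sP).
  under eq_fun => y.
    rewrite out//; last exact: sP.
    rewrite upd_same (gmean_invariant _ sP)// mulrC; over.
  by rewrite gaussEZ// gaussE_cst mulrC.
have um := subseq_uniq (subseq_cons _ _) ukm.
under eq_fun => y.
  rewrite IHm//; last exact: sP.
  over.
by rewrite gaussEZ//; exact: Gi.
Qed.

Variables (al ga : I -> R).
Let v (t : R) i : R := al i + t * ga i.

(** Gaussian interpolation formula: with variances al + t ga, the t-derivative is half the sum of ga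
    i times the mean of the second derivative in coordinate i. The two-point form, uniform in x, is
    what the induction on l can integrate. *)
Lemma gmean_heat l j : uniq l -> exists C : R, forall x (t t' : R),
  (forall i, i \in l -> 0 <= v t i) -> (forall i, i \in l -> 0 <= v t' i) ->
  `|gmean l (v t') (F j) x - gmean l (v t) (F j) x
    - (t' - t) * \sum_(i <- l) ga i / 2 * gmean l (v t) (F (d i (d i j))) x|
  <= C * (t' - t) ^+ 2.
Proof.
elim: l j => [|i l IH] j ul.
  exists 0 => x t t' _ _.
  by rewrite /= big_nil mulr0 subr0 subrr normr0 mul0r.
have /= /andP[il ul'] := ul.
have [C HC] := IH j ul'.
pose K := \sum_(k <- l) `|ga k / 2| * (B (d i (d i (d k (d k j)))) * `|ga i|).
(* C pays for moving the variances of the tail, K for changing the head variance inside the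
   first-order terms of the tail, and the last summand for moving the head variance in F itself. *)
exists (C + K + B (d i (d i (d i (d i j)))) * ga i ^+ 2) => x t t' vt vt'.
have vl u : (forall k, k \in i :: l -> 0 <= v u k) -> forall k, k \in l -> 0 <= v u k.
  by move=> H k kl; apply: H; rewrite inE kl orbT.
have vi : 0 <= v t i by exact/vt/mem_head.
have vi' : 0 <= v t' i by exact/vt'/mem_head.
have dv : v t' i - v t i = (t' - t) * ga i by rewrite /v; ring.
have sl := smooth_family_gmean (v t) ul' sF.
have lip j0 := let '(conj gb gt) := smooth_family_slice j0 x sl il in
  gauss_heat_lip gb gt 0 vi vi'.
have heat := let '(conj gb gt) := smooth_family_slice j x sl il in
  gauss_heat gb gt 0 vi vi'.
rewrite big_cons /=.
set A := gaussE (fun y => gmean l (v t') (F j) (upd x i (Num.sqrt (v t' i) * y))).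
set A1 := gaussE (fun y => gmean l (v t) (F j) (upd x i (Num.sqrt (v t' i) * y))).
set A0 := gaussE (fun y => gmean l (v t) (F j) (upd x i (Num.sqrt (v t i) * y))).
pose S1 k := gaussE (fun y => gmean l (v t) (F (d k (d k j))) (upd x i (Num.sqrt (v t' i) * y))).
pose S0 k := gaussE (fun y => gmean l (v t) (F (d k (d k j))) (upd x i (Num.sqrt (v t i) * y))).
rewrite -/(S0 i).
have -> : \sum_(k <- l) ga k / 2 *
   gaussE (fun y => gmean l (v t) (F (d k (d k j))) (upd x i (Num.sqrt (v t i) * y)))
   = \sum_(k <- l) ga k / 2 * S0 k by [].
have H1 : `|A - A1 - (t' - t) * \sum_(k <- l) ga k / 2 * S1 k| <= C * (t' - t) ^+ 2.
  have GS : forall k, gint (fun y => ga k / 2 * gmean l (v t) (F (d k (d k j))) (upd x i (Num.sqrt (v t' i) * y))).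
    by move=> k; apply: gintZ; exact: Gi.
  have -> : \sum_(k <- l) ga k / 2 * S1 k = gaussE (fun y => \sum_(k <- l) ga k / 2 *
     gmean l (v t) (F (d k (d k j))) (upd x i (Num.sqrt (v t' i) * y))).
    rewrite gaussE_sum//; apply: eq_bigr => k _.
    by rewrite gaussEZ//; exact: Gi.
  rewrite -gaussEZ; last exact: gint_sum.
  rewrite -!gaussEB; try by do ?[exact: Gi|apply: gintB|apply: gintZ|exact: gint_sum].
  apply: gaussE_bound => [|y]; first by do ?[exact: Gi|apply: gintB|apply: gintZ|exact: gint_sum].
  by apply: HC; exact: vl.
have H2 : `|(t' - t) * \sum_(k <- l) ga k / 2 * S1 k - (t' - t) * \sum_(k <- l) ga k / 2 * S0 k| <= K * (t' - t) ^+ 2.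
  rewrite -mulrBr normrM -sumrB.
  apply: (@le_trans _ _ (`|t' - t| * \sum_(k <- l) `|ga k / 2| * (B (d i (d i (d k (d k j)))) * (`|t' - t| * `|ga i|)))).
    apply: ler_wpM2l => //; apply: (le_trans (ler_norm_sum _ _ _)).
    apply: ler_sum => k _; rewrite -mulrBr normrM; apply: ler_wpM2l => //.
    have := lip (d k (d k j)); rewrite dv normrM; exact.
  rewrite -(real_normK (num_real (t' - t))) /K mulr_suml mulr_sumr le_eqVlt.
  apply/orP; left; apply/eqP; apply: eq_bigr => k _.
  by move: (B _) => b; rewrite expr2; ring.
have H3 : `|A1 - A0 - (t' - t) * (ga i / 2 * S0 i)| <= B (d i (d i (d i (d i j)))) * ga i ^+ 2 * (t' - t) ^+ 2.
  have := heat; rewrite dv /= -/A1 -/A0 -/(S0 i) exprMn.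
  rewrite -(mulrA (B _)) [ga i ^+ 2 * _]mulrC.
  suff -> : (t' - t) * (ga i / 2 * S0 i) = (t' - t) * ga i / 2 * S0 i by [].
  by ring.
have -> : A - A0 - (t' - t) * (ga i / 2 * S0 i + \sum_(k <- l) ga k / 2 * S0 k) =
  (A - A1 - (t' - t) * \sum_(k <- l) ga k / 2 * S1 k) +
  ((t' - t) * \sum_(k <- l) ga k / 2 * S1 k - (t' - t) * \sum_(k <- l) ga k / 2 * S0 k) +
  (A1 - A0 - (t' - t) * (ga i / 2 * S0 i)) by ring.
rewrite 2![(_ + _) * (t' - t) ^+ 2]mulrDl.
apply: (le_trans (ler_normD _ _)); apply: lerD => //.
by apply: (le_trans (ler_normD _ _)); exact: lerD.
Qed.

End Family.
End IteratedGaussianMean.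

(** * Averages over independent replicas *)

Section Replicas.
Context {R : realType} {S : finType} (s0 : S).
Implicit Types (w : S -> R) (f g : (nat -> S) -> R) (s : nat -> S) (n : nat).

(* A replicated configuration is a sequence; [avg w n f] averages the first [n]
   replicas independently with weights [w] and freezes the others at [s0]. *)
Fixpoint avg w n f : R :=
  if n is n'.+1 then \sum_(a : S) w a * avg w n' (fun s => f (upd s n' a))
  else f (fun=> s0).

Definition local_at n f := forall s s', (forall k, (k < n)%N -> s k = s' k) -> f s = f s'.

Lemma local_at_le n m f : (n <= m)%N -> local_at n f -> local_at m f.
Proof. by move=> nm lf s s' H; apply: lf => k kn; apply: H; exact: leq_trans nm. Qed.

Lemma local_at_upd n f s k a : local_at n f -> (n <= k)%N -> f (upd s k a) = f s.
Proof.
move=> lf nk; apply: lf => m mn; rewrite upd_other//.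
by rewrite neq_ltn (leq_trans mn nk).
Qed.

Lemma eq_avg_supp w n f g :
  (forall s, (forall k, (n <= k)%N -> s k = s0) -> f s = g s) -> avg w n f = avg w n g.
Proof.
elim: n f g => [|n IH] f g fg /=; first exact: fg.
apply: eq_bigr => a _; congr (_ * _); apply: IH => s Hs; apply: fg => k nk.
by rewrite upd_other ?Hs ?(ltnW nk)// gt_eqF.
Qed.

Lemma eq_avg w n f g : f =1 g -> avg w n f = avg w n g.
Proof. by move=> fg; apply: eq_avg_supp => s _. Qed.

Lemma avg_lin w n (a b : R) f g :
  avg w n (fun s => a * f s + b * g s) = a * avg w n f + b * avg w n g.
Proof.
elim: n f g => //= n IH f g; rewrite !mulr_sumr -big_split/=; apply: eq_bigr => c _.
by rewrite IH; ring.
Qed.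

Lemma avgZ w n (a : R) f : avg w n (fun s => a * f s) = a * avg w n f.
Proof.
have := avg_lin w n a 0 f f; rewrite mul0r addr0 => <-.
by apply: eq_avg => s; rewrite mul0r addr0.
Qed.

Lemma avg_le w n f g : (forall a, 0 <= w a) -> (forall s, f s <= g s) ->
  avg w n f <= avg w n g.
Proof.
move=> w0; elim: n f g => [|n IH] f g fg /=; first exact: fg.
by apply: ler_sum => a _; apply: ler_wpM2l => //; apply: IH => s; exact: fg.
Qed.

(** Bounding the weights by 1 gives a bound free of the disorder, as [smooth_family] demands. *)
Lemma avg_norm_le w n f : (forall a, 0 <= w a <= 1) ->
  `|avg w n f| <= avg (fun=> 1) n (fun s => `|f s|).
Proof.
move=> w01; elim: n f => //= n IH f.
apply: (le_trans (ler_norm_sum _ _ _)); apply: ler_sum => a _.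
have /andP[w0 w1] := w01 a; rewrite normrM ger0_norm//.
by apply: ler_pM => //; exact: IH.
Qed.

Section Probability.
Variable w : S -> R.
Hypothesis w1 : \sum_a w a = 1.

Lemma avg_local n m f : (n <= m)%N -> local_at n f -> avg w m f = avg w n f.
Proof.
move=> /subnK <- lf; elim: (m - n)%N => //= k IH.
under eq_bigr => a _.
  rewrite (eq_avg _ _ (g := f)); first over.
  by move=> s; apply: (local_at_upd _ _ lf); rewrite leq_addl.
by rewrite -mulr_suml w1 mul1r IH.
Qed.

Lemma avg_cst n (c : R) : avg w n (fun=> c) = c.
Proof. by rewrite (@avg_local 0). Qed.

(** A product measure is unchanged when one coordinate is drawn again. This exhibits the dependence
    on replica l as one explicit sum. *)
Lemma avg_resample n l f : (l < n)%N ->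
  avg w n f = \sum_a w a * avg w n (fun s => f (upd s l a)).
Proof.
elim: n f => // n IH f; rewrite ltnS leq_eqVlt => /predU1P[->|ln].
  under [RHS]eq_bigr => a _.
    rewrite (_ : avg w n.+1 _ = avg w n (fun s => f (upd s n a))); first over.
    rewrite /=; under eq_bigr => c _.
      rewrite (eq_avg _ _ (g := fun s => f (upd s n a))); first over.
      by move=> s; rewrite upd_upd.
    by rewrite -mulr_suml w1 mul1r.
  by [].
rewrite /=; under eq_bigr => a _ do rewrite IH// mulr_sumr.
rewrite exchange_big/=; apply: eq_bigr => c _; rewrite mulr_sumr; apply: eq_bigr => a _.
rewrite mulrCA; congr (_ * (_ * _)); apply: eq_avg => s.
by rewrite updC// ltn_eqF.
Qed.

Definition swap (a b k : nat) : nat := if k == a then b else if k == b then a else k.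

(** Once both replicas are resampled, exchanging them only renames two summation indices. *)
Lemma avg_swap n a b f : (a < n)%N -> (b < n)%N -> a != b ->
  avg w n (fun s => f (s \o swap a b)) = avg w n f.
Proof.
move=> an bn ab.
have dbl g : avg w n g = \sum_c \sum_e w c * w e * avg w n (fun s => g (upd (upd s b e) a c)).
  rewrite (avg_resample _ an); apply: eq_bigr => c _.
  rewrite (avg_resample _ bn) mulr_sumr; apply: eq_bigr => e _.
  by rewrite mulrA.
rewrite dbl exchange_big/= dbl; apply: eq_bigr => c _; apply: eq_bigr => e _.
rewrite [w e * _]mulrC; congr (_ * _); apply: eq_avg => s; congr f.
apply/funext => k; rewrite /= /swap /upd.
have [_|ka] := eqVneq k a; first by rewrite eq_sym (negbTE ab) eqxx.
have [_|kb] := eqVneq k b; first by rewrite eqxx.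
by rewrite (negbTE ka) (negbTE kb).
Qed.

(* [T] is an involution, and the function averaged to zero by the two points of
   every orbit does not see the other dependence on replica [l]. *)
Lemma avg_flip0 n l (T : S -> S) (u : S -> R) f : (l < n)%N -> involutive T ->
  (forall a, w a * u a + w (T a) * u (T a) = 0) ->
  (forall s, f (upd s l (T (s l))) = f s) ->
  avg w n (fun s => u (s l) * f s) = 0.
Proof.
move=> ln TT uT fT; rewrite (avg_resample _ ln).
pose G a := w a * u a * avg w n (fun s => f (upd s l a)).
have E : \sum_a w a * avg w n (fun s => u (upd s l a l) * f (upd s l a)) = \sum_a G a.
  apply: eq_bigr => a _; rewrite /G -mulrA; congr (_ * _); rewrite -avgZ; apply: eq_avg => s.
  by rewrite upd_same.
have GT a : G (T a) = - G a.
  rewrite /G -mulNr; congr (_ * _); first by apply/eqP; rewrite -addr_eq0 addrC uT.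
  by apply: eq_avg => s; rewrite -[RHS]fT upd_upd upd_same.
rewrite E; have : \sum_a G a = - \sum_a G a.
  by rewrite {1}(reindex_inj (inv_inj TT))/= -sumrN; apply: eq_bigr => a _.
by move=> /eqP; rewrite -subr_eq0 opprK -mulr2n -mulr_natl mulf_eq0 pnatr_eq0/= => /eqP.
Qed.

End Probability.

Definition trunc n s k := if (k < n)%N then s k else s0.

Lemma local_at_trunc n f s : local_at n f -> f (trunc n s) = f s.
Proof. by apply => k kn; rewrite /trunc kn. Qed.

Lemma is_derive_sum_seq (T : Type) (r : seq T) (h : T -> R -> R) (dh : T -> R) (y : R) :
  (forall a, is_derive y 1 (h a) (dh a)) ->
  is_derive y 1 (fun y => \sum_(a <- r) h a y) (\sum_(a <- r) dh a).
Proof.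
move=> H; elim: r => [|a r IH].
  rewrite big_nil; have -> : (fun y => \sum_(a <- [::]) h a y) = cst 0.
    by apply/funext => z; rewrite big_nil.
  exact: is_derive_cst.
rewrite big_cons; have -> : (fun y => \sum_(a <- a :: r) h a y) = h a + (fun y => \sum_(a <- r) h a y).
  by apply/funext => z; rewrite big_cons.
exact: is_deriveD.
Qed.

(** W (A - m) is the derivative of a Gibbs weight when m is the Gibbs mean of A; the product rule
    collects one such factor per replica. *)
Lemma is_derive_avg (W : R -> S -> R) (A : S -> R) (y m : R) :
  (forall a, is_derive y 1 (W^~ a) (W y a * (A a - m))) ->
  forall n f, is_derive y 1 (fun y => avg (W y) n f)
    (\sum_(l < n) avg (W y) n (fun s => A (s l) * f s) - n%:R * m * avg (W y) n f).
Proof.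
move=> dW; elim=> [|n IH] f /=.
  rewrite big_ord0 !mul0r subrr; exact: is_derive_cst.
have D : forall a, is_derive y 1 (fun y => W y a * avg (W y) n (fun s => f (upd s n a)))
   (W y a * (\sum_(l < n) avg (W y) n (fun s => A (s l) * f (upd s n a))
      - n%:R * m * avg (W y) n (fun s => f (upd s n a)))
   + avg (W y) n (fun s => f (upd s n a)) * (W y a * (A a - m))).
  move=> a; have D := is_deriveM (dW a) (IH (fun s => f (upd s n a))).
  by apply: (is_derive_eq D).
apply: (is_derive_eq (is_derive_sum_seq _ D)).
rewrite big_ord_recr/= exchange_big/=. rewrite mulr_sumr -big_split/= -sumrB.
apply: eq_bigr => a _.
have -> : avg (W y) n (fun s => A (upd s n a n) * f (upd s n a)) = A a * avg (W y) n (fun s => f (upd s n a)).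
  by rewrite -avgZ; apply: eq_avg => s; rewrite upd_same.
have -> : \sum_(l < n) W y a * avg (W y) n (fun s => A (upd s n a l) * f (upd s n a)) =
  W y a * \sum_(l < n) avg (W y) n (fun s => A (s l) * f (upd s n a)).
  rewrite mulr_sumr; apply: eq_bigr => l _; congr (_ * _); apply: eq_avg => s.
  by rewrite upd_other// ltn_eqF.
by rewrite -addn1 natrD; ring.
Qed.

End Replicas.

(** * Gibbs averages as smooth functions of the disorder *)

Section Taylor.
Context {R : realType}.

Lemma taylor2_le (g0 g1 g2 : R -> R) (B : R) :
  (forall y : R, is_derive y 1 g0 (g1 y)) -> (forall y : R, is_derive y 1 g1 (g2 y)) ->
  (forall y, `|g2 y| <= B) ->
  forall y h, `|g0 (y + h) - g0 y - h * g1 y| <= B * h ^+ 2.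
Proof.
move=> d0 d1 gB y h.
have MV (f df : R -> R) : (forall y : R, is_derive y 1 f (df y)) -> forall a c,
    exists z, `|z - a| <= `|c - a| /\ f c - f a = df z * (c - a).
  move=> fd a c; have cf := is_derive_continuous fd.
  have [ac|ca|<-] := ltgtP a c.
  - have [z] := MVT ac (fun x _ => fd x) (continuous_subspaceT cf).
    rewrite in_itv/= => /andP[az zc] E; exists z; split => //.
    by rewrite !gtr0_norm ?subr_gt0// lerD2r ltW.
  - have [z] := MVT ca (fun x _ => fd x) (continuous_subspaceT cf).
    rewrite in_itv/= => /andP[cz za] E; exists z; split => //.
      by rewrite !ltr0_norm ?subr_lt0// lerN2 lerD2r ltW.
    by rewrite -opprB E; ring.
  - by exists a; split => //; rewrite !subrr mulr0.
have [z [zy E0]] := MV _ _ d0 y (y + h).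
have [z' [_ E1]] := MV _ _ d1 y z.
have hE : y + h - y = h by ring.
rewrite hE in zy E0.
rewrite E0 mulrC -mulrBr E1 !normrM.
rewrite -(real_normK (num_real h)) expr2 [leRHS]mulrCA.
by apply: ler_wpM2l => //; exact: ler_pM.
Qed.

End Taylor.

(** The left side is the integrand after two derivatives: u2 is f, u1 the sum of a over the n = u5
    replicas, u3 and u4 the values at the two new ones. The next identity is applied after
    exchanging the new replicas in the last term, with u6 for n times the constant square. *)
Lemma replica_poly_identity (R : realType) (u1 u2 u3 u4 u5 : R) :
  u2 * (u1 - u5 * u3) * (u1 + u3 - (u5 + 1) * u4) =
  u2 * (u1 ^+ 2 - u5 * u3 ^+ 2 + (1 - u5) * (u1 * u3) + u5 * (u5 + 1) * (u3 * u4)) -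
  (u5 + 1) * (u2 * u1 * u4).
Proof. by ring. Qed.

Lemma replica_poly_identity2 (R : realType) (u1 u2 u3 u4 u5 u6 : R) :
  u2 * (u1 ^+ 2 - u6 + (1 - u5) * (u1 * u3) + u5 * (u5 + 1) * (u3 * u4)) -
  (u5 + 1) * (u2 * u1 * u3) =
  u2 * (u1 ^+ 2 - u6 - 2 * u5 * (u1 * u3) + u5 * (u5 + 1) * (u3 * u4)).
Proof. by ring. Qed.

Section GibbsFamily.
Context {R : realType} {S I : finType} (s0 : S) (a : I -> S -> R) (b : S -> R).
Implicit Types (x : I -> R) (n : nat) (i : I) (j : nat * ((nat -> S) -> R)).

Definition energy x s : R := \sum_i x i * a i s + b s.
Definition gweight x s : R := expR (energy x s) / \sum_c expR (energy x c).

Lemma gibbs_Z_gt0 x : 0 < \sum_c expR (energy x c).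
Proof.
rewrite (bigD1 s0)//= ltr_pwDl ?expR_gt0//.
by apply: sumr_ge0 => c _; exact: expR_ge0.
Qed.

Lemma gweight_ge0 x s : 0 <= gweight x s.
Proof. by rewrite divr_ge0 ?expR_ge0 ?ltW// gibbs_Z_gt0. Qed.

Lemma gweight_sum x : \sum_s gweight x s = 1.
Proof. by rewrite -mulr_suml divff// gt_eqF// gibbs_Z_gt0. Qed.

Lemma gweight_le1 x s : 0 <= gweight x s <= 1.
Proof.
rewrite gweight_ge0 -(gweight_sum x) (bigD1 s)//= lerDl.
by apply: sumr_ge0 => c _; exact: gweight_ge0.
Qed.

Definition gfam j x : R := avg s0 (gweight x) j.1 j.2.

(** Differentiating the normalisation introduces a new replica carrying the Gibbs mean of a i.
    [trunc] keeps f from seeing that replica even when f is not local. *)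
Definition gder i j : nat * ((nat -> S) -> R) :=
  (j.1.+1, fun s => j.2 (trunc s0 j.1 s) * (\sum_(l < j.1) a i (s l) - j.1%:R * a i (s j.1))).

Definition gbound j : R := avg s0 (fun=> 1) j.1 (fun s => `|j.2 s|).

Lemma energy_upd x i y s : energy (upd x i y) s = energy x s + (y - x i) * a i s.
Proof.
rewrite /energy (bigD1 i)//= [in RHS](bigD1 i)//= upd_same.
have -> : \sum_(k | k != i) upd x i y k * a k s = \sum_(k | k != i) x k * a k s.
  by apply: eq_bigr => k ki; rewrite upd_other.
by ring.
Qed.

Lemma is_derive_gweight x i s (y : R) :
  let w y := gweight (upd x i y) in
  is_derive y 1 (w^~ s) (w y s * (a i s - \sum_c w y c * a i c)).
Proof.
move=> w; pose E c (y : R) := expR (energy (upd x i y) c).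
have dE c : is_derive y 1 (E c) (E c y * a i c).
  have -> : E c = expR \o (fun y => energy x c + (y - x i) * a i c).
    by apply/funext => z; rewrite /E/= energy_upd.
  apply: is_derive1_comp; apply: is_derive_eq.
  by rewrite /GRing.scale/=; ring.
have dZ := is_derive_sum_seq (index_enum S) dE.
have Z0 : \sum_c E c y != 0 by rewrite gt_eqF// gibbs_Z_gt0.
have -> : (fun y => w y s) = E s * (fun y => (\sum_c E c y)^-1) by [].
have D := is_deriveM (dE s) (is_deriveV Z0 dZ).
apply: (is_derive_eq D); rewrite /w /gweight -/(E _ _) /GRing.scale/=.
have -> : \sum_c E c y / (\sum_e E e y) * a i c = (\sum_c E c y * a i c) / \sum_c E c y.
  by rewrite mulr_suml; apply: eq_bigr => c _; rewrite mulrAC.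
by field.
Qed.

Lemma is_derive_gfam x i j (y : R) :
  is_derive y 1 (fun y => gfam j (upd x i y)) (gfam (gder i j) (upd x i y)).
Proof.
have D := is_derive_avg s0 (fun s => is_derive_gweight x i s y) j.1 j.2.
apply: (is_derive_eq D); case: j {D} => n f /=.
rewrite /gfam/=; set w := gweight _.
have -> : \sum_c w c * avg s0 w n (fun s => f (trunc s0 n (upd s n c)) *
      (\sum_(l < n) a i (upd s n c l) - n%:R * a i (upd s n c n))) =
   \sum_c w c * (\sum_(l < n) avg s0 w n (fun s => a i (s l) * f s) - n%:R * (a i c * avg s0 w n f)).
  apply: eq_bigr => c _; congr (_ * _).
  have -> : \sum_(l < n) avg s0 w n (fun s => a i (s l) * f s) = avg s0 w n (fun s => (\sum_(l < n) a i (s l)) * f s).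
    elim: (index_enum _) => [|l r IH].
      rewrite big_nil -[LHS](mul0r (avg s0 w n f)) -avgZ.
      by apply: eq_avg => s; rewrite big_nil.
    rewrite big_cons IH -[X in X + _]mul1r -[X in _ + X]mul1r -avg_lin.
    by apply: eq_avg => s; rewrite big_cons; ring.
  have E (X A : R) : X - n%:R * (a i c * A) = 1 * X + (- (n%:R * a i c)) * A by ring.
  rewrite E -avg_lin.
  apply: eq_avg_supp => s Hs; rewrite upd_same.
  have -> : trunc s0 n (upd s n c) = s.
    apply/funext => k; rewrite /trunc; case: ltnP => [kn|nk]; last by rewrite Hs.
    by rewrite upd_other// ltn_eqF.
  have -> : \sum_(l < n) a i (upd s n c l) = \sum_(l < n) a i (s l).
    by apply: eq_bigr => l _; rewrite upd_other// ltn_eqF.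
  by ring.
under [RHS]eq_bigr do rewrite mulrBr.
rewrite sumrB -mulr_suml gweight_sum mul1r; congr (_ - _).
rewrite mulr_sumr mulr_suml.
by apply: eq_bigr => c _; ring.
Qed.

Lemma gfam_smooth : smooth_family gder gbound predT gfam.
Proof.
split=> [j x|i j x h _].
  by apply: avg_norm_le => s; exact: gweight_le1.
have := @taylor2_le _ (fun y => gfam j (upd x i y)) _ _ (gbound (gder i (gder i j)))
  (is_derive_gfam x i j) (is_derive_gfam x i (gder i j)) _ (x i) h.
rewrite upd_id; apply => y.
by apply: avg_norm_le => s; exact: gweight_le1.
Qed.

(* The terms with equal replicas cancel because [a i] has constant square. *)
Lemma gfam_gder2 i n f x (ka : R) : (forall s, a i s ^+ 2 = ka) -> local_at n f ->
  gfam (gder i (gder i (n, f))) x = gfam (n.+2, fun s => f s *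
   (((\sum_(l < n) a i (s l)) ^+ 2 - n%:R * ka)
    - 2 * n%:R * ((\sum_(l < n) a i (s l)) * a i (s n))
    + n%:R * (n%:R + 1) * (a i (s n) * a i (s n.+1)))) x.
Proof.
move=> aka lf.
rewrite -[LHS]/(avg s0 (gweight x) n.+2 (gder i (gder i (n, f))).2).
rewrite -[RHS]/(avg s0 (gweight x) n.+2 _).
have w1 := gweight_sum x; set w := gweight x in w1 *.
pose P s := \sum_(l < n) a i (s (nat_of_ord l)).
have Psw s : P (s \o swap n n.+1) = P s.
  by apply: eq_bigr => l _; rewrite /= /swap !ltn_eqF// ltnS ltnW.
have fsw s : f (s \o swap n n.+1) = f s.
  by apply: lf => k kn; rewrite /= /swap !ltn_eqF// ltnS ltnW.
have sw : avg s0 w n.+2 (fun s => f s * P s * a i (s n.+1)) =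
          avg s0 w n.+2 (fun s => f s * P s * a i (s n)).
  rewrite -(@avg_swap _ _ s0 w w1 n.+2 n n.+1)// ?ltn_eqF//.
  by apply: eq_avg => s; rewrite Psw fsw /= /swap eqxx gtn_eqF.
transitivity (1 * avg s0 w n.+2 (fun s => f s * ((P s) ^+ 2 - n%:R * ka +
    (1 - n%:R) * (P s * a i (s n)) + n%:R * (n%:R + 1) * (a i (s n) * a i (s n.+1))))
   + (- (n%:R + 1)) * avg s0 w n.+2 (fun s => f s * P s * a i (s n.+1))).
  rewrite -avg_lin; apply: eq_avg => s /=.
  have -> : trunc s0 n (trunc s0 n.+1 s) = trunc s0 n s.
    apply/funext => k; rewrite /trunc; case: ltnP => // kn.
    by rewrite ltnS ltnW.
  rewrite local_at_trunc//.
  have -> : \sum_(l < n) a i (trunc s0 n.+1 s l) = P s.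
    by apply: eq_bigr => l _; rewrite /trunc ltnS ltnW.
  rewrite big_ord_recr/= -/(P s) /trunc ltnSn.
  have -> : n.+1%:R = n%:R + 1 :> R by rewrite -addn1 natrD.
  rewrite -[in RHS](aka (s n)).
  by rewrite mul1r mulNr replica_poly_identity.
rewrite sw -avg_lin; apply: eq_avg => s.
by rewrite mul1r mulNr replica_poly_identity2.
Qed.

End GibbsFamily.

(** * Functions on [0, 1] with a quadratic Taylor remainder *)

Section QuadraticPath.
Context {R : realType}.
Implicit Types (phi psi : R -> R).

(* [psi] is the derivative of [phi] on [0, 1], endpoints included. *)
Definition quad_path phi psi := exists C : R, forall t t',
  0 <= t <= 1 -> 0 <= t' <= 1 ->
  `|psi t| <= C /\ `|phi t' - phi t - (t' - t) * psi t| <= C * (t' - t) ^+ 2.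

(** Composing with this map extends a path from [0, 1] to a continuous function on the line, to
    which the mean and extreme value theorems apply. *)
Definition clamp (t : R) : R := Num.max 0 (Num.min t 1).

Lemma clamp_id t : 0 <= t <= 1 -> clamp t = t.
Proof. by move=> /andP[t0 t1]; rewrite /clamp min_l// max_r. Qed.

Lemma clamp_01 t : 0 <= clamp t <= 1.
Proof. by rewrite /clamp le_max lexx/= ge_max ler01 ge_min lexx orbT. Qed.

Lemma clamp_lip t t' : `|clamp t' - clamp t| <= `|t' - t|.
Proof.
wlog tt : t t' / t <= t' => [H|].
  by have [/H//|/ltW/H] := leP t t'; rewrite distrC [leRHS]distrC.
have l01 : 0 <= 1 :> R by []. 
rewrite [leRHS]ger0_norm ?subr_ge0// /clamp.
by case: (leP t 1) => t1; case: (leP t' 1) => t1'; do ?rewrite (max_r l01);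
  case: (leP 0 t) => t0; case: (leP 0 t') => t0'; apply/ler_normlP; split; lra.
Qed.

Lemma quad_path_continuous phi psi : quad_path phi psi -> continuous (phi \o clamp).
Proof.
move=> [C H]; apply: (@continuous_dist_le _ _ (C + C)) => x y /=.
have [B1 B2] := H _ _ (clamp_01 y) (clamp_01 x).
have dxy := clamp_lip y x; set dl := clamp x - clamp y in B2 dxy.
have C0 : 0 <= C by exact: le_trans (normr_ge0 _) B1.
have dl1 : `|dl| <= 1.
  by have := clamp_01 x; have := clamp_01 y => ? ?; apply/ler_normlP; rewrite /dl; split; lra.
have -> : phi (clamp x) - phi (clamp y) =
  (phi (clamp x) - phi (clamp y) - dl * psi (clamp y)) + dl * psi (clamp y) by ring.
apply: (le_trans (ler_normD _ _)); rewrite [(C + C) * _]mulrDl; apply: lerD.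
  apply: (le_trans B2); apply: ler_wpM2l => //.
  rewrite -(real_normK (num_real dl)); apply: le_trans dxy.
  by have := normr_ge0 dl; rewrite expr2; nra.
by rewrite normrM mulrC; apply: ler_pM.
Qed.

Lemma quad_path_MVT phi psi t t' : quad_path phi psi -> 0 <= t -> t < t' -> t' <= 1 ->
  exists c, [/\ 0 <= c, c <= 1 & phi t' - phi t = (t' - t) * psi c].
Proof.
move=> qp t0 tt t1.
have cc := quad_path_continuous qp.
have D (x : R) : x \in `]t, t'[ -> is_derive x 1 (phi \o clamp) (psi x).
  rewrite in_itv/= => /andP[tx xt].
  have [C H] := qp.
  have x0 : 0 < x by exact: le_lt_trans tx.
  have x1 : x < 1 by exact: lt_le_trans t1.
  apply: (@is_derive_taylor _ _ _ _ C (Num.min x (1 - x))).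
    by rewrite lt_min x0 subr_gt0.
  move=> h; rewrite lt_min !ltr_norml => /andP[h1 h2] /=.
  have x01 : 0 <= x <= 1 by lra.
  have xh01 : 0 <= x + h <= 1 by lra.
  rewrite !clamp_id//; have [_] := H _ _ x01 xh01.
  by rewrite (_ : x + h - x = h)//; ring.
have [c] := MVT tt D (continuous_subspaceT cc).
rewrite in_itv/= => /andP[tc ct]; rewrite /= !clamp_id; try lra; move=> E.
by exists c; split; [lra|lra|rewrite E mulrC].
Qed.

Lemma quad_path_le phi psi M : quad_path phi psi ->
  (forall t, 0 <= t <= 1 -> `|psi t| <= M) -> `|phi 1 - phi 0| <= M.
Proof.
move=> qp pM; have [c [c0 c1 ->]] := quad_path_MVT qp (lexx 0) ltr01 (lexx 1).
by rewrite subr0 mul1r; apply: pM; rewrite c0 c1.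
Qed.

Lemma quad_path2_le phi psi psi2 M : quad_path phi psi -> quad_path psi psi2 ->
  (forall t, 0 <= t <= 1 -> `|psi2 t| <= M) -> `|phi 1 - phi 0 - psi 0| <= M.
Proof.
move=> qp qp2 pM; have [c [c0 c1 ->]] := quad_path_MVT qp (lexx 0) ltr01 (lexx 1).
have M0 : 0 <= M by apply: le_trans (pM 0 _); rewrite ?normr_ge0 ?lexx ?ler01.
rewrite subr0 mul1r; move: c0; rewrite le_eqVlt => /predU1P[<-|c0].
  by rewrite subrr normr0.
have [e [e0 e1 ->]] := quad_path_MVT qp2 (lexx 0) c0 c1.
rewrite subr0 normrM (gtr0_norm c0) -[leRHS]mul1r; apply: ler_pM => //; first exact: ltW.
by apply: pM; rewrite e0 e1.
Qed.

(** At a maximum point c the mean value theorem on [c, 1] gives phi c <= phi 1 + ka phi c, hence phi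
    c <= phi 1 / (1 - ka), and ka <= 1/4. The control runs backwards, from the true model at t =
    1. *)
Lemma quad_path_gronwall phi psi (ka t : R) : quad_path phi psi -> 0 <= ka <= 1 / 4 ->
  (forall t, 0 <= t <= 1 -> 0 <= phi t) ->
  (forall t, 0 <= t <= 1 -> `|psi t| <= ka * phi t) -> 0 <= t <= 1 ->
  phi t <= 4 / 3 * phi 1.
Proof.
move=> qp /andP[k0 k1] pos H t01.
have [c] := @EVT_max _ (phi \o clamp) 0 1 ler01 (continuous_subspaceT (quad_path_continuous qp)).
rewrite in_itv/= => c01 cmax.
have phic : phi c <= phi 1 + ka * phi c.
  have /andP[c0] := c01; rewrite le_eqVlt => /predU1P[->|c1].
    rewrite lerDl; apply: le_trans (H 1 _); first exact: normr_ge0.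
    by rewrite ler01 lexx.
  have [e [e0 e1 E]] := quad_path_MVT qp c0 c1 (lexx 1).
  have e01 : 0 <= e <= 1 by rewrite e0 e1.
  have /= := cmax e; rewrite in_itv/= !clamp_id// => /(_ e01) ec.
  have := H e e01; rewrite ler_norml => /andP[He _].
  have : ka * phi e <= ka * phi c by exact: ler_wpM2l.
  have p0 : 0 <= ka * phi e by apply: le_trans (H e e01); exact: normr_ge0.
  by nra.
have /= := cmax t; rewrite in_itv/= !clamp_id// => /(_ t01) tc.
have := pos c c01; nra.
Qed.

End QuadraticPath.

(** * Quenched averages and their derivative along a Gaussian interpolation *)

Section QuenchedMean.
Context {R : realType} {S I : finType} (s0 : S) (a : I -> S -> R) (b : S -> R).
Variable L : seq I.
Hypothesis uL : uniq L.
Implicit Types (v : I -> R) (n : nat) (f g : (nat -> S) -> R) (s : nat -> S).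

Let sF := gfam_smooth s0 a b.

Definition qmean v n f : R := gmean L v (gfam s0 a b (n, f)) (fun=> 0).

Lemma qmean_lin v n (c e : R) f g :
  qmean v n (fun s => c * f s + e * g s) = c * qmean v n f + e * qmean v n g.
Proof. by apply: (gmean_lin sF) => // x; exact: avg_lin. Qed.

Lemma eq_qmean v n f g : f =1 g -> qmean v n f = qmean v n g.
Proof. by move=> /funext ->. Qed.

Lemma qmeanZ v n (c : R) f : qmean v n (fun s => c * f s) = c * qmean v n f.
Proof.
rewrite -[RHS]addr0 -(mul0r (qmean v n f)) -qmean_lin; apply: eq_qmean => s.
by rewrite mul0r addr0.
Qed.

Lemma qmeanD v n f g : qmean v n (fun s => f s + g s) = qmean v n f + qmean v n g.
Proof.
rewrite -[qmean v n f]mul1r -[qmean v n g]mul1r -qmean_lin.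
by apply: eq_qmean => s; rewrite !mul1r.
Qed.

Lemma qmeanB v n f g : qmean v n (fun s => f s - g s) = qmean v n f - qmean v n g.
Proof.
rewrite -[qmean v n f]mul1r -mulN1r -qmean_lin.
by apply: eq_qmean => s; rewrite mul1r mulN1r.
Qed.

Lemma qmean_le v n f g : (forall s, f s <= g s) -> qmean v n f <= qmean v n g.
Proof.
move=> fg; apply: (gmean_le sF) => // x; apply: avg_le => // c.
exact: gweight_ge0.
Qed.

Lemma gmean_cst v (c : R) (l : seq I) x : gmean l v (fun=> c) x = c.
Proof.
elim: l x => //= i l IH x; under eq_fun do rewrite IH.
exact: gaussE_cst.
Qed.

Lemma qmean_cst v n (c : R) : qmean v n (fun=> c) = c.
Proof.
rewrite -[RHS](gmean_cst v c L (fun=> 0)); apply: gmean_eqF => x.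
by rewrite /gfam/= avg_cst// gweight_sum.
Qed.

Lemma qmean_ge0 v n f : (forall s, 0 <= f s) -> 0 <= qmean v n f.
Proof. by move=> f0; rewrite -(qmean_cst v n 0); exact: qmean_le. Qed.

Lemma qmean_norm_le v n f g : (forall s, `|f s| <= g s) -> `|qmean v n f| <= qmean v n g.
Proof.
move=> fg; apply/ler_normlP; split; last first.
  by apply: qmean_le => s; exact: le_trans (ler_norm _) (fg s).
rewrite -mulN1r -qmeanZ; apply: qmean_le => s.
by rewrite mulN1r (le_trans _ (fg s))// -normrN ler_norm.
Qed.

Lemma qmean_sum v n (T : Type) (r : seq T) (f : T -> (nat -> S) -> R) :
  qmean v n (fun s => \sum_(k <- r) f k s) = \sum_(k <- r) qmean v n (f k).
Proof.
elim: r => [|k r IH].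
  by rewrite big_nil -[RHS](qmean_cst v n 0); apply: eq_qmean => s; rewrite big_nil.
rewrite big_cons -IH -qmeanD; apply: eq_qmean => s.
by rewrite big_cons.
Qed.

Lemma qmean_local v n m f : (n <= m)%N -> local_at n f -> qmean v m f = qmean v n f.
Proof.
move=> nm lf; apply: gmean_eqF => x; apply: avg_local => //.
exact: gweight_sum.
Qed.

Lemma qmean_swap v n k l f : (k < n)%N -> (l < n)%N -> k != l ->
  qmean v n (fun s => f (s \o swap k l)) = qmean v n f.
Proof.
move=> kn ln kl; apply: gmean_eqF => x; apply: avg_swap => //.
exact: gweight_sum.
Qed.

Section Path.
Variables (al ga : I -> R) (ka : I -> R).
Let v (t : R) i : R := al i + t * ga i.
Hypothesis v_ge0 : forall (t : R) i, 0 <= t <= 1 -> i \in L -> 0 <= v t i.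
Hypothesis a_sqr : forall i (c : S), a i c ^+ 2 = ka i.

(** The t-derivative of the covariance of the energies of c and e. *)
Definition path_cov (c e : S) : R := \sum_(i <- L) ga i * (a i c * a i e).

(** The usual replica formula: the sum of [path_cov] over pairs l < m, minus n times the pairs with
    one new replica, plus n (n+1) / 2 times the pair of new replicas. The diagonal of the double sum
    is removed by subtracting n equal values, since each a i has constant square. *)
Definition path_kernel n s : R :=
  (\sum_(l < n) \sum_(m < n) path_cov (s l) (s m) - n%:R * path_cov (s 0) (s 0)) / 2
  - n%:R * \sum_(l < n) path_cov (s l) (s n)
  + n%:R * (n%:R + 1) / 2 * path_cov (s n) (s n.+1).

Lemma quad_path_qmean n f : local_at n f ->
  quad_path (fun t => qmean (v t) n f)
            (fun t => qmean (v t) n.+2 (fun s => f s * path_kernel n s)).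
Proof.
move=> lf; have [C H] := gmean_heat sF al ga (n, f) uL.
pose B := gbound s0 (n.+2, fun s => f s * path_kernel n s).
exists (`|C| + B) => t t' t01 t01'.
have B0 : 0 <= B.
  by apply: le_trans (gmean_bound sF (v t) (n.+2, fun s => f s * path_kernel n s) (fun=> 0) uL).
split; first by apply: (le_trans (gmean_bound sF _ _ _ uL)); rewrite lerDr.
have := H (fun=> 0) t t' (fun i => v_ge0 t01) (fun i => v_ge0 t01').
have -> : \sum_(i <- L) ga i / 2 * gmean L (fun i => al i + t * ga i)
    (gfam s0 a b (gder s0 a i (gder s0 a i (n, f)))) (fun=> 0) =
  qmean (v t) n.+2 (fun s => f s * path_kernel n s).
  transitivity (\sum_(i <- L) qmean (v t) n.+2 (fun s => ga i / 2 * (f s *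
   (((\sum_(l < n) a i (s l)) ^+ 2 - n%:R * ka i)
    - 2 * n%:R * ((\sum_(l < n) a i (s l)) * a i (s n))
    + n%:R * (n%:R + 1) * (a i (s n) * a i (s n.+1)))))).
    apply: eq_bigr => i _; rewrite qmeanZ; congr (_ * _); apply: gmean_eqF => x.
    by apply: gfam_gder2.
  rewrite -qmean_sum; apply: eq_qmean => s.
  rewrite /path_kernel /path_cov.
  have -> : \sum_(l < n) \sum_(m < n) \sum_(i <- L) ga i * (a i (s l) * a i (s m)) =
    \sum_(i <- L) ga i * (\sum_(l < n) a i (s l)) ^+ 2.
    under eq_bigr do rewrite exchange_big/=.
    rewrite exchange_big/=; apply: eq_bigr => i _.
    rewrite expr2 mulr_suml mulr_sumr; apply: eq_bigr => l _.
    by rewrite !mulr_sumr; apply: eq_bigr => m _.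
  have -> : \sum_(l < n) \sum_(i <- L) ga i * (a i (s l) * a i (s n)) =
    \sum_(i <- L) ga i * ((\sum_(l < n) a i (s l)) * a i (s n)).
    rewrite exchange_big/=; apply: eq_bigr => i _.
    by rewrite mulr_suml mulr_sumr.
  rewrite !mulr_sumr -sumrB mulr_suml -sumrB -big_split/= mulr_sumr.
  apply: eq_bigr => i _; rewrite -(a_sqr i (s 0)).
  by move: (\sum_(l < n) _) => P; field.
move=> H'; apply: (le_trans H'); apply: ler_wpM2r; first exact: sqr_ge0.
by rewrite (le_trans (ler_norm _))// lerDl.
Qed.

End Path.
End QuenchedMean.

(** * The interpolation at a site and its decoupled starting point *)

Section Spins.
Context {R : realType} {N : nat}.
Implicit Types (c e : config N) (i j : 'I_N).

Lemma spin_sqr c i : spin R c i * spin R c i = 1.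
Proof. by rewrite /spin -expr2 sqrr_sign. Qed.

Lemma spin_norm c i : `|spin R c i| = 1.
Proof. by rewrite /spin normr_sign. Qed.

Definition flip i c : config N := [ffun j => if j == i then ~~ c j else c j].

Lemma flipK i : involutive (flip i).
Proof. by move=> c; apply/ffunP => j; rewrite !ffunE; case: (j == i) => //; rewrite negbK. Qed.

Lemma spin_flip i c : spin R (flip i c) i = - spin R c i.
Proof. by rewrite /spin ffunE eqxx signrN. Qed.

Lemma spin_flip_other i c j : j != i -> spin R (flip i c) j = spin R c j.
Proof. by rewrite /spin ffunE => /negbTE ->. Qed.

Lemma prod_spin_flip i c (A : seq 'I_N) : uniq A ->
  \prod_(j <- A) spin R (flip i c) j =
  (if i \in A then -1 else 1) * \prod_(j <- A) spin R c j.
Proof.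
elim: A => [_|k A IH /= /andP[kA uA]]; first by rewrite !big_nil mul1r.
rewrite !big_cons inE IH//; have [E|ik] := eqVneq i k.
  by subst k; rewrite spin_flip (negbTE kA)/= mul1r mulN1r mulNr.
by rewrite spin_flip_other 1?eq_sym//= mulrCA.
Qed.

Lemma prod_spin_sqr c (A : seq 'I_N) :
  (\prod_(j <- A) spin R c j) * (\prod_(j <- A) spin R c j) = 1.
Proof. by rewrite -big_split big1//= => j _; exact: spin_sqr. Qed.

End Spins.

Section Model.
Context {R : realType} (p : nat) (beta h q : R).

Definition field_coef : R := beta * (p%:R / 2) `^ (1 / 2) * q `^ ((p%:R - 1) / 2).

(* E[tanh^m (field_coef Y + h)] and the limit of the cavity covariances *)
Definition tau (m : nat) : R := tanh_moment p beta h q m.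
Definition cov_limit : R := field_coef ^+ 2.

Section Size.
Variable N : nat.
Local Notation S := (config N).
Local Notation J := (increasing_tuple N p + 'I_N)%type.
Implicit Types (i : 'I_N) (n : nat) (f g : (nat -> S) -> R) (s : nat -> S) (c e : S).

Let s0 : S := [ffun=> false].

Lemma uniq_increasing_tuple (A : increasing_tuple N p) : uniq (val (val A)).
Proof.
have /(sorted_uniq ltn_trans ltnn) := valP A.
exact: map_uniq.
Qed.

(* The coordinate [inr i] is the Gaussian field replacing, at the start of the
   interpolation at site [i], the couplings that involve this site. *)
Definition coupling (k : J) (c : S) : R :=
  match k with
  | inl A => beta * u R N p * \prod_(j <- val A) spin R c j
  | inr i => field_coef * spin R c i
  end.

Definition external (c : S) : R := h * \sum_(i < N) spin R c i.

Definition coords : seq J :=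
  [seq inr i | i <- index_enum 'I_N] ++ [seq inl A | A <- index_enum (increasing_tuple N p)].

Lemma uniq_coords : uniq coords.
Proof.
rewrite cat_uniq; apply/and3P; split.
- by rewrite map_inj_uniq ?index_enum_uniq// => ? ? [].
- by apply/hasPn => _ /mapP[A _ ->]; apply/mapP => -[].
- by rewrite map_inj_uniq ?index_enum_uniq// => ? ? [].
Qed.

(** At t = 0 the unit variances sit on the couplings avoiding i and on the field at i; at t = 1 they
    sit on all the couplings. Fields at other sites always have variance 0. *)
Definition path_al i (k : J) : R :=
  match k with inl A => (i \notin val A)%:R | inr j => (j == i)%:R end.
Definition path_ga i (k : J) : R :=
  match k with inl A => (i \in val A)%:R | inr j => - (j == i)%:R end.
Definition path_var i (t : R) (k : J) : R := path_al i k + t * path_ga i k.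

Lemma path_var_ge0 i (t : R) k : 0 <= t <= 1 -> k \in coords -> 0 <= path_var i t k.
Proof.
move=> /andP[t0 t1] _; rewrite /path_var; case: k => [A|j] /=.
  by case: (i \in _); rewrite /= ?mulr1 ?mulr0 ?add0r ?addr0.
by case: (j == i) => /=; lra.
Qed.

Definition coupling_sqr (k : J) : R :=
  match k with inl A => (beta * u R N p) ^+ 2 | inr i => field_coef ^+ 2 end.

Lemma couplingE2 k c : coupling k c ^+ 2 = coupling_sqr k.
Proof.
case: k => [A|i] /=; rewrite exprMn.
  by rewrite [X in _ * X]expr2 prod_spin_sqr mulr1.
by rewrite [X in _ * X]expr2 spin_sqr mulr1.
Qed.

Definition cmean i (t : R) n f : R := qmean s0 coupling external coords (path_var i t) n f.

Definition full_var (k : J) : R := match k with inl _ => 1 | inr _ => 0 end.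
Definition fmean n f : R := qmean s0 coupling external coords full_var n f.

Lemma cmean1 i n f : cmean i 1 n f = fmean n f.
Proof.
apply: gmean_eq_coef => k _; rewrite /path_var mul1r; case: k => [A|j] /=.
  by case: (i \in _) => /=; rewrite ?addr0 ?add0r.
by case: (j == i); rewrite /= subrr.
Qed.

(* the covariance, divided by the two spins at [i], of the couplings at [i] *)
Definition cavity_cov i c e : R := (beta * u R N p) ^+ 2 *
  (\sum_(A : increasing_tuple N p | i \in val A)
      \prod_(j <- val A) (spin R c j * spin R e j)) * (spin R c i * spin R e i).

Definition Wcov i c e : R := spin R c i * spin R e i * (cavity_cov i c e - cov_limit).

Lemma path_covE i c e : path_cov coupling coords (path_ga i) c e = Wcov i c e.
Proof.
have sp : (spin R c i * spin R e i) * (spin R c i * spin R e i) = 1.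
  by rewrite mulrACA !spin_sqr mulr1.
rewrite /path_cov /coords big_cat/= !big_map/=.
rewrite (bigD1 i)//= big1 ?addr0; last first.
  by move=> j /negbTE ji; rewrite ji oppr0 mul0r.
rewrite eqxx mulN1r addrC /Wcov mulrBr; congr (_ - _); last first.
  by rewrite /cov_limit; ring.
rewrite /cavity_cov mulrCA sp mulr1 [in RHS]big_mkcond/= mulr_sumr; apply: eq_bigr => A _.
rewrite big_split/=; case: (i \in _); rewrite ?mul1r ?mul0r ?mulr0//=.
by rewrite expr2; ring.
Qed.

(** Each product over a tuple containing i changes sign, and so does the explicit factor at i. *)
Lemma cavity_cov_flipl i c e : cavity_cov i (flip i c) e = cavity_cov i c e.
Proof.
rewrite /cavity_cov spin_flip.
have -> : \sum_(A : increasing_tuple N p | i \in val A)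
    \prod_(j <- val A) (spin R (flip i c) j * spin R e j) =
  - \sum_(A : increasing_tuple N p | i \in val A)
    \prod_(j <- val A) (spin R c j * spin R e j).
  rewrite -sumrN; apply: eq_bigr => A iA.
  by rewrite !big_split/= prod_spin_flip ?uniq_increasing_tuple// iA mulN1r mulNr.
by ring.
Qed.

Lemma cavity_covC i c e : cavity_cov i c e = cavity_cov i e c.
Proof.
rewrite /cavity_cov [spin R c i * _]mulrC; congr (_ * _ * _); apply: eq_bigr => A _.
by apply: eq_bigr => j _; rewrite mulrC.
Qed.

Lemma cavity_cov_flipr i c e : cavity_cov i c (flip i e) = cavity_cov i c e.
Proof. by rewrite cavity_covC cavity_cov_flipl cavity_covC. Qed.

Lemma WcovC i c e : Wcov i c e = Wcov i e c.
Proof. by rewrite /Wcov cavity_covC [spin R c i * _]mulrC. Qed.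

Definition kernel i n s : R :=
  (\sum_(l < n) \sum_(m < n) Wcov i (s l) (s m) - n%:R * Wcov i (s 0) (s 0)) / 2
  - n%:R * \sum_(l < n) Wcov i (s l) (s n)
  + n%:R * (n%:R + 1) / 2 * Wcov i (s n) (s n.+1).

(** The couplings have constant square. The diagonal values need not be small, but being equal they
    cancel in [kernel]. *)
Lemma Wcov_diag i c e : Wcov i c c = Wcov i e e.
Proof.
rewrite -!path_covE /path_cov; apply: eq_bigr => k _.
by rewrite -!expr2 !couplingE2.
Qed.

Lemma quad_path_cmean i n f : local_at n f ->
  quad_path (fun t => cmean i t n f) (fun t => cmean i t n.+2 (fun s => f s * kernel i n s)).
Proof.
move=> lf.
have := quad_path_qmean s0 external uniq_coords (@path_var_ge0 i) couplingE2 lf.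
congr quad_path; apply/funext => t; apply: eq_qmean => s; congr (_ * _).
rewrite /path_kernel /kernel path_covE; congr (_ - _ + _).
- congr ((_ - _) / 2); apply: eq_bigr => l _; apply: eq_bigr => m _.
  by rewrite path_covE.
- by congr (_ * _); apply: eq_bigr => l _; rewrite path_covE.
- by rewrite path_covE.
Qed.

Lemma local_kernel i n : local_at n.+2 (kernel i n).
Proof.
move=> s s' H; rewrite /kernel (H n)// (H n.+1)//.
rewrite (Wcov_diag i (s 0) (s' 0)); congr ((_ - _) / 2 - _ * _ + _).
- by apply: eq_bigr => l _; apply: eq_bigr => m _; rewrite !H// ltnS ltnW// ltnS ltnW.
- by apply: eq_bigr => l _; rewrite !H// ltnS ltnW// ltnS ltnW.
Qed.

Definition flip_at i (l : nat) s : nat -> S := upd s l (flip i (s l)).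

Definition flip_invariant i f := forall l s, f (flip_at i l s) = f s.

(** The realizations visited by the mean at t = 0; in particular the couplings containing i are
    zero. *)
Let supp i (x : J -> R) := forall k, path_var i 0 k = 0 -> x k = 0.

Let supp0 i : supp i (fun=> 0). Proof. by []. Qed.

Let local_field i (x : J -> R) : R := field_coef * x (inr i) + h.

(** With the couplings containing i equal to zero, the energy sees the spin at i only through the
    local field. *)
Let energy_flip i x c : supp i x ->
  energy coupling external x c - local_field i x * spin R c i =
  energy coupling external x (flip i c) - local_field i x * spin R (flip i c) i.
Proof.
move=> xs; apply/eqP; rewrite -subr_eq0.
suff K : energy coupling external x c - energy coupling external x (flip i c) =
   local_field i x * (spin R c i - spin R (flip i c) i).
  by apply/eqP; lra.
rewrite /energy /external.
have -> : \sum_k x k * coupling k c = \sum_k x k * coupling k (flip i c) +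
   x (inr i) * field_coef * (spin R c i - spin R (flip i c) i).
  rewrite (bigD1 (inr i))//= [in RHS](bigD1 (inr i))//=.
  have -> : \sum_(k | k != inr i) x k * coupling k c = \sum_(k | k != inr i) x k * coupling k (flip i c).
    apply: eq_bigr => -[A|j] ji /=.
      rewrite prod_spin_flip ?uniq_increasing_tuple//.
      case: ifP => iA; last by rewrite mul1r.
      by rewrite xs ?mul0r// /path_var/= iA mul0r addr0.
    by rewrite spin_flip_other//; apply: contraNneq ji => ->.
  by ring.
have -> : \sum_j spin R c j = \sum_j spin R (flip i c) j + (spin R c i - spin R (flip i c) i).
  rewrite (bigD1 i)//= [in RHS](bigD1 i)//=.
  have -> : \sum_(j | j != i) spin R c j = \sum_(j | j != i) spin R (flip i c) j.
    by apply: eq_bigr => j ji; rewrite spin_flip_other.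
  by ring.
by rewrite /local_field; ring.
Qed.

(** Given the other spins, the spin at i has weights proportional to the exponentials of plus and
    minus the local field, whose mean is tanh; hence c and its flip cancel. *)
Let weight_flip0 i x c : supp i x ->
  let t c := spin R c i - tanh (local_field i x) in
  let w := gweight coupling external x in w c * t c + w (flip i c) * t (flip i c) = 0.
Proof.
move=> xs t w; rewrite /w /gweight /t.
set Z := \sum_c _.
have E c' : expR (energy coupling external x c') =
   expR (energy coupling external x c' - local_field i x * spin R c' i) * expR (local_field i x * spin R c' i).
  by rewrite -expRD; congr expR; ring.
rewrite (E c) (E (flip i c)) -energy_flip// spin_flip.
set B := expR (_ - _); set g := local_field i x.
have D0 : expR g + expR (- g) != 0 by rewrite gt_eqF// addr_gt0 ?expR_gt0.
have Z0 : Z != 0 by rewrite gt_eqF//; exact: (gibbs_Z_gt0 s0).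
rewrite /tanh; rewrite /spin; case: (c i); rewrite ?expr1 ?expr0 ?mulrN1 ?mulr1 ?opprK.
  by rewrite mulr1; field; rewrite D0 Z0.
by field; rewrite D0 Z0.
Qed.

(* At the start of the interpolation the spins at [i] are independent of the
   rest, with mean [tanh] of the local field in every replica. *)
Let avg_spin i n l f x : supp i x -> (forall s, f (flip_at i l s) = f s) -> (l < n)%N ->
  avg s0 (gweight coupling external x) n (fun s => spin R (s l) i * f s) =
  tanh (local_field i x) * avg s0 (gweight coupling external x) n f.
Proof.
move=> xs fi ln; apply/eqP; rewrite -subr_eq0 -avgZ -[X in X - _]mul1r -mulN1r -avg_lin.
apply/eqP.
have /= <- := avg_flip0 s0 (gweight_sum s0 coupling external x)
  ln (flipK i) (fun c => weight_flip0 c xs) fi.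
by apply: eq_avg => s; ring.
Qed.

Let flip_invariant_trunc i n f : flip_invariant i f -> flip_invariant i (f \o trunc s0 n).
Proof.
move=> fi l s /=; case: (ltnP l n) => [ln|nl].
  have -> : trunc s0 n (flip_at i l s) = flip_at i l (trunc s0 n s).
    apply/funext => k; rewrite /trunc /flip_at /upd ln.
    by have [->|] := eqVneq k l; rewrite ?ln.
  exact: fi.
congr f; apply/funext => k; rewrite /trunc /flip_at /upd.
by have [->|//] := eqVneq k l; rewrite ltnNge nl.
Qed.

(** The derivative in the field compares the spins at i of n replicas with n times that of a new
    one; each has mean tanh of the local field, so it vanishes. *)
Let gfam_field_invariant i n f x y : supp i x -> flip_invariant i f ->
  gfam s0 coupling external (n, f) (upd x (inr i) y) =
  gfam s0 coupling external (n, f) x.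
Proof.
move=> xs fi; pose G (y : R) := gfam s0 coupling external (n, f) (upd x (inr i) y).
have dG (z : R) : is_derive z 1 G 0.
  apply: (is_derive_eq (is_derive_gfam s0 coupling external x (inr i) (n, f) z)).
  have xs' : supp i (upd x (inr i) z).
    move=> k vk; rewrite upd_other ?xs//; apply: contra_eq_neq vk => ->.
    by rewrite /path_var/= eqxx mul0r addr0 oner_neq0.
  move: (upd x _ z) xs' => x1 xs1.
  set w := gweight coupling external x1.
  have w1 : \sum_c w c = 1 by exact: (gweight_sum s0).
  rewrite -[LHS]/(avg s0 w n.+1 (gder s0 coupling (inr i) (n, f)).2).
  have fi' := flip_invariant_trunc n fi.
  transitivity (field_coef * (\sum_(l < n) avg s0 w n.+1 (fun s => spin R (s l) i * (f \o trunc s0 n) s)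
     - n%:R * avg s0 w n.+1 (fun s => spin R (s n) i * (f \o trunc s0 n) s))).
    have -> : \sum_(l < n) avg s0 w n.+1 (fun s => spin R (s l) i * (f \o trunc s0 n) s) =
      avg s0 w n.+1 (fun s => \sum_(l < n) (spin R (s l) i * (f \o trunc s0 n) s)).
      elim: (index_enum _) => [|l r IH].
        by rewrite big_nil -[LHS](avg_cst s0 w1 n.+1); apply: eq_avg => s; rewrite big_nil.
      rewrite big_cons IH -[X in X + _]mul1r -[X in _ + X]mul1r -avg_lin.
      by apply: eq_avg => s; rewrite big_cons !mul1r.
    rewrite -[X in _ * (X - _)]mul1r -mulNr -avg_lin -avgZ; apply: eq_avg => s /=.
    rewrite -mulr_sumr -mulr_suml; ring.
  rewrite (avg_spin xs1)//.
  under eq_bigr => l _ do rewrite (avg_spin xs1) ?(ltn_trans (ltn_ord l))//.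
  by rewrite sumr_const card_ord -mulr_natl; ring.
have := @is_derive_0_is_cst R G y (x (inr i)) dG.
by rewrite /G upd_id.
Qed.

Let continuous_tanh_field : continuous (fun y : R => tanh (field_coef * y + h)).
Proof.
have cE (a b : R) : continuous (fun y : R => expR (a * y + b)).
  move=> y; apply: (@continuous_comp _ _ _ (fun y : R => a * y + b) (@expR R)).
    by apply: cvgD; [apply: cvgM; [exact: cvg_cst|exact: cvg_id]|exact: cvg_cst].
  exact: continuous_expR.
have -> : (fun y : R => tanh (field_coef * y + h)) = fun y =>
    (expR (field_coef * y + h) - expR (- field_coef * y + - h)) *
    (expR (field_coef * y + h) + expR (- field_coef * y + - h))^-1.
  by apply/funext => y; rewrite /tanh opprD mulNr.
move=> y; apply: cvgM; first by apply: cvgB; exact: cE.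
apply: cvgV; first by rewrite gt_eqF// addr_gt0 ?expR_gt0.
by apply: cvgD; exact: cE.
Qed.

Let tanh_le1 (z : R) : `|tanh z| <= 1.
Proof.
rewrite /tanh normrM normfV; have a0 := expR_gt0 z; have b0 := expR_gt0 (- z).
rewrite (gtr0_norm (addr_gt0 a0 b0)) ler_pdivrMr ?addr_gt0// mul1r.
by rewrite ler_norml; apply/andP; split; lra.
Qed.

(* [sites] lists the replicas whose spin at [i] occurs *)
Lemma cmean0_spins i n f (r : seq nat) : flip_invariant i f -> uniq r ->
  all (fun l => l < n)%N r ->
  cmean i 0 n (fun s => \prod_(l <- r) spin R (s l) i * f s) =
  tau (size r) * cmean i 0 n f.
Proof.
move=> fi ur rn; rewrite /cmean /qmean.
pose th (y : R) := tanh (field_coef * y + h) ^+ size r.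
have -> : tau (size r) = gaussE (fun y => th (Num.sqrt (path_var i 0 (inr i)) * y)).
  rewrite /tau /tanh_moment; congr gaussE; apply/funext => y.
  by rewrite /th /path_var/= eqxx mul0r addr0 sqrtr1 (mul1r y).
have sst := @gmean_stable_zero R _ (path_var i 0).
(* The field at i factors out: it enters as a power of tanh and, by [gfam_field_invariant], nowhere
   else. *)
apply: (gmean_factor (gfam_smooth s0 coupling external) sst) => //.
- exact: uniq_coords.
- by rewrite mem_cat map_f// mem_index_enum.
- rewrite /path_var/= eqxx mul0r addr0 sqrtr1.
  under eq_fun do rewrite mul1r; apply: (@gint_bounded _ _ 1).
    move=> y; apply: (@continuous_comp _ _ _ (fun y : R => tanh (field_coef * y + h)) (fun z => z ^+ size r)).
      exact: continuous_tanh_field.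
    exact: exprn_continuous.
  by move=> y; rewrite normrX exprn_ile1.
- move=> x xs; rewrite /gfam/= /th -/(local_field i x) {th}.
  elim: r ur rn => [_ _|l r IH /= /andP[lr ur] /andP[ln rn]].
    by rewrite expr0 mul1r; apply: eq_avg => s; rewrite big_nil mul1r.
  rewrite exprS -mulrA -IH//.
  have -> : avg s0 (gweight coupling external x) n (fun s => \prod_(l <- l :: r) spin R (s l) i * f s) =
     avg s0 (gweight coupling external x) n (fun s => spin R (s l) i * (\prod_(l <- r) spin R (s l) i * f s)).
    by apply: eq_avg => s; rewrite big_cons mulrA.
  rewrite avg_spin// => s; rewrite fi; congr (_ * _).
  rewrite big_seq_cond [RHS]big_seq_cond; apply: eq_bigr => k /andP[kr _].
  by rewrite /flip_at upd_other//; apply: contraNneq lr => <-.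
- by move=> x y xs; exact: gfam_field_invariant.
Qed.

End Size.
End Model.

(** * Elementary symmetric polynomials of signs *)

Section SymmetricFunctions.
Context {R : realType}.
Implicit Types (l : seq R) (m n : nat).

Definition elem_sym m l : R := (\prod_(x <- l) (1 + x *: 'X))`_m.

Lemma elem_sym0 l : elem_sym 0 l = 1.
Proof.
rewrite /elem_sym; elim: l => [|x l IH]; first by rewrite big_nil coef1.
by rewrite big_cons mulrDl mul1r coefD IH -scalerAl coefZ coefXM mulr0 addr0.
Qed.

Lemma elem_symS_nil m : elem_sym m.+1 [::] = 0.
Proof. by rewrite /elem_sym big_nil coef1. Qed.

Lemma elem_symS_cons m x l : elem_sym m.+1 (x :: l) = elem_sym m.+1 l + x * elem_sym m l.
Proof. by rewrite /elem_sym big_cons mulrDl mul1r coefD -scalerAl coefZ coefXM. Qed.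

(** In the product of the sum with e_(m+1), a new factor either extends a product to m+2 distinct
    variables, each obtained m+2 times, or squares to 1 and leaves m of them, each obtained [size l]
    - m times. *)
Lemma elem_sym_rec l m : (forall x, x \in l -> x * x = 1) ->
  m.+2%:R * elem_sym m.+2 l + ((size l)%:R - m%:R) * elem_sym m l = (\sum_(x <- l) x) * elem_sym m.+1 l.
Proof.
elim: l m => [|x l IH] m l1.
  rewrite big_nil !elem_symS_nil mul0r mulr0 add0r sub0r.
  by case: m => [|m]; [rewrite oppr0 mul0r|rewrite elem_symS_nil mulr0].
have x1 : x * x = 1 by apply: l1; exact: mem_head.
have {}IH k := IH k (fun y yl => l1 y (mem_behead (s := x :: l) yl)).
rewrite big_cons !elem_symS_cons /= -[(size l).+1]addn1 natrD.
have E (S e1 e2 : R) : (x + S) * (e2 + x * e1) = x * e2 + (x * x) * e1 + S * e2 + x * (S * e1).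
  by ring.
rewrite E x1 -IH; case: m => [|m].
  rewrite !elem_sym0 mulr1.
  have -> : \sum_(y <- l) y = elem_sym 1 l.
    elim: (l) => [|y s IHs]; first by rewrite elem_symS_nil big_nil.
    by rewrite elem_symS_cons elem_sym0 mulr1 big_cons IHs addrC.
  by ring.
rewrite -IH !elem_symS_cons -[m.+3]addn1 -[m.+2]addn1 -[m.+1]addn1 !natrD.
by ring.
Qed.

Lemma elem_sym_perm m l l' : perm_eq l l' -> elem_sym m l = elem_sym m l'.
Proof. by move=> ll; rewrite /elem_sym (perm_big _ ll). Qed.

Lemma elem_sym_le l m : (forall x, x \in l -> `|x| <= 1) ->
  m`!%:R * `|elem_sym m l| <= (size l)%:R ^+ m.
Proof.
elim: l m => [|x l IH] [|m] l1; rewrite ?elem_sym0 ?normr1 ?mulr1 ?expr0 ?fact0//.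
  by rewrite elem_symS_nil normr0 mulr0 exprn_ge0.
have {}IH k := IH k (fun y yl => l1 y (mem_behead (s := x :: l) yl)).
rewrite elem_symS_cons; apply: (@le_trans _ _ (m.+1`!%:R * (`|elem_sym m.+1 l| + `|elem_sym m l|))).
  rewrite ler_wpM2l//; apply: (le_trans (ler_normD _ _)); rewrite lerD2l normrM.
  by rewrite ler_piMl// l1// mem_head.
rewrite mulrDr; apply: (@le_trans _ _ ((size l)%:R ^+ m.+1 + m.+1%:R * (size l)%:R ^+ m)).
  apply: lerD; first exact: IH.
  by rewrite factS natrM -mulrA ler_wpM2l.
rewrite /= -[in leRHS]addn1 natrD.
move: (size l)%:R (ler0n R (size l)) => n n0.
elim: m {IH} => [|m IHm]; first by rewrite !expr1 expr0 mulr1.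
rewrite [leRHS]exprSr; apply: (@le_trans _ _ ((n ^+ m.+1 + m.+1%:R * n ^+ m) * (n + 1))).
  rewrite -[m.+2%:R]natr1 !exprS.
  have : 0 <= m.+1%:R * n ^+ m by rewrite mulr_ge0// exprn_ge0.
  have : 0 <= n ^+ m by rewrite exprn_ge0.
  by move: (n ^+ m) (m.+1%:R : R) => y z ? ?; lra.
by rewrite ler_wpM2r// addr_ge0.
Qed.

(* m! e_m = S^m + O(N^(m-1)) when the variables are signs *)
Lemma elem_sym_asymp m : exists C : R, forall (M : R) l, (forall x, x \in l -> x * x = 1) ->
  (size l)%:R <= M -> 1 <= M ->
  M * `|m`!%:R * elem_sym m l - (\sum_(x <- l) x) ^+ m| <= C * M ^+ m.
Proof.
elim/ltn_ind: m => -[|[|m]] IH.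
- by exists 0 => M l _ _ _; rewrite elem_sym0 fact0 mulr1 expr0 subrr normr0 mulr0 mul0r.
- exists 0 => M l _ _ _.
  have -> : \sum_(y <- l) y = elem_sym 1 l.
    elim: (l) => [|y s IHs]; first by rewrite elem_symS_nil big_nil.
    by rewrite elem_symS_cons elem_sym0 mulr1 big_cons IHs addrC.
  by rewrite (_ : 1`! = 1%N)// mul1r expr1 subrr normr0 mulr0 mul0r.
have [C HC] := IH m.+1 (ltnSn _).
exists (C + m.+1%:R * (1 + m%:R)) => M l l1 lM M1.
have M0 : 0 <= M by exact: le_trans M1.
have ln x : x \in l -> `|x| <= 1.
  by move=> /l1 xx; rewrite -(@expr_le1 _ 2)// -normrX expr2 xx normr1.
have Sle : `|\sum_(x <- l) x| <= M.
  apply: le_trans lM; apply: (le_trans (ler_norm_sum _ _ _)).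
  rewrite -sum1_size natr_sum big_seq [leRHS]big_seq; apply: ler_sum => x xl.
  exact: ln.
have rec := elem_sym_rec m l1.
have em := elem_sym_le m ln.
have {}HC := HC M l l1 lM M1.
set S := \sum_(x <- l) x in Sle rec HC *.
(* The recursion turns the error at m+2 into S times the error at m+1, plus a term of order
   M^(m+1). *)
have -> : m.+2`!%:R * elem_sym m.+2 l - S ^+ m.+2 =
   S * (m.+1`!%:R * elem_sym m.+1 l - S ^+ m.+1)
   - m.+1%:R * ((size l)%:R - m%:R) * (m`!%:R * elem_sym m l).
  have -> : m.+2`!%:R * elem_sym m.+2 l = m.+1`!%:R * (m.+2%:R * elem_sym m.+2 l).
    by rewrite factS natrM; ring.
  have -> : m.+2%:R * elem_sym m.+2 l = S * elem_sym m.+1 l - ((size l)%:R - m%:R) * elem_sym m l.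
    by rewrite -rec; ring.
  rewrite (exprS _ m.+1) factS natrM; ring.
have nm : `|(size l)%:R - m%:R| <= M * (1 + m%:R).
  apply: (le_trans (ler_normB _ _)); rewrite !ger0_norm// mulrDr mulr1 lerD//.
  by rewrite ler_peMl.
have emM : `|m`!%:R * elem_sym m l| <= M ^+ m.
  rewrite normrM ger0_norm//; apply: (le_trans em).
  by rewrite lerXn2r// nnegrE.
apply: (@le_trans _ _ (M * (`|S| * `|m.+1`!%:R * elem_sym m.+1 l - S ^+ m.+1| +
   m.+1%:R * `|(size l)%:R - m%:R| * `|m`!%:R * elem_sym m l|))).
  apply: ler_wpM2l => //; apply: (le_trans (ler_normB _ _)).
  by rewrite !normrM; rewrite (@ger0_norm _ m.+1%:R)// lerD2l.
rewrite mulrDr mulrDl; apply: lerD.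
  rewrite mulrCA; apply: (@le_trans _ _ (M * (C * M ^+ m.+1))); last by rewrite (exprS M m.+1) mulrCA.
  by apply: ler_pM => //; rewrite mulr_ge0.
apply: (@le_trans _ _ (M * (m.+1%:R * (M * (1 + m%:R)) * M ^+ m))).
  by apply: ler_wpM2l => //; apply: ler_pM => //; exact: ler_wpM2l.
by rewrite !exprS; move: (M ^+ m) => y; rewrite le_eqVlt; apply/orP; left; apply/eqP; ring.
Qed.

(** Strictly increasing tuples correspond to p-element sets through sorted enumeration, and these
    sets index the coefficient of X^p in the product of the 1 + eta_j X. *)
Lemma sum_increasing_tuple (N p : nat) (eta : 'I_N -> R) : (0 < N)%N ->
  \sum_(A : increasing_tuple N p) \prod_(j <- val A) eta j =
  elem_sym p [seq eta j | j <- index_enum 'I_N].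
Proof.
move=> N0; pose i0 := Ordinal N0.
transitivity (\sum_(B : {set 'I_N} | #|B| == p) \prod_(j in B) eta j); last first.
  rewrite /elem_sym big_map.
  have -> : \prod_j (1 + eta j *: 'X) = \prod_j (eta j *: 'X + 1) :> {poly R}.
    by apply: eq_bigr => j _; rewrite addrC.
  rewrite (bigA_distr 1 +%R)/= coef_sum big_mkcond/=; apply: eq_bigr => B _.
  have -> : \prod_i (if i \in B then eta i *: 'X else 1) = (\prod_(i in B) eta i) *: 'X^#|B|.
    by rewrite -big_mkcond/= scaler_prod prodr_const.
  by rewrite coefZ coefXn [p == _]eq_sym; case: (#|B| == p); rewrite ?mulr1 ?mulr0.
transitivity (\sum_(t : p.-tuple 'I_N | sorted ltn [seq nat_of_ord j | j <- t]) \prod_(j <- t) eta j).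
  rewrite (reindex_omap (val : increasing_tuple N p -> p.-tuple 'I_N) insub)/=; last first.
    by move=> t st; rewrite insubT.
  apply: eq_bigl => A; rewrite (valP A) valK eqxx.
  by [].
pose f_t (t : p.-tuple 'I_N) := [set i in t].
(* The default [i0] is not reached when A has p elements. *)
pose f_A (A : {set 'I_N}) := [tuple of mkseq (nth i0 (enum A)) p].
have val_fA (A : {set 'I_N}) : #|A| = p -> val (f_A A) = enum A.
  by move=> Am; rewrite -[enum _](mkseq_nth i0) -cardE Am.
have inc_A (A : {set 'I_N}) : sorted ltn (map val (enum A)).
  rewrite -[enum _](eq_filter (mem_enum _)).
  rewrite -(eq_filter (mem_map val_inj _)) -filter_map.
  by rewrite (sorted_filter ltn_trans) // unlock val_ord_enum iota_ltn_sorted.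
rewrite [RHS](reindex_onto f_t f_A)/= => [|A]; last first.
  by move/eqP=> cardAm; apply/setP=> x; rewrite inE -(mem_enum A) -val_fA.
apply: eq_big => t.
  apply/idP/idP => [inc_t|/andP [/eqP t_m /eqP <-]]; last by rewrite val_fA.
  have ft_m: #|f_t t| = p.
    rewrite cardsE (card_uniqP _) ?size_tuple // -(map_inj_uniq val_inj).
    exact: (sorted_uniq ltn_trans ltnn).
  rewrite ft_m eqxx -val_eqE val_fA // -(inj_eq (inj_map val_inj)) /=.
  apply/eqP/(irr_sorted_eq ltn_trans ltnn) => // y.
  by apply/mapP/mapP=> [] [x t_x ->]; exists x; rewrite // mem_enum inE in t_x *.
move=> st; have ut : uniq t.
  by apply: map_uniq (sorted_uniq ltn_trans ltnn st).
by rewrite big_uniq//; apply: eq_bigl => j; rewrite inE.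
Qed.

End SymmetricFunctions.

(** * Covariance of the couplings at a site, in terms of the overlap *)

Section CavityCovariance.
Context {R : realType} (p : nat) (beta : R).
Hypothesis hp : (2 <= p)%N.

(** Setting eta i to 0 kills exactly the tuples containing i; subtract the two expansions of the
    full sum. *)
Lemma sum_increasing_tuple_mem (N : nat) (i : 'I_N) (eta : 'I_N -> R) :
  \sum_(A : increasing_tuple N p | i \in val A) \prod_(j <- val A) eta j =
  eta i * elem_sym p.-1 [seq eta j | j <- rem i (index_enum 'I_N)].
Proof.
have N0 : (0 < N)%N by exact: leq_trans (ltn_ord i).
have p0 : p = p.-1.+1 by rewrite prednK// (leq_trans _ hp).
have pe : perm_eq (index_enum 'I_N) (i :: rem i (index_enum 'I_N)).
  exact/perm_to_rem/mem_index_enum.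
pose eta0 j := if j == i then 0 else eta j.
have E0 := sum_increasing_tuple p eta0 N0.
have E1 := sum_increasing_tuple p eta N0.
rewrite (elem_sym_perm _ (perm_map eta pe)) /= p0 elem_symS_cons -p0 in E1.
rewrite (elem_sym_perm _ (perm_map eta0 pe)) /= p0 elem_symS_cons -p0 /eta0 eqxx mul0r addr0 in E0.
have Emap : [seq (if j == i then 0 else eta j) | j <- rem i (index_enum 'I_N)] =
            [seq eta j | j <- rem i (index_enum 'I_N)].
  apply/eq_in_map => j; rewrite mem_rem_uniq ?index_enum_uniq// inE.
  by move=> /andP[/negbTE ->].
rewrite Emap in E0.
rewrite (bigID (fun A : increasing_tuple N p => i \in val A))/= in E0.
rewrite (bigID (fun A : increasing_tuple N p => i \in val A))/= in E1.
rewrite big1 ?add0r in E0; last first.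
  by move=> A iA; rewrite (big_rem i)//= eqxx mul0r.
have E2 : \sum_(A : increasing_tuple N p | i \notin val A) \prod_(j <- val A) (if j == i then 0 else eta j)
  = \sum_(A : increasing_tuple N p | i \notin val A) \prod_(j <- val A) eta j.
  apply: eq_bigr => A iA; rewrite big_seq [RHS]big_seq; apply: eq_bigr => j jA.
  by rewrite ifN//; apply: contraNneq iA => <-.
rewrite E2 in E0; rewrite E0 in E1.
by move/eqP: E1; rewrite addrC (can2_eq (addKr _) (addNKr _)) => /eqP ->; ring.
Qed.

Lemma u_sqr (N : nat) : (u R N p) ^+ 2 = p`!%:R / (2 * N%:R ^+ p.-1).
Proof. by rewrite /u sqr_sqrtr// divr_ge0// mulr_ge0// exprn_ge0. Qed.

Section Fixed.
Variables (N : nat) (i : 'I_N) (c e : config N).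

Let l := [seq spin R c j * spin R e j | j <- rem i (index_enum 'I_N)].

Let N0 : (0 < N)%N. Proof. exact: leq_trans (ltn_ord i). Qed.

Let size_l : size l = N.-1.
Proof. by rewrite size_map size_rem ?mem_index_enum// /index_enum -enumT size_enum_ord. Qed.

Let l_sqr x : x \in l -> x * x = 1.
Proof. by move=> /mapP[j _ ->]; rewrite mulrACA !spin_sqr mulr1. Qed.

Let l_norm x : x \in l -> `|x| <= 1.
Proof. by move=> /mapP[j _ ->]; rewrite normrM !spin_norm mulr1. Qed.

Let K0 : 0 <= beta ^+ 2 * (p%:R / 2).
Proof. by apply: mulr_ge0 => //; exact: sqr_ge0. Qed.

(** As p! = p (p-1)!, the normalisation u_N produces the factor p/2, and the spins at i occur twice
    and cancel. *)
Let cavity_covE : cavity_cov p beta i c e =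
  beta ^+ 2 * (p%:R / 2) * ((p.-1)`!%:R * elem_sym p.-1 l / N%:R ^+ p.-1).
Proof.
have T := sum_increasing_tuple_mem i (fun j => spin R c j * spin R e j).
rewrite /cavity_cov T exprMn u_sqr -/l.
have -> : p`!%:R = p%:R * p.-1`!%:R :> R.
  by rewrite -natrM; case: (p) hp.
have sp : (spin R c i * spin R e i) * (spin R c i * spin R e i) = 1.
  by rewrite mulrACA !spin_sqr mulr1.
transitivity (beta ^+ 2 * (p%:R * p.-1`!%:R / (2 * N%:R ^+ p.-1)) * elem_sym p.-1 l
   * ((spin R c i * spin R e i) * (spin R c i * spin R e i))); first by ring.
by rewrite sp mulr1 invfM; ring.
Qed.

Lemma cavity_cov_le : `|cavity_cov p beta i c e| <= beta ^+ 2 * (p%:R / 2).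
Proof.
rewrite cavity_covE normrM (ger0_norm K0).
rewrite ler_piMr//.
have NN : 0 < N%:R ^+ p.-1 :> R by rewrite exprn_gt0// ltr0n.
rewrite normrM normfV (gtr0_norm NN) ler_pdivrMr// mul1r normrM ger0_norm//.
apply: (le_trans (elem_sym_le p.-1 l_norm)); rewrite lerXn2r ?nnegrE//.
by rewrite size_l ler_nat leq_pred.
Qed.

(** Two errors of order 1/N add up: replacing (p-1)! e_(p-1) by a power of the sum S over sites
    other than i, and restoring site i in S to obtain the overlap. *)
Lemma cavity_cov_dist (C : R) :
  (forall (M : R) l, (forall x, x \in l -> x * x = 1) ->
    (size l)%:R <= M -> 1 <= M ->
    M * `|p.-1`!%:R * elem_sym p.-1 l - (\sum_(x <- l) x) ^+ p.-1| <= C * M ^+ p.-1) ->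
  `|cavity_cov p beta i c e - beta ^+ 2 * (p%:R / 2) * overlap R c e ^+ p.-1|
     <= beta ^+ 2 * (p%:R / 2) * (C + p%:R) / N%:R.
Proof.
move=> HC.
have NR : 0 < N%:R :> R by rewrite ltr0n.
have NN : 0 < N%:R ^+ p.-1 :> R by rewrite exprn_gt0.
have N1 : 1 <= N%:R :> R by rewrite ler1n.
have {}HC := HC N%:R l l_sqr _ N1.
have {HC} HC : N%:R * `|p.-1`!%:R * elem_sym p.-1 l - (\sum_(x <- l) x) ^+ p.-1| <= C * N%:R ^+ p.-1.
  by apply: HC; rewrite size_l ler_nat leq_pred.
rewrite cavity_covE -mulrBr normrM (ger0_norm K0).
rewrite -[leRHS]mulrA; apply: ler_wpM2l; first exact: K0.
pose S := \sum_(x <- l) x; pose V := \sum_(j < N) spin R c j * spin R e j.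
have SV : V = S + spin R c i * spin R e i.
  rewrite /V /S big_map (perm_big _ (perm_to_rem (mem_index_enum i)))/= big_cons.
  by rewrite addrC.
have -> : overlap R c e ^+ p.-1 = V ^+ p.-1 / N%:R ^+ p.-1.
  by rewrite /overlap mulrC exprMn exprVn.
rewrite -mulrBl normrM normfV (gtr0_norm NN) ler_pdivrMr//.
rewrite -(ler_pM2l NR).
have -> : N%:R * ((C + p%:R) / N%:R * N%:R ^+ p.-1) = C * N%:R ^+ p.-1 + p%:R * N%:R ^+ p.-1.
  by field; rewrite gt_eqF.
have Sle : `|S| <= N%:R.
  apply: (@le_trans _ _ (size l)%:R); last by rewrite size_l ler_nat leq_pred.
  apply: (le_trans (ler_norm_sum _ _ _)).
  rewrite -sum1_size natr_sum big_seq [leRHS]big_seq; apply: ler_sum => x xl.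
  exact: l_norm.
have Vle : `|V| <= N%:R.
  apply: (le_trans (ler_norm_sum _ _ _)).
  rewrite -[X in _ <= X%:R](card_ord N) -sum1_card natr_sum; apply: ler_sum => j _.
  by rewrite normrM !spin_norm mulr1.
have SVk k : `|S ^+ k - V ^+ k| * N%:R <= k%:R * N%:R ^+ k.
  elim: k => [|k IH]; first by rewrite !expr0 subrr normr0 !mul0r.
  have -> : S ^+ k.+1 - V ^+ k.+1 = S * (S ^+ k - V ^+ k) + (S - V) * V ^+ k.
    by rewrite !exprS; ring.
  apply: (@le_trans _ _ ((N%:R * `|S ^+ k - V ^+ k| + 1 * N%:R ^+ k) * N%:R)).
    rewrite ler_pM2r//; apply: (le_trans (ler_normD _ _)); rewrite !normrM; apply: lerD.
      by apply: ler_wpM2r.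
    apply: ler_pM => //.
      by rewrite SV opprD addNKr normrN normrM !spin_norm mulr1.
    by rewrite normrX lerXn2r// nnegrE.
  rewrite mulrDl mul1r -exprSr -mulrA -natr1 mulrDl mul1r lerD2r.
  by rewrite (exprS _ k) [leRHS]mulrCA; apply: ler_wpM2l => //; exact: ltW.
apply: (@le_trans _ _ (N%:R * (`|p.-1`!%:R * elem_sym p.-1 l - S ^+ p.-1| + `|S ^+ p.-1 - V ^+ p.-1|))).
  by apply: ler_wpM2l; [exact: ltW|exact: ler_distD].
rewrite mulrDr; apply: lerD => //; rewrite mulrC; apply: (le_trans (SVk _)).
by rewrite ler_pM2r// ler_nat leq_pred.
Qed.

End Fixed.

Lemma cavity_cov_asymp : exists C : R, forall N (i : 'I_N) (c e : config N),
  `|cavity_cov p beta i c e - beta ^+ 2 * (p%:R / 2) * overlap R c e ^+ p.-1| <= C / N%:R.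
Proof.
have [C HC] := @elem_sym_asymp R p.-1.
by exists (beta ^+ 2 * (p%:R / 2) * (C + p%:R)) => N i c e; exact: cavity_cov_dist.
Qed.

End CavityCovariance.

(** * Elementary inequalities for powers *)

Section RealInequalities.
Context {R : realType}.
Implicit Types x y z d : R.

(** Weighted AM-GM: multiply the previous case by z and use (k+1) y^k (z - y)^2 >= 0. *)
Lemma young_expr (k : nat) y z : 0 <= y -> 0 <= z ->
  k.+1%:R * (y ^+ k * z) <= k%:R * y ^+ k.+1 + z ^+ k.+1.
Proof.
move=> y0 z0; elim: k => [|k IH]; first by rewrite mul1r mul0r add0r expr0 mul1r expr1.
have H1 := ler_wpM2l z0 IH.
have H2 : 0 <= k.+1%:R * y ^+ k * (z - y) ^+ 2.
  by rewrite mulr_ge0 ?sqr_ge0// mulr_ge0// exprn_ge0.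
rewrite -[k.+2%:R]natr1 (exprS z k.+1) (exprS y k.+1) (exprS y k).
move: H1 H2; rewrite (exprS y k) -[k.+1%:R]natr1.
move: (y ^+ k) (z ^+ k.+1) (k%:R : R) => a b n.
by rewrite expr2; lra.
Qed.

Lemma exprB_le x y d (k : nat) : `|x| <= d -> `|y| <= d ->
  `|x ^+ k.+1 - y ^+ k.+1| <= k.+1%:R * `|x - y| * d ^+ k.
Proof.
move=> xd yd; have d0 : 0 <= d by exact: le_trans xd.
elim: k => [|k IH]; first by rewrite !expr1 expr0 mul1r mulr1.
have -> : x ^+ k.+2 - y ^+ k.+2 = x * (x ^+ k.+1 - y ^+ k.+1) + (x - y) * y ^+ k.+1.
  by rewrite !(exprS _ k.+1); ring.
apply: (le_trans (ler_normD _ _)); rewrite !normrM.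
apply: (@le_trans _ _ (d * (k.+1%:R * `|x - y| * d ^+ k) + `|x - y| * d ^+ k.+1)).
  apply: lerD; first exact: ler_pM.
  by rewrite ler_wpM2l// normrX lerXn2r// nnegrE.
rewrite -[k.+2%:R]natr1 exprS le_eqVlt; apply/orP; left; apply/eqP.
by move: (d ^+ k) (k.+1%:R : R) `|x - y| => a b c; ring.
Qed.

Lemma exprD_le2 x y (k : nat) : 0 <= x -> 0 <= y ->
  (x + y) ^+ k <= 2 ^+ k * (x ^+ k + y ^+ k).
Proof.
move=> x0 y0.
have [xy|/ltW yx] := leP x y.
  apply: (@le_trans _ _ ((2 * y) ^+ k)).
    by rewrite lerXn2r ?nnegrE ?addr_ge0 ?mulr_ge0//; lra.
  by rewrite exprMn ler_wpM2l ?exprn_ge0// lerDr exprn_ge0.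
apply: (@le_trans _ _ ((2 * x) ^+ k)).
  by rewrite lerXn2r ?nnegrE ?addr_ge0 ?mulr_ge0//; lra.
by rewrite exprMn ler_wpM2l ?exprn_ge0// lerDl exprn_ge0.
Qed.

Lemma expr_taylor2 (k : nat) : exists C : R, forall x y, `|x| <= 1 -> `|y| <= 1 ->
  `|x ^+ k - y ^+ k - k%:R * y ^+ k.-1 * (x - y)| <= C * (x - y) ^+ 2.
Proof.
elim: k => [|k [C IH]].
  by exists 0 => x y _ _; rewrite !expr0 subrr !mul0r subr0 normr0.
exists (C + k%:R) => x y x1 y1.
have -> : x ^+ k.+1 - y ^+ k.+1 - k.+1%:R * y ^+ k * (x - y) =
   x * (x ^+ k - y ^+ k - k%:R * y ^+ k.-1 * (x - y)) + k%:R * y ^+ k.-1 * (x - y) ^+ 2.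
  case: k {IH} => [|k]; first by rewrite !expr0 !expr1; ring.
  by rewrite /= -[k.+2%:R]natr1 !exprS; ring.
apply: (le_trans (ler_normD _ _)); rewrite mulrDl; apply: lerD.
  by rewrite normrM -[leRHS]mul1r; apply: ler_pM => //; exact: IH.
rewrite normrM (ger0_norm (sqr_ge0 _)) ler_wpM2r ?sqr_ge0//.
by rewrite normrM ger0_norm// ler_piMr// normrX exprn_ile1.
Qed.

End RealInequalities.

(** * A priori control of averages along the interpolation *)

Section Moments.
Context {R : realType} (p : nat) (beta h q : R).
Hypothesis hp : (2 <= p)%N.
Hypothesis hsmall : 8 * p%:R ^+ 2 * beta ^+ 2 <= 1 / 2.
Hypothesis hq01 : 0 <= q <= 1.
Hypothesis hq : q = tau p beta h q 2.

Local Notation chat := (cov_limit p beta q).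

Let q0 : 0 <= q. Proof. by case/andP: hq01. Qed.
Let q1 : q <= 1. Proof. by case/andP: hq01. Qed.

Lemma cov_limitE : chat = beta ^+ 2 * (p%:R / 2) * q ^+ p.-1.
Proof.
rewrite /cov_limit /field_coef !exprMn; congr (_ * _ * _).
  by rewrite -powR_mulrn ?powR_ge0// -powRrM mul1r mulVf// powRr1.
rewrite -[LHS]powR_mulrn ?powR_ge0// -powRrM divfK// -(@natrB _ p 1) ?(ltnW hp)//.
by rewrite powR_mulrn// subn1.
Qed.

Let K0 : 0 <= beta ^+ 2 * (p%:R / 2).
Proof. by apply: mulr_ge0 => //; exact: sqr_ge0. Qed.

Section FixedSize.
Variable N : nat.
Hypothesis hN : (p <= N)%N.
Local Notation S := (config N).
Implicit Types (i : 'I_N) (n : nat) (f g : (nat -> S) -> R) (s : nat -> S) (c e : S).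
Local Notation cm i t n f := (cmean p beta h q i t n f).
Local Notation fm n f := (fmean p beta h q n f).
Local Notation W := (Wcov p beta q).
Local Notation ker i n s := (kernel p beta q i n s).

Let N0 : 0 < N%:R :> R. Proof. by rewrite ltr0n (leq_trans _ hN)// (leq_trans _ hp). Qed.
Let N1 : 1 <= N%:R :> R. Proof. by rewrite ler1n (leq_trans _ hN)// (leq_trans _ hp). Qed.

Lemma overlap_norm c e : `|overlap R c e| <= 1.
Proof.
rewrite /overlap normrM normfV (gtr0_norm N0) mulrC ler_pdivrMr// mul1r.
apply: (le_trans (ler_norm_sum _ _ _)).
rewrite -[X in _ <= X%:R](card_ord N) -sum1_card natr_sum; apply: ler_sum => j _.
by rewrite normrM !spin_norm mulr1.
Qed.

Lemma overlapC c e : overlap R c e = overlap R e c.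
Proof. by rewrite /overlap; congr (_ * _); apply: eq_bigr => j _; rewrite mulrC. Qed.

Definition odev (a b : nat) s : R := overlap R (s a) (s b) - q.

Lemma dev_norm a b s : `|odev a b s| <= 2.
Proof.
by apply: (le_trans (ler_normB _ _)); rewrite (ger0_norm q0);
  have := overlap_norm (s a) (s b); have := q1; lra.
Qed.

Lemma spin2_norm c e i : `|spin R c i * spin R e i| = 1.
Proof. by rewrite normrM !spin_norm mulr1. Qed.

Lemma Wcov_norm i c e : `|W i c e| = `|cavity_cov p beta i c e - chat|.
Proof. by rewrite /Wcov normrM spin2_norm mul1r. Qed.

Lemma Wcov_le i c e : `|W i c e| <= beta ^+ 2 * p%:R.
Proof.
rewrite Wcov_norm; apply: (le_trans (ler_normB _ _)).
have -> : beta ^+ 2 * p%:R = beta ^+ 2 * (p%:R / 2) + beta ^+ 2 * (p%:R / 2) by field.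
apply: lerD; first exact: cavity_cov_le.
rewrite cov_limitE normrM (ger0_norm K0) ler_piMr//.
by rewrite normrX ger0_norm// exprn_ile1.
Qed.

Lemma cm_local i t n m f : (n <= m)%N -> local_at n f -> cm i t m f = cm i t n f.
Proof. exact: qmean_local. Qed.

Lemma cm_ge0 i t n f : (forall s, 0 <= f s) -> 0 <= cm i t n f.
Proof. by apply: qmean_ge0; exact: uniq_coords. Qed.

Lemma cm_le i t n f g : (forall s, f s <= g s) -> cm i t n f <= cm i t n g.
Proof. by apply: qmean_le; exact: uniq_coords. Qed.

Lemma cm_norm_le i t n f g : (forall s, `|f s| <= g s) -> `|cm i t n f| <= cm i t n g.
Proof. by apply: qmean_norm_le; exact: uniq_coords. Qed.

Lemma cmZ i t n (a : R) f : cm i t n (fun s => a * f s) = a * cm i t n f.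
Proof. by apply: qmeanZ; exact: uniq_coords. Qed.

Lemma cmD i t n f g : cm i t n (fun s => f s + g s) = cm i t n f + cm i t n g.
Proof. by apply: qmeanD; exact: uniq_coords. Qed.

Lemma cmB i t n f g : cm i t n (fun s => f s - g s) = cm i t n f - cm i t n g.
Proof. by apply: qmeanB; exact: uniq_coords. Qed.

Lemma kernel2E i s : ker i 2 s = W i (s 0) (s 1) - 2 * (W i (s 0) (s 2) + W i (s 1) (s 2))
  + 3 * W i (s 2) (s 3).
Proof.
rewrite /kernel !big_ord_recl !big_ord0/= !addr0.
rewrite -[bump 0 0]/1%N (WcovC p beta q i (s 1) (s 0)) (Wcov_diag p beta q i (s 1) (s 0)).
by field.
Qed.

(** Two exchanges of replicas carry (a, b) to (0, 1); the second is computed after the first has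
    possibly moved b. *)
Lemma cm_pair i t n a b (G : S -> S -> R) : (1 < n)%N -> (a < n)%N -> (b < n)%N -> a != b ->
  cm i t n (fun s => G (s a) (s b)) = cm i t n (fun s => G (s 0) (s 1)).
Proof.
move=> n1 an bn ab; have n0 : (0 < n)%N by exact: ltnW.
have sw k l f : (k < n)%N -> (l < n)%N -> cm i t n (fun s => f (s \o swap k l)) = cm i t n f.
  have [<- _ _|kl kn ln] := eqVneq k l.
    apply: eq_qmean => s; congr f; apply/funext => m; rewrite /= /swap.
    by have [->|] := eqVneq m k.
  exact: qmean_swap.
rewrite -(sw 0 a)//=.
have -> : swap 0 a a = 0 by rewrite /swap eqxx; case: eqP.
have b0 : swap 0 a b != 0 by rewrite /swap [b == a]eq_sym (negbTE ab); case: (eqVneq b 0) ab => [->|].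
have bn' : (swap 0 a b < n)%N by rewrite /swap; case: ifP => // _; case: ifP.
rewrite -(sw 1 (swap 0 a b))//=.
have -> : swap 1 (swap 0 a b) 0 = 0 by rewrite {1}/swap/= eq_sym (negbTE b0).
have -> // : swap 1 (swap 0 a b) (swap 0 a b) = 1.
by rewrite {1}/swap eqxx; case: eqP.
Qed.

(** The two-replica kernel has total weight 1 + 4 + 3 = 8 and entries at most beta^2 p, so the rate
    is 8 beta^2 p <= 4 beta^2 p^2 <= 1/4, using p >= 2. *)
Lemma cm_gronwall i t f : local_at 2 f -> (forall s, 0 <= f s) -> 0 <= t <= 1 ->
  cm i t 2 f <= 4 / 3 * fm 2 f.
Proof.
move=> lf f0 t01; rewrite -(cmean1 _ _ _ _ i).
have qp := quad_path_cmean p beta h q i lf.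
apply: (quad_path_gronwall (ka := 8 * (beta ^+ 2 * p%:R)) qp) => //.
- apply/andP; split.
    by apply: mulr_ge0 => //; apply: mulr_ge0 => //; exact: sqr_ge0.
  have : beta ^+ 2 * (2 * p%:R) <= beta ^+ 2 * p%:R ^+ 2.
    by rewrite ler_wpM2l ?sqr_ge0// expr2 ler_wpM2r// ler_nat.
  by have := hsmall; lra.
- by move=> t' _; exact: cm_ge0.
- move=> t' _; rewrite -(@cm_local i t' 2 4)// -cmZ.
  apply: cm_norm_le => s.
  rewrite normrM (ger0_norm (f0 s)) mulrC ler_wpM2r// kernel2E.
  have := Wcov_le i (s 0) (s 1); have := Wcov_le i (s 0) (s 2).
  have := Wcov_le i (s 1) (s 2); have := Wcov_le i (s 2) (s 3).
  rewrite !ler_norml => ? ? ? ?; apply/andP; split; lra.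
Qed.

End FixedSize.
End Moments.

(** * Even moments of the overlap deviation have the order of powers of 1/N *)

Section EvenMoments.
Context {R : realType} (p : nat) (beta h q : R).
Hypothesis hp : (2 <= p)%N.
Hypothesis hsmall : 8 * p%:R ^+ 2 * beta ^+ 2 <= 1 / 2.
Hypothesis hq01 : 0 <= q <= 1.
Hypothesis hq : q = tau p beta h q 2.

Local Notation S N := (config N).
Local Notation cm i t n f := (cmean p beta h q i t n f).
Local Notation fm n f := (fmean p beta h q n f).
Local Notation W := (Wcov p beta q).
Local Notation ker i n s := (kernel p beta q i n s).
Local Notation chat := (cov_limit p beta q).
Local Notation dev := (odev q).

Let q0 : 0 <= q. Proof. by case/andP: hq01. Qed.
Let q1 : q <= 1. Proof. by case/andP: hq01. Qed.

Lemma Nge1 N : (p <= N)%N -> 1 <= N%:R :> R.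
Proof. by move=> pN; rewrite ler1n (leq_trans _ pN)// (leq_trans _ hp). Qed.

(** A Lipschitz constant of beta^2 (p/2) r^(p-1) on [-1, 1]. *)
Definition kap0 : R := beta ^+ 2 * (p%:R / 2) * p.-1%:R.

Lemma kap0_ge0 : 0 <= kap0.
Proof. by apply: mulr_ge0 => //; apply: mulr_ge0 => //; exact: sqr_ge0. Qed.

(** The factor 64/3 is 8 (total weight of the kernel) times 2 (bound on eps eps' - q) times 4/3
    (Gronwall). *)
Lemma kap0_small : 64 / 3 * kap0 <= 2 / 3.
Proof.
have p1 : p.-1%:R <= p%:R :> R by rewrite ler_nat leq_pred.
have : beta ^+ 2 * (p%:R * p.-1%:R) <= beta ^+ 2 * p%:R ^+ 2.
  by rewrite ler_wpM2l ?sqr_ge0// expr2 ler_wpM2l.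
by rewrite /kap0; have := hsmall; lra.
Qed.

Lemma Wcov_dev_le : exists2 C : R, 0 <= C & forall N (i : 'I_N) (c e : config N), (p <= N)%N ->
  `|W i c e| <= kap0 * `|overlap R c e - q| + C / N%:R.
Proof.
have [C HC] := cavity_cov_asymp beta hp.
exists `|C| => // N i c e pN; have N1 := Nge1 pN.
have N0 : 0 < N%:R :> R by exact: lt_le_trans N1.
rewrite Wcov_norm cov_limitE//.
have -> : cavity_cov p beta i c e - beta ^+ 2 * (p%:R / 2) * q ^+ p.-1 =
   beta ^+ 2 * (p%:R / 2) * (overlap R c e ^+ p.-1 - q ^+ p.-1) +
   (cavity_cov p beta i c e - beta ^+ 2 * (p%:R / 2) * overlap R c e ^+ p.-1) by ring.
apply: (le_trans (ler_normD _ _)); apply: lerD; last first.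
  by apply: (le_trans (HC _ _ _ _)); rewrite ler_pM2r ?invr_gt0// ler_norm.
have K0 : 0 <= beta ^+ 2 * (p%:R / 2) by apply: mulr_ge0 => //; exact: sqr_ge0.
rewrite normrM (ger0_norm K0) /kap0 -mulrA; apply: ler_wpM2l => //.
have -> : p.-1 = p.-2.+1 by case: (p) hp => [//|[//|]].
have q1' : `|q| <= 1 by rewrite ger0_norm.
have := @exprB_le R (overlap R c e) q 1 p.-2 (overlap_norm hp pN c e) q1'.
by rewrite expr1n mulr1.
Qed.

(* the overlap deviation without the contribution of the site [i] *)
Definition devi N (i : 'I_N) (a b : nat) (s : nat -> config N) : R :=
  dev a b s - spin R (s a) i * spin R (s b) i / N%:R.

Lemma flip_invariant_devi N (i : 'I_N) a b : (p <= N)%N -> flip_invariant i (devi i a b).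
Proof.
move=> pN; have N1 := Nge1 pN; have N0 : N%:R != 0 :> R by rewrite gt_eqF// (lt_le_trans _ N1).
have E s : devi i a b s = N%:R^-1 * \sum_(j | j != i) spin R (s a) j * spin R (s b) j - q.
  rewrite /devi /odev /overlap (bigD1 i)//=; ring.
move=> l s; rewrite !E; congr (_ * _ - _); apply: eq_bigr => j ji.
have F c : spin R (flip_at i l s c) j = spin R (s c) j.
  rewrite /flip_at; have [->|cl] := eqVneq c l; last by rewrite upd_other.
  by rewrite upd_same spin_flip_other.
by rewrite !F.
Qed.

Lemma flip_invariant_comp N (i : 'I_N) (f : (nat -> config N) -> R) (F : R -> R) :
  flip_invariant i f -> flip_invariant i (fun s => F (f s)).
Proof. by move=> fi l s; rewrite fi. Qed.

(** This is where the equation for q enters: at t = 0 the mean of the two spins is [tau 2]. *)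
Lemma cm0_centered N (i : 'I_N) n a b f : (a < n)%N -> (b < n)%N -> a != b ->
  flip_invariant i f ->
  cm i 0 n (fun s => (spin R (s a) i * spin R (s b) i - q) * f s) = 0.
Proof.
move=> an bn ab fi.
transitivity (cm i 0 n (fun s => \prod_(l <- [:: a; b]) spin R (s l) i * f s - q * f s)).
  by apply: eq_qmean => s; rewrite big_cons big_seq1; ring.
rewrite cmB cmZ cmean0_spins//=; first by rewrite -hq subrr.
  by rewrite inE ab.
by rewrite an bn.
Qed.

Lemma local_dev N a b n : (a < n)%N -> (b < n)%N -> local_at n (@dev N a b).
Proof. by move=> an bn s s' H; rewrite /odev !H. Qed.

Lemma local_devi N (i : 'I_N) a b n : (a < n)%N -> (b < n)%N -> local_at n (devi i a b).
Proof. by move=> an bn s s' H; rewrite /devi (local_dev an bn H) !H. Qed.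

Lemma fm_ge0 N n (f : (nat -> config N) -> R) : (forall s, 0 <= f s) -> 0 <= fm n f.
Proof. by apply: qmean_ge0; exact: uniq_coords. Qed.

Lemma fm_le N n (f g : (nat -> config N) -> R) : (forall s, f s <= g s) -> fm n f <= fm n g.
Proof. by apply: qmean_le; exact: uniq_coords. Qed.

Lemma fm_norm_le N n (f g : (nat -> config N) -> R) : (forall s, `|f s| <= g s) ->
  `|fm n f| <= fm n g.
Proof. by apply: qmean_norm_le; exact: uniq_coords. Qed.

Lemma fmZ N n (a : R) (f : (nat -> config N) -> R) : fm n (fun s => a * f s) = a * fm n f.
Proof. by apply: qmeanZ; exact: uniq_coords. Qed.

Lemma fmD N n (f g : (nat -> config N) -> R) : fm n (fun s => f s + g s) = fm n f + fm n g.
Proof. by apply: qmeanD; exact: uniq_coords. Qed.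

Lemma fmB N n (f g : (nat -> config N) -> R) : fm n (fun s => f s - g s) = fm n f - fm n g.
Proof. by apply: qmeanB; exact: uniq_coords. Qed.

Lemma fm_cst N n (c : R) : fm n (fun _ : nat -> config N => c) = c.
Proof. exact: qmean_cst. Qed.

Lemma fm_sum N n (T : Type) (r : seq T) (f : T -> (nat -> config N) -> R) :
  fm n (fun s => \sum_(k <- r) f k s) = \sum_(k <- r) fm n (f k).
Proof. by apply: qmean_sum; exact: uniq_coords. Qed.

(** Bounds uniform in the site will be averaged through this identity, so symmetry between sites is
    not invoked. *)
Lemma dev_average N a b (s : nat -> config N) : (p <= N)%N ->
  dev a b s = N%:R^-1 * \sum_(i < N) (spin R (s a) i * spin R (s b) i - q).
Proof.
move=> pN; have N1 := Nge1 pN; have N0 : N%:R != 0 :> R by rewrite gt_eqF// (lt_le_trans _ N1).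
rewrite sumrB sumr_const card_ord mulrBr /odev /overlap; congr (_ - _).
by rewrite -[q *+ N]mulr_natl mulKf.
Qed.

(* AM-GM: the odd power times another deviation is absorbed by the even moment *)
Let kernel_term (C1 : R) (m : nat) : 0 <= C1 -> exists2 C : R, 0 <= C &
  forall N (Y Z D w : R), 1 <= N -> 0 <= Y <= 2 -> 0 <= Z <= 2 -> D = Y + N^-1 ->
  `|w| <= kap0 * Z + C1 / N ->
  `|w| * (2 * D ^+ m.+1) <=
    2 * kap0 / m.+2%:R * (m.+1%:R * Y ^+ m.+2 + Z ^+ m.+2) + C / N * D ^+ m.
Proof.
move=> C10; exists (4 * kap0 * m.+1%:R + 6 * C1).
  have k0 := kap0_ge0.
  by apply: addr_ge0; apply: mulr_ge0 => //; apply: mulr_ge0.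
have k0 := kap0_ge0; have kk0 : 0 <= 2 * kap0 by rewrite mulr_ge0.
move=> N Y Z D w N1 /andP[Y0 Y2] /andP[Z0 Z2] DE wle.
have N0 : 0 < N by exact: lt_le_trans N1.
have iN0 : 0 <= N^-1 by rewrite invr_ge0 ltW.
have iN1 : N^-1 <= 1 by rewrite invf_le1.
have D0 : 0 <= D by rewrite DE addr_ge0.
have D3 : D <= 3 by rewrite DE; lra.
have DY : D ^+ m.+1 <= Y ^+ m.+1 + m.+1%:R * N^-1 * D ^+ m.
  have nD : `|D| <= D by rewrite ger0_norm.
  have nY : `|Y| <= D by rewrite ger0_norm// DE lerDl.
  have := exprB_le m nD nY.
  have -> : D - Y = N^-1 by rewrite DE; ring.
  by rewrite (ger0_norm iN0); have := ler_norm (D ^+ m.+1 - Y ^+ m.+1); lra.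
have Yg := young_expr m.+1 Y0 Z0.
have Dm0 : 0 <= D ^+ m by rewrite exprn_ge0.
apply: (@le_trans _ _ ((kap0 * Z + C1 / N) * (2 * D ^+ m.+1))).
  by rewrite ler_wpM2r// mulr_ge0// exprn_ge0.
have T2 : C1 / N * (2 * D ^+ m.+1) <= 6 * C1 / N * D ^+ m.
  rewrite exprS; have -> : 6 * C1 / N * D ^+ m = C1 / N * D ^+ m * 6 by ring.
  have -> : C1 / N * (2 * (D * D ^+ m)) = C1 / N * D ^+ m * (2 * D) by ring.
  by rewrite ler_wpM2l ?mulr_ge0//; lra.
have T1 : kap0 * Z * (2 * D ^+ m.+1) <=
    2 * kap0 / m.+2%:R * (m.+1%:R * Y ^+ m.+2 + Z ^+ m.+2) + 4 * kap0 * m.+1%:R / N * D ^+ m.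
  have -> : 2 * kap0 / m.+2%:R * (m.+1%:R * Y ^+ m.+2 + Z ^+ m.+2) =
     2 * kap0 * (m.+2%:R^-1 * (m.+1%:R * Y ^+ m.+2 + Z ^+ m.+2)) by ring.
  apply: (@le_trans _ _ (2 * kap0 * (Y ^+ m.+1 * Z) + 2 * kap0 * (m.+1%:R * N^-1 * D ^+ m * Z))).
    have -> : kap0 * Z * (2 * D ^+ m.+1) = 2 * kap0 * Z * D ^+ m.+1 by ring.
    have -> : 2 * kap0 * (Y ^+ m.+1 * Z) + 2 * kap0 * (m.+1%:R * N^-1 * D ^+ m * Z) =
      2 * kap0 * Z * (Y ^+ m.+1 + m.+1%:R * N^-1 * D ^+ m) by ring.
    by apply: ler_wpM2l => //; exact: mulr_ge0.
  apply: lerD.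
    apply: ler_wpM2l => //.
    by rewrite ler_pdivlMl ?ltr0n.
  have -> : 4 * kap0 * m.+1%:R / N * D ^+ m = 2 * kap0 * (m.+1%:R * N^-1 * D ^+ m * 2) by ring.
  apply: ler_wpM2l => //.
  by apply: ler_wpM2l => //; apply: mulr_ge0 => //; exact: mulr_ge0.
have -> : (4 * kap0 * m.+1%:R + 6 * C1) / N * D ^+ m =
  4 * kap0 * m.+1%:R / N * D ^+ m + 6 * C1 / N * D ^+ m by ring.
by rewrite mulrDl addrA; exact: lerD T1 T2.
Qed.

(** The cavity step at one site: delete i from the odd power, start from a centered quantity at t =
    0, and bound the derivative by the even moment itself. The factor 2/3 < 1 permits absorption. *)
Let step_const (m : nat) : exists2 C : R, 0 <= C & forall N (i : 'I_N), (p <= N)%N ->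
  `|fm 2 (fun s : nat -> config N => (spin R (s 0) i * spin R (s 1) i - q) * dev 0 1 s ^+ (2 * m).+1)| <=
  2 / 3 * fm 2 (fun s : nat -> config N => dev 0 1 s ^+ (2 * m).+2) +
  C / N%:R * fm 2 (fun s : nat -> config N => (`|dev 0 1 s| + N%:R^-1) ^+ (2 * m)).
Proof.
have [C1 C10 HW] := Wcov_dev_le.
have [C2 C20 HK] := kernel_term (2 * m) C10.
exists (2 * (2 * m).+1%:R + 8 * C2 * (4 / 3)).
  by rewrite addr_ge0 ?mulr_ge0.
move=> N i pN; have N1 := Nge1 pN; have N0 : 0 < N%:R :> R by exact: lt_le_trans N1.
have iN0 : 0 <= N%:R^-1 :> R by rewrite invr_ge0 ltW.
pose k := (2 * m)%N; rewrite -/k in HK *.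
pose D (s : nat -> config N) := `|dev 0 1 s| + N%:R^-1.
pose e (s : nat -> config N) := spin R (s 0) i * spin R (s 1) i - q.
have e2 s : `|e s| <= 2.
  by rewrite /e; apply: (le_trans (ler_normB _ _)); rewrite spin2_norm ger0_norm//; have := q1; lra.
have Dge s : 0 <= D s by rewrite addr_ge0.
have devD s : `|dev 0 1 s| <= D s by rewrite lerDl.
have deviD s : `|devi i 0 1 s| <= D s.
  by apply: (le_trans (ler_normB _ _)); rewrite lerD2l normrM spin2_norm mul1r ger0_norm.
have ev : ~~ odd k.+2 by rewrite /= negbK oddM.
have evE s a b : `|dev a b s| ^+ k.+2 = dev a b s ^+ k.+2.
  by rewrite -normrX ger0_norm// exprn_even_ge0.
have HA : `|fm 2 (fun s : nat -> config N => e s * dev 0 1 s ^+ k.+1) - fm 2 (fun s : nat -> config N => e s * devi i 0 1 s ^+ k.+1)|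
   <= 2 * k.+1%:R / N%:R * fm 2 (fun s : nat -> config N => D s ^+ k).
  rewrite -fmB -fmZ; apply: fm_norm_le => s; rewrite -mulrBr normrM.
  have -> : 2 * k.+1%:R / N%:R * D s ^+ k = 2 * (k.+1%:R * N%:R^-1 * D s ^+ k) by ring.
  apply: ler_pM => //.
  have := exprB_le k (devD s) (deviD s).
  have -> // : `|dev 0 1 s - devi i 0 1 s| = N%:R^-1.
  by rewrite /devi opprB addrCA subrr addr0 normrM spin2_norm mul1r ger0_norm.
have lD j : local_at 2 (fun s : nat -> config N => D s ^+ j).
  by move=> s s' H; rewrite /D (local_dev (n := 2) _ _ H).
have lf : local_at 2 (fun s : nat -> config N => e s * devi i 0 1 s ^+ k.+1).
  by move=> s s' H; rewrite /e !H// (local_devi i (n := 2) _ _ H).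
have qp := quad_path_cmean p beta h q i lf.
have Hpsi t : 0 <= t <= 1 ->
    `|cm i t 4 (fun s : nat -> config N => e s * devi i 0 1 s ^+ k.+1 * ker i 2 s)| <=
    2 / 3 * fm 2 (fun s : nat -> config N => dev 0 1 s ^+ k.+2) + 8 * C2 * (4 / 3) / N%:R * fm 2 (fun s : nat -> config N => D s ^+ k).
  move=> t01.
  (* T a b dominates one kernel entry times the odd power by functions of single pairs of replicas,
     which [cm_pair] and [cm_gronwall] bring back to (0, 1) and t = 1. *)
  pose T a b (s : nat -> config N) := 2 * kap0 / k.+2%:R * (k.+1%:R * dev 0 1 s ^+ k.+2 + dev a b s ^+ k.+2)
     + C2 / N%:R * D s ^+ k.
  have HT a b s : `|W i (s a) (s b)| * (2 * D s ^+ k.+1) <= T a b s.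
    rewrite /T -!evE; apply: HK => //; last exact: HW.
    - by rewrite normr_ge0 (dev_norm hp hq01 pN).
    - by rewrite normr_ge0 (dev_norm hp hq01 pN).
  have cmT a b : (a < 4)%N -> (b < 4)%N -> a != b ->
    cm i t 4 (T a b) <= 4 / 3 * (2 * kap0 * fm 2 (fun s : nat -> config N => dev 0 1 s ^+ k.+2) + C2 / N%:R * fm 2 (fun s : nat -> config N => D s ^+ k)).
    move=> a4 b4 ab; rewrite /T cmD !cmZ cmD cmZ.
    rewrite (cm_pair p beta h q i t (fun c e => (overlap R c e - q) ^+ k.+2) _ a4 b4 ab)//.
    rewrite -/(dev 0 1).
    have -> : k.+1%:R * cm i t 4 (fun s : nat -> config N => dev 0 1 s ^+ k.+2) + cm i t 4 (fun s : nat -> config N => (overlap R (s 0) (s 1) - q) ^+ k.+2)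
      = k.+2%:R * cm i t 4 (fun s : nat -> config N => dev 0 1 s ^+ k.+2).
      by rewrite -[k.+2%:R]natr1; ring.
    rewrite -[2 * kap0 / _ * _]mulrA mulKf ?pnatr_eq0//.
    rewrite (@cm_local R p beta h q N i t 2 4)//; last first.
      by move=> s s' H; rewrite (local_dev (n := 2) _ _ H).
    rewrite (@cm_local R p beta h q N i t 2 4)//.
    rewrite mulrDr; apply: lerD.
      rewrite [leRHS]mulrCA; apply: ler_wpM2l; first by rewrite mulr_ge0// kap0_ge0.
      apply: cm_gronwall => //.
      - by move=> s s' H; rewrite (local_dev (n := 2) _ _ H).
      - by move=> s; rewrite exprn_even_ge0.
    rewrite [leRHS]mulrCA; apply: ler_wpM2l; first by rewrite mulr_ge0.
    by apply: cm_gronwall => // s; rewrite exprn_ge0.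
  move: T HT cmT => T HT cmT.
  apply: (@le_trans _ _ (cm i t 4 (fun s : nat -> config N => T 0 1 s + 2 * (T 0 2 s + T 1 2 s) + 3 * T 2 3 s))).
    apply: cm_norm_le => s; rewrite normrM kernel2E.
    have ed : `|e s * devi i 0 1 s ^+ k.+1| <= 2 * D s ^+ k.+1.
      rewrite normrM; apply: ler_pM => //; rewrite normrX lerXn2r// nnegrE//.
    have Wt : `|W i (s 0) (s 1) - 2 * (W i (s 0) (s 2) + W i (s 1) (s 2)) + 3 * W i (s 2) (s 3)| <=
      `|W i (s 0) (s 1)| + 2 * (`|W i (s 0) (s 2)| + `|W i (s 1) (s 2)|) + 3 * `|W i (s 2) (s 3)|.
      have n2 : `|2| = 2 :> R by rewrite ger0_norm.
      have n3 : `|3| = 3 :> R by rewrite ger0_norm.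
      apply: (le_trans (ler_normD _ _)); rewrite [`|3 * _|]normrM n3 lerD2r.
      apply: (le_trans (ler_normB _ _)); rewrite [`|2 * _|]normrM n2 lerD2l; apply: ler_wpM2l => //.
      exact: ler_normD.
    apply: (le_trans (ler_pM (normr_ge0 _) (normr_ge0 _) ed Wt)).
    have := HT 0 1 s; have := HT 0 2 s; have := HT 1 2 s; have := HT 2 3 s.
    move: (T 0 1 s) (T 0 2 s) (T 1 2 s) (T 2 3 s) => x1 x2 x3 x4.
    move: (`|W i (s 0) (s 1)|) (`|W i (s 0) (s 2)|) (`|W i (s 1) (s 2)|) (`|W i (s 2) (s 3)|).
    by move: (2 * D s ^+ k.+1) => d w1 w2 w3 w4; rewrite !mulrDr; nra.
  have -> : cm i t 4 (fun s : nat -> config N => T 0 1 s + 2 * (T 0 2 s + T 1 2 s) + 3 * T 2 3 s) =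
    cm i t 4 (T 0 1) + 2 * (cm i t 4 (T 0 2) + cm i t 4 (T 1 2)) + 3 * cm i t 4 (T 2 3).
    by rewrite !cmD !cmZ cmD.
  have := cmT 0 1 isT isT isT; have := cmT 0 2 isT isT isT.
  have := cmT 1 2 isT isT isT; have := cmT 2 3 isT isT isT.
  have M0 : 0 <= fm 2 (fun s : nat -> config N => dev 0 1 s ^+ k.+2).
    by apply: fm_ge0 => s; rewrite exprn_even_ge0.
  have := ler_wpM2r M0 kap0_small.
  move: (cm i t 4 _) (cm i t 4 _) (cm i t 4 _) (cm i t 4 _) => x3 x4 x5 x6.
  set x1 := fm 2 _ in M0 *; set x2 := fm 2 _; move: x1 x2 M0 => x1 x2 M0 ? ? ? ? ?.
  have -> : 8 * C2 * (4 / 3) / N%:R * x2 = 8 * (4 / 3) * (C2 / N%:R * x2) by ring.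
  by lra.
(* As [cm0_centered] makes the value at t = 0 vanish, the bound on the derivative bounds the value
   at t = 1. *)
have HB := quad_path_le qp Hpsi.
rewrite /= cm0_centered// ?subr0 in HB; last first.
  exact: (flip_invariant_comp (fun z => z ^+ k.+1) (flip_invariant_devi i 0 1 pN)).
rewrite cmean1 in HB.
have -> : fm 2 (fun s : nat -> config N => (spin R (s 0) i * spin R (s 1) i - q) * dev 0 1 s ^+ k.+1) =
  (fm 2 (fun s : nat -> config N => e s * dev 0 1 s ^+ k.+1) - fm 2 (fun s : nat -> config N => e s * devi i 0 1 s ^+ k.+1)) +
  fm 2 (fun s : nat -> config N => e s * devi i 0 1 s ^+ k.+1) by rewrite subrK.
apply: (le_trans (ler_normD _ _)); rewrite !mulrDl.
by move: HA HB; lra.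
Qed.

Lemma even_moment (m : nat) : exists2 C : R, 0 <= C & forall N, (p <= N)%N ->
  fm 2 (fun s : nat -> config N => dev 0 1 s ^+ (2 * m)) <= C / N%:R ^+ m.
Proof.
elim: m => [|m [C C0 IH]].
  exists 1 => // N pN; rewrite muln0 expr0 divr1 -[leRHS](fm_cst N 2).
  by apply: fm_le => s; rewrite expr0.
have [C1 C10 HS] := step_const m.
(* The 3 is 1 / (1 - 2/3), from absorbing 2/3 of the moment into the left side. *)
exists (3 * (C1 * 2 ^+ (2 * m) * (C + 1))).
  by rewrite !mulr_ge0// ?exprn_ge0// addr_ge0.
move=> N pN; have N1 := Nge1 pN; have N0 : 0 < N%:R :> R by exact: lt_le_trans N1.
have iN0 : 0 <= N%:R^-1 :> R by rewrite invr_ge0 ltW.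
have iN1 : N%:R^-1 <= 1 :> R by rewrite invf_le1.
have -> : (2 * m.+1 = (2 * m).+2)%N by rewrite mulnS.
set M := fm 2 _.
have HM : M <= 2 / 3 * M + C1 / N%:R * fm 2 (fun s : nat -> config N => (`|dev 0 1 s| + N%:R^-1) ^+ (2 * m)).
  have ME : M = N%:R^-1 * \sum_(i < N)
     fm 2 (fun s : nat -> config N => (spin R (s 0) i * spin R (s 1) i - q) * dev 0 1 s ^+ (2 * m).+1).
    rewrite -fm_sum -fmZ; apply: eq_qmean => s.
    by rewrite exprS [X in X * _](dev_average _ _ _ pN) -mulrA mulr_suml.
  rewrite [leLHS]ME ler_pdivrMl//; apply: (le_trans (ler_norm _)).
  apply: (le_trans (ler_norm_sum _ _ _)).
  apply: (@le_trans _ _ (\sum_(i < N) (2 / 3 * M + C1 / N%:R * fm 2 (fun s : nat -> config N => (`|dev 0 1 s| + N%:R^-1) ^+ (2 * m))))).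
    by apply: ler_sum => i _; exact: HS.
  by rewrite sumr_const card_ord -[leLHS]mulr_natl.
have HD : fm 2 (fun s : nat -> config N => (`|dev 0 1 s| + N%:R^-1) ^+ (2 * m)) <= 2 ^+ (2 * m) * ((C + 1) / N%:R ^+ m).
  apply: (@le_trans _ _ (fm 2 (fun s : nat -> config N => 2 ^+ (2 * m) * (dev 0 1 s ^+ (2 * m) + N%:R^-1 ^+ m)))).
    apply: fm_le => s; apply: (le_trans (exprD_le2 _ _ _)) => //.
    apply: ler_wpM2l; first by rewrite exprn_ge0.
    apply: lerD; first by rewrite -normrX ger0_norm// exprn_even_ge0// oddM.
    by rewrite mul2n -addnn exprD ler_piMl ?exprn_ge0// exprn_ile1.
  rewrite fmZ ler_wpM2l ?exprn_ge0// fmD mulrDl; apply: lerD; first exact: IH.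
  by rewrite mul1r exprVn fm_cst.
have := ler_wpM2l (divr_ge0 C10 (ltW N0)) HD.
have -> : 3 * (C1 * 2 ^+ (2 * m) * (C + 1)) / N%:R ^+ m.+1 =
  3 * (C1 / N%:R * (2 ^+ (2 * m) * ((C + 1) / N%:R ^+ m))).
  by rewrite exprS invfM; ring.
by move: HM; lra.
Qed.

End EvenMoments.

(** * Counting powers of N^(-1/2) *)

Section OrderCalculus.
Context {R : realType} (p : nat) (beta h q : R).
Hypothesis hp : (2 <= p)%N.
Hypothesis hsmall : 8 * p%:R ^+ 2 * beta ^+ 2 <= 1 / 2.
Hypothesis hq01 : 0 <= q <= 1.
Hypothesis hq : q = tau p beta h q 2.

Local Notation cm i t n f := (cmean p beta h q i t n f).
Local Notation fm n f := (fmean p beta h q n f).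
Local Notation W := (Wcov p beta q).
Local Notation ker i n s := (kernel p beta q i n s).
Local Notation chat := (cov_limit p beta q).
Local Notation dev := (odev q).
Local Notation devi := (devi q).

Definition rt (N : nat) : R := (Num.sqrt N%:R)^-1.

Lemma rt_gt0 N : (p <= N)%N -> 0 < rt N.
Proof. by move=> pN; rewrite invr_gt0 sqrtr_gt0 (lt_le_trans ltr01)// (@Nge1 R p hp N pN). Qed.

Lemma rt_le1 N : (p <= N)%N -> rt N <= 1.
Proof.
move=> pN; have N1 := @Nge1 R p hp N pN; rewrite invf_le1 ?sqrtr_gt0 ?(lt_le_trans ltr01)//.
by rewrite -[leLHS](@sqrtr1 R) ler_wsqrtr.
Qed.

Lemma rt_sqr N : rt N ^+ 2 = N%:R^-1.
Proof. by rewrite exprVn sqr_sqrtr. Qed.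

Lemma cm_cst N (i : 'I_N) t n (c : R) : cm i t n (fun _ : nat -> config N => c) = c.
Proof. exact: qmean_cst. Qed.

(** Odd powers lie between the neighbouring even ones by AM-GM at the scale r = N^(-1/2). Eight
    replicas leave room for functions of four replicas and two kernels, each adding two. *)
Lemma abs_moment (k : nat) : exists2 C : R, 0 <= C &
  forall N (i : 'I_N) (t : R) a b, (p <= N)%N -> 0 <= t <= 1 ->
    (a < 8)%N -> (b < 8)%N -> a != b ->
    cm i t 8 (fun s => `|dev a b s| ^+ k) <= C * rt N ^+ k.
Proof.
have even m : exists2 C : R, 0 <= C &
  forall N (i : 'I_N) (t : R) a b, (p <= N)%N -> 0 <= t <= 1 ->
    (a < 8)%N -> (b < 8)%N -> a != b ->
    cm i t 8 (fun s => `|dev a b s| ^+ (2 * m)) <= C * rt N ^+ (2 * m).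
  have [C C0 HC] := even_moment hp hsmall hq01 hq m.
  exists (4 / 3 * C) => [|N i t a b pN t01 a8 b8 ab]; first by rewrite mulr_ge0.
  have ev : ~~ odd (2 * m) by rewrite oddM.
  rewrite (cm_pair p beta h q i t (fun c e => `|overlap R c e - q| ^+ (2 * m)) _ a8 b8 ab)//.
  have -> : cm i t 8 (fun s => `|overlap R (s 0) (s 1) - q| ^+ (2 * m)) =
    cm i t 8 (fun s => dev 0 1 s ^+ (2 * m)).
    by apply: eq_qmean => s; rewrite -normrX ger0_norm// exprn_even_ge0.
  rewrite (@cm_local R p beta h q N i t 2 8)//; last first.
    by move=> s s' H; rewrite (local_dev q (n := 2) _ _ H).
  apply: (@le_trans _ _ (4 / 3 * fm 2 (fun s : nat -> config N => dev 0 1 s ^+ (2 * m)))).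
    apply: cm_gronwall => //.
    + by move=> s s' H; rewrite (local_dev q (n := 2) _ _ H).
    + by move=> s; rewrite exprn_even_ge0.
  rewrite -[leRHS]mulrA; apply: ler_wpM2l => //; apply: (le_trans (HC N pN)).
  by rewrite exprM rt_sqr exprVn.
have [m [->|->]] : exists m, k = (2 * m)%N \/ k = (2 * m).+1.
  exists k./2; rewrite mul2n; have := odd_double_half k.
  by case: (odd k) => /= E; [right|left]; rewrite -[LHS]E.
  exact: even.
have [C C0 HC] := even m; have [C' C'0 HC'] := even m.+1.
exists ((C + C') / 2) => [|N i t a b pN t01 a8 b8 ab]; first by rewrite divr_ge0 ?addr_ge0.
have r0 := rt_gt0 pN; set r := rt N in r0 *.
have r0' : r != 0 by rewrite gt_eqF.
apply: (@le_trans _ _ (cm i t 8 (fun s => (2 * r)^-1 * `|dev a b s| ^+ (2 * m.+1) + r / 2 * `|dev a b s| ^+ (2 * m)))).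
  apply: cm_le => s; rewrite mulnS !exprS.
  have X0 : 0 <= `|dev a b s| ^+ (2 * m) by rewrite exprn_ge0.
  move: (`|dev a b s|) X0 => x; move: (x ^+ _) => X X0.
  have -> : (2 * r)^-1 * (x * (x * X)) + r / 2 * X = x * X + (2 * r)^-1 * X * (x - r) ^+ 2.
    by field.
  rewrite lerDl; apply: mulr_ge0; last exact: sqr_ge0.
  by apply: mulr_ge0 => //; rewrite invr_ge0 mulr_ge0// ltW.
rewrite cmD !cmZ.
apply: (@le_trans _ _ ((2 * r)^-1 * (C' * r ^+ (2 * m.+1)) + r / 2 * (C * r ^+ (2 * m)))).
  apply: lerD; apply: ler_wpM2l.
  - by rewrite invr_ge0 mulr_ge0// ltW.
  - exact: (HC' N i t a b).
  - by rewrite divr_ge0// ltW.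
  - exact: (HC N i t a b).
rewrite mulnS !exprS; move: (r ^+ _) => X.
by rewrite le_eqVlt; apply/orP; left; apply/eqP; field.
Qed.

(* [Delta] dominates the overlap deviations and is of order [N^(-1/2)]. *)
Definition replica_pairs : seq (nat * nat) :=
  [seq ab <- [seq (a, b) | a <- iota 0 8, b <- iota 0 8] | ab.1 != ab.2].

Definition Delta N (s : nat -> config N) : R :=
  rt N + \sum_(ab <- replica_pairs) `|dev ab.1 ab.2 s|.

Lemma Delta_moment (k : nat) : exists2 C : R, 0 <= C &
  forall N (i : 'I_N) (t : R), (p <= N)%N -> 0 <= t <= 1 ->
    cm i t 8 (fun s => Delta s ^+ k) <= C * rt N ^+ k.
Proof.
have [C C0 HC] := abs_moment k.
have : all (fun ab => [&& (ab.1 < 8)%N, (ab.2 < 8)%N & ab.1 != ab.2]) replica_pairs by [].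
rewrite /Delta; elim: replica_pairs => [_|[a b] l IH /= /andP[/and3P[a8 b8 ab] al]].
  exists 1 => // N i t pN t01; rewrite mul1r -[leRHS](cm_cst i t 8).
  by apply: cm_le => s; rewrite big_nil addr0.
have [C' C'0 HC'] := IH al.
exists (2 ^+ k * (C + C')) => [|N i t pN t01]; first by rewrite mulr_ge0 ?exprn_ge0 ?addr_ge0.
have r0 := rt_gt0 pN.
apply: (@le_trans _ _ (cm i t 8 (fun s => 2 ^+ k * (`|dev a b s| ^+ k + (rt N + \sum_(j <- l) `|dev j.1 j.2 s|) ^+ k)))).
  apply: cm_le => s; rewrite big_cons/= addrCA; apply: exprD_le2 => //.
  by rewrite addr_ge0 ?sumr_ge0// ltW.
rewrite cmZ cmD -mulrA ler_wpM2l ?exprn_ge0// mulrDl; apply: lerD; first exact: HC.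
exact: HC'.
Qed.

Lemma Delta_ge_rt N (s : nat -> config N) : rt N <= Delta s.
Proof. by rewrite lerDl sumr_ge0. Qed.

Lemma Delta_ge_dev N (s : nat -> config N) a b : (p <= N)%N -> (a < 8)%N -> (b < 8)%N -> a != b ->
  `|dev a b s| <= Delta s.
Proof.
move=> pN a8 b8 ab; have abp : (a, b) \in replica_pairs.
  by rewrite mem_filter; apply/andP; split => //; apply: allpairs_f; rewrite mem_iota.
rewrite /Delta (big_rem _ abp)/= addrCA lerDl addr_ge0 ?sumr_ge0//.
by rewrite ltW// rt_gt0.
Qed.

Lemma Delta_ge0 N (s : nat -> config N) : (p <= N)%N -> 0 <= Delta s.
Proof. by move=> pN; apply: le_trans (Delta_ge_rt s); rewrite ltW// rt_gt0. Qed.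

Lemma invN_le_Delta2 N (s : nat -> config N) : (p <= N)%N -> N%:R^-1 <= Delta s ^+ 2.
Proof.
move=> pN; rewrite -rt_sqr lerXn2r ?nnegrE ?Delta_ge_rt ?Delta_ge0//.
by rewrite ltW// rt_gt0.
Qed.

Definition Dmax : R := 1 + 2 * (size replica_pairs)%:R.

Lemma Delta_le N (s : nat -> config N) : (p <= N)%N -> Delta s <= Dmax.
Proof.
move=> pN; apply: lerD; first exact: rt_le1.
rewrite -sum1_size natr_sum mulr_sumr; apply: ler_sum => ab _.
by rewrite mulr1; exact: (dev_norm hp hq01 pN).
Qed.

Lemma Dmax_ge0 : 0 <= Dmax.
Proof. by rewrite addr_ge0// mulr_ge0. Qed.

Lemma cm_order (k : nat) : exists2 C : R, 0 <= C &
  forall N (i : 'I_N) (t A : R) (f : (nat -> config N) -> R), (p <= N)%N -> 0 <= t <= 1 -> 0 <= A ->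
    (forall s, `|f s| <= A * Delta s ^+ k) -> `|cm i t 8 f| <= A * C * rt N ^+ k.
Proof.
have [C C0 HC] := Delta_moment k; exists C => // N i t A f pN t01 A0 fA.
apply: (@le_trans _ _ (cm i t 8 (fun s => A * Delta s ^+ k))).
  exact: cm_norm_le.
by rewrite cmZ -mulrA ler_wpM2l// HC.
Qed.

Lemma Wcov_order : exists2 C : R, 0 <= C & forall N (i : 'I_N) (s : nat -> config N) a b,
  (p <= N)%N -> (a < 8)%N -> (b < 8)%N -> a != b -> `|W i (s a) (s b)| <= C * Delta s.
Proof.
have [C C0 HC] := Wcov_dev_le beta hp hq01.
exists (kap0 p beta + C) => [|N i s a b pN a8 b8 ab]; first by rewrite addr_ge0 ?kap0_ge0.
apply: (le_trans (HC N i (s a) (s b) pN)); rewrite mulrDl; apply: lerD.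
  by apply: ler_wpM2l; [exact: kap0_ge0|exact: Delta_ge_dev].
apply: ler_wpM2l => //; rewrite -rt_sqr.
apply: le_trans (Delta_ge_rt s); rewrite expr2 ler_piMr ?rt_le1//.
by rewrite ltW// rt_gt0.
Qed.

(** Only pairs of distinct replicas survive in the kernel, and for them [Wcov] is dominated by
    [Delta]. *)
Lemma kernel_order : exists2 C : R, 0 <= C & forall N (i : 'I_N) (s : nat -> config N) n,
  (p <= N)%N -> (n <= 6)%N -> `|ker i n s| <= C * Delta s.
Proof.
have [C C0 HC] := Wcov_order.
(* For n <= 6 the three parts of the kernel have total weights at most n^2 / 2, n^2 and n (n+1) /
   2. *)
exists (36 * C + 36 * C + 21 * C) => [|N i s n pN n6]; first by rewrite !addr_ge0 ?mulr_ge0.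
have D0 := Delta_ge0 s pN; have CD0 : 0 <= C * Delta s by rewrite mulr_ge0.
have n6R : n%:R <= 6 :> R by rewrite (ler_nat R n 6).
have n0R : 0 <= n%:R :> R by [].
have nn : n%:R * n%:R <= 36 :> R.
  by apply: (@le_trans _ _ (6 * 6)); [exact: ler_pM|lra].
have -> : ker i n s = (\sum_(l < n) \sum_(m < n) (if l == m then 0 else W i (s l) (s m))) / 2
  - n%:R * \sum_(l < n) W i (s l) (s n) + n%:R * (n%:R + 1) / 2 * W i (s n) (s n.+1).
  rewrite /kernel; congr (_ / 2 - _ + _).
  rewrite -[n in n%:R](card_ord n) -sum1_card natr_sum mulr_suml -sumrB.
  apply: eq_bigr => l _; rewrite mul1r (bigD1 l)//= [in RHS](bigD1 l)//= eqxx add0r.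
  rewrite (Wcov_diag p beta q i (s l) (s 0)) addrAC subrr add0r.
  by apply: eq_bigr => m ml; rewrite eq_sym (negbTE ml).
have small m : (m < n)%N -> (m < 8)%N by move=> mn; rewrite (leq_trans mn)// (leq_trans n6).
have n8 : (n < 8)%N by rewrite ltnS (leq_trans n6).
have n18 : (n.+1 < 8)%N by rewrite !ltnS.
have B1 : `|\sum_(l < n) \sum_(m < n) (if l == m then 0 else W i (s l) (s m))| <= n%:R * n%:R * (C * Delta s).
  apply: (le_trans (ler_norm_sum _ _ _)).
  apply: (@le_trans _ _ (\sum_(l < n) \sum_(m < n) (C * Delta s))).
    apply: ler_sum => l _; apply: (le_trans (ler_norm_sum _ _ _)); apply: ler_sum => m _.
    have [_|lm] := eqVneq l m; first by rewrite normr0.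
    by apply: HC => //; rewrite ?small.
  by rewrite !sumr_const !card_ord -[_ *+ n *+ n]mulr_natl -[C * _ *+ n]mulr_natl mulrA.
have B2 : `|\sum_(l < n) W i (s l) (s n)| <= n%:R * (C * Delta s).
  apply: (le_trans (ler_norm_sum _ _ _)).
  apply: (@le_trans _ _ (\sum_(l < n) (C * Delta s))).
    by apply: ler_sum => l _; apply: HC => //; [exact: small|rewrite neq_ltn ltn_ord].
  by rewrite sumr_const card_ord -[_ *+ n]mulr_natl.
have B3 : `|W i (s n) (s n.+1)| <= C * Delta s by apply: HC => //; rewrite neq_ltn ltnSn.
apply: (le_trans (ler_normD _ _)); rewrite [leRHS]mulrDl; apply: lerD.
  apply: (le_trans (ler_normB _ _)); rewrite mulrDl; apply: lerD.
    rewrite normrM [`|2^-1|]ger0_norm ?invr_ge0// -mulrA.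
    by have := ler_wpM2r CD0 nn; move: B1; move: (`|_|) => x; lra.
  rewrite normrM ger0_norm//.
  apply: (le_trans (ler_wpM2l n0R B2)).
  have -> : 36 * C * Delta s = 36 * (C * Delta s) by ring.
  by have := ler_wpM2r CD0 nn; rewrite -(mulrA n%:R n%:R).
have c0 : 0 <= n%:R * (n%:R + 1) / 2 :> R by rewrite divr_ge0// mulr_ge0// addr_ge0.
rewrite normrM (ger0_norm c0) -[leRHS]mulrA; apply: ler_pM => //.
by move: nn n6R; lra.
Qed.

(** The t-derivative carries one kernel, hence one more factor [Delta]. *)
Lemma cm_first_order (k : nat) : exists2 C : R, 0 <= C &
  forall N (i : 'I_N) (A : R) (f : (nat -> config N) -> R), (p <= N)%N -> 0 <= A ->
    local_at 6 f -> (forall s, `|f s| <= A * Delta s ^+ k) ->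
    `|fm 8 f - cm i 0 8 f| <= A * C * rt N ^+ k.+1.
Proof.
have [C C0 HC] := cm_order k.+1; have [CK CK0 HK] := kernel_order.
exists (CK * C) => [|N i A f pN A0 lf fA]; first by rewrite mulr_ge0.
have qp := quad_path_cmean p beta h q i lf.
rewrite -(cmean1 p beta h q i) !(@cm_local R p beta h q N i _ 6 8)//.
apply: (quad_path_le qp) => t t01; rewrite mulrA.
apply: HC => // [|s]; first by rewrite mulr_ge0.
rewrite normrM exprSr; have := HK N i s 6 pN (leqnn 6) => H.
apply: (le_trans (ler_pM (normr_ge0 _) (normr_ge0 _) (fA s) H)).
by rewrite le_eqVlt; apply/orP; left; apply/eqP; ring.
Qed.

(** The remainder of the expansion at t = 0 carries two kernels, on four and then on six replicas,
    hence two more factors [Delta]. *)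
Lemma cm_second_order (k : nat) : exists2 C : R, 0 <= C &
  forall N (i : 'I_N) (A : R) (f : (nat -> config N) -> R), (p <= N)%N -> 0 <= A ->
    local_at 4 f -> (forall s, `|f s| <= A * Delta s ^+ k) ->
    `|fm 8 f - cm i 0 8 f - cm i 0 8 (fun s => f s * ker i 4 s)| <= A * C * rt N ^+ k.+2.
Proof.
have [C C0 HC] := cm_order k.+2; have [CK CK0 HK] := kernel_order.
exists (CK * CK * C) => [|N i A f pN A0 lf fA]; first by rewrite !mulr_ge0.
have qp := quad_path_cmean p beta h q i lf.
have lf6 : local_at 6 (fun s => f s * ker i 4 s).
  move=> s s' H; rewrite (local_kernel p beta q i H); congr (_ * _).
  by apply: (local_at_le _ lf) H.
have qp2 := quad_path_cmean p beta h q i lf6.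
rewrite -(cmean1 p beta h q i) !(@cm_local R p beta h q N i _ 4 8 f)//.
rewrite (@cm_local R p beta h q N i _ 6 8)//.
apply: (quad_path2_le qp qp2) => t t01; rewrite mulrA.
apply: HC => // [|s]; first by rewrite !mulr_ge0.
rewrite !normrM !exprSr.
have H4 := HK N i s 4 pN isT; have H6 := HK N i s 6 pN isT.
apply: (le_trans (ler_pM _ (normr_ge0 _) (ler_pM (normr_ge0 _) (normr_ge0 _) (fA s) H4) H6)).
  by rewrite mulr_ge0.
by rewrite le_eqVlt; apply/orP; left; apply/eqP; ring.
Qed.

End OrderCalculus.

Lemma exprB_step (R : comPzRingType) (x e : R) (m : nat) :
  x ^+ m.+1 - (x - e) ^+ m.+1 - m.+1%:R * e * x ^+ m =
  (x - e) * (x ^+ m - (x - e) ^+ m - m%:R * e * x ^+ m.-1) - m%:R * e ^+ 2 * x ^+ m.-1.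
Proof.
case: m => [|k]; first by rewrite !expr0 !expr1; ring.
rewrite /= -[k.+2%:R]natr1 [x ^+ k.+2]exprS [(x - e) ^+ k.+2]exprS [x ^+ k.+1]exprS.
by move: (x ^+ k) ((x - e) ^+ k.+1) => X Y; ring.
Qed.

Local Opaque Delta Dmax.

(** * Expansions of the deviation, the covariance and the kernel *)

Section CavityExpansion.
Context {R : realType} (p : nat) (beta h q : R).
Hypothesis hp : (2 <= p)%N.
Hypothesis hsmall : 8 * p%:R ^+ 2 * beta ^+ 2 <= 1 / 2.
Hypothesis hq01 : 0 <= q <= 1.
Hypothesis hq : q = tau p beta h q 2.

Local Notation cm i t n f := (cmean p beta h q i t n f).
Local Notation fm n f := (fmean p beta h q n f).
Local Notation W := (Wcov p beta q).
Local Notation ker i n s := (kernel p beta q i n s).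
Local Notation chat := (cov_limit p beta q).
Local Notation dev := (odev q).
Local Notation devi := (devi q).
Local Notation rt := (@rt R).
Local Notation Delta := (Delta q).
Local Notation r4 := (tau p beta h q 4).

Let q0 : 0 <= q. Proof. by case/andP: hq01. Qed.
Let q1 : q <= 1. Proof. by case/andP: hq01. Qed.

Let DM : R := 1 + @Dmax R.
Let DM_ge0 : 0 <= DM. Proof. by rewrite addr_ge0 ?Dmax_ge0. Qed.

Section Pointwise.
Variables (N : nat) (i : 'I_N).
Hypothesis pN : (p <= N)%N.
Implicit Types s : nat -> config N.

Let D0 s : 0 <= Delta s. Proof. exact: (Delta_ge0 q hp). Qed.

Lemma devi_le s : `|devi i 0 1 s| <= DM * Delta s.
Proof.
apply: (le_trans (ler_normB _ _)); rewrite mulrDl mul1r; apply: lerD.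
  exact: (Delta_ge_dev q hp s pN).
rewrite normrM spin2_norm mul1r ger0_norm ?invr_ge0//.
apply: (le_trans (invN_le_Delta2 q hp s pN)); rewrite expr2.
by apply: ler_wpM2r; [exact: D0|exact: (Delta_le hp hq01)].
Qed.

Lemma dev_le s : `|dev 0 1 s| <= DM * Delta s.
Proof.
apply: (le_trans (Delta_ge_dev q hp s pN _ _ _)) => //.
by rewrite ler_peMl// lerDl Dmax_ge0.
Qed.

Lemma dev_subi s : `|dev 0 1 s - devi i 0 1 s| <= Delta s ^+ 2.
Proof.
rewrite /devi opprB addrCA subrr addr0 normrM spin2_norm mul1r ger0_norm ?invr_ge0//.
exact: (invN_le_Delta2 q hp).
Qed.

End Pointwise.

Lemma dev_pow_first (m : nat) : exists2 C : R, 0 <= C &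
  forall N (i : 'I_N) s, (p <= N)%N ->
    `|dev 0 1 s ^+ m - devi i 0 1 s ^+ m| <= C * Delta s ^+ m.+1.
Proof.
case: m => [|m].
  by exists 0 => // N i s pN; rewrite !expr0 subrr normr0 mul0r.
exists (m.+1%:R * DM ^+ m) => [|N i s pN]; first by rewrite mulr_ge0 ?exprn_ge0.
have D0 := Delta_ge0 q hp s pN.
apply: (le_trans (exprB_le _ (dev_le pN s) (devi_le i pN s))).
rewrite exprMn; apply: (@le_trans _ _ (m.+1%:R * Delta s ^+ 2 * (DM ^+ m * Delta s ^+ m))).
  apply: ler_wpM2r; first by rewrite mulr_ge0 ?exprn_ge0.
  by apply: ler_wpM2l => //; exact: dev_subi.
by rewrite !exprS; move: (DM ^+ m) => X; rewrite le_eqVlt; apply/orP; left; apply/eqP; ring.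
Qed.

(** Removing site i changes the deviation by eps eps' / N, which is at most Delta^2; the linear term
    in this change is kept because it produces the source term of the cavity equation. *)
Lemma dev_pow_second (m : nat) : exists2 C : R, 0 <= C &
  forall N (i : 'I_N) s, (p <= N)%N ->
    `|dev 0 1 s ^+ m - devi i 0 1 s ^+ m
      - m%:R * (spin R (s 0) i * spin R (s 1) i / N%:R) * dev 0 1 s ^+ m.-1| <= C * Delta s ^+ m.+2.
Proof.
elim: m => [|m [C C0 HC]].
  by exists 0 => // N i s pN; rewrite !expr0 subrr !mul0r subr0 normr0.
exists (DM * C + m%:R * DM ^+ m.-1) => [|N i s pN].
  by rewrite addr_ge0 ?mulr_ge0 ?exprn_ge0.
have D0 := Delta_ge0 q hp s pN.
set e := spin R (s 0) i * spin R (s 1) i / N%:R.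
have yE : devi i 0 1 s = dev 0 1 s - e by [].
have -> : dev 0 1 s ^+ m.+1 - devi i 0 1 s ^+ m.+1 - m.+1%:R * e * dev 0 1 s ^+ m.+1.-1 =
  devi i 0 1 s * (dev 0 1 s ^+ m - devi i 0 1 s ^+ m - m%:R * e * dev 0 1 s ^+ m.-1)
  - m%:R * e ^+ 2 * dev 0 1 s ^+ m.-1.
  by rewrite yE; exact: exprB_step.
have eD : `|e| <= Delta s ^+ 2.
  by rewrite (_ : e = dev 0 1 s - devi i 0 1 s) ?dev_subi// yE; ring.
apply: (le_trans (ler_normB _ _)); rewrite [leRHS]mulrDl; apply: lerD.
  rewrite normrM; apply: (le_trans (ler_pM (normr_ge0 _) (normr_ge0 _) (devi_le i pN s) (HC N i s pN))).
  by rewrite le_eqVlt; apply/orP; left; apply/eqP; rewrite !exprS; ring.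
rewrite [leLHS]normrM [`|m%:R * _|]normrM (ger0_norm (ler0n _ m)) [`|e ^+ 2|]normrX.
case: (m) => [|k]; first by rewrite !mul0r.
have E2 : `|e| ^+ 2 <= (Delta s ^+ 2) ^+ 2 by rewrite lerXn2r ?nnegrE// exprn_ge0.
have Ek : `|dev 0 1 s ^+ k| <= (DM * Delta s) ^+ k.
  by rewrite normrX lerXn2r ?nnegrE ?mulr_ge0// dev_le.
have kR : 0 <= k.+1%:R :> R by [].
apply: (le_trans (ler_pM _ (normr_ge0 _) (ler_wpM2l kR E2) Ek)).
  by rewrite mulr_ge0// exprn_ge0.
rewrite [(DM * _) ^+ k]exprMn le_eqVlt; apply/orP; left; apply/eqP.
rewrite [k.+1.-1]/= [Delta s ^+ k.+4]exprS [Delta s ^+ k.+3]exprS [Delta s ^+ k.+2]exprS [Delta s ^+ k.+1]exprS.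
by move: (DM ^+ k) (Delta s ^+ k) (Delta s) => X Y Z; ring.
Qed.

(** The derivative of beta^2 (p/2) r^(p-1) at r = q. *)
Definition ecoef : R := kap0 p beta * q ^+ p.-2.

Lemma ecoef_bounds : 0 <= ecoef <= 1 / 32.
Proof.
have k0 := kap0_ge0 p beta; have k1 := kap0_small hsmall.
have Q0 : 0 <= q ^+ p.-2 by rewrite exprn_ge0.
have Q1 : q ^+ p.-2 <= 1 by rewrite exprn_ile1.
rewrite /ecoef mulr_ge0//=; have := ler_wpM2l k0 Q1; lra.
Qed.

Lemma cavity_cov_order : exists2 C : R, 0 <= C &
  forall N (i : 'I_N) s a b, (p <= N)%N -> (a < 8)%N -> (b < 8)%N -> a != b ->
    `|cavity_cov p beta i (s a) (s b) - chat| <= C * Delta s.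
Proof.
have [C C0 HC] := Wcov_order beta hp hq01; exists C => // N i s a b pN a8 b8 ab.
by rewrite -Wcov_norm; exact: HC.
Qed.

(** Taylor expansion at q of beta^2 (p/2) R^(p-1); the error 1/N of [cavity_cov_asymp] is also at
    most Delta^2. *)
Lemma cavity_cov_order2 : exists2 C : R, 0 <= C &
  forall N (i : 'I_N) s a b, (p <= N)%N -> (a < 8)%N -> (b < 8)%N -> a != b ->
    `|cavity_cov p beta i (s a) (s b) - chat - ecoef * dev a b s| <= C * Delta s ^+ 2.
Proof.
have [C1 HC1] := cavity_cov_asymp beta hp; have [C2 HC2] := @expr_taylor2 R p.-1.
have K0 : 0 <= beta ^+ 2 * (p%:R / 2) by apply: mulr_ge0 => //; exact: sqr_ge0.
exists (`|C1| + beta ^+ 2 * (p%:R / 2) * `|C2|) => [|N i s a b pN a8 b8 ab].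
  by apply: addr_ge0 => //; exact: mulr_ge0.
set K := beta ^+ 2 * (p%:R / 2) in K0 *.
set ov := overlap R (s a) (s b).
have -> : cavity_cov p beta i (s a) (s b) - chat - ecoef * dev a b s =
  (cavity_cov p beta i (s a) (s b) - K * ov ^+ p.-1) +
  K * (ov ^+ p.-1 - q ^+ p.-1 - p.-1%:R * q ^+ p.-2 * (ov - q)).
  by rewrite cov_limitE// -/K /ecoef /kap0 -/K /odev -/ov; ring.
apply: (le_trans (ler_normD _ _)); rewrite [leRHS]mulrDl; apply: lerD.
  apply: (le_trans (HC1 _ _ _ _)); apply: (@le_trans _ _ (`|C1| / N%:R)).
    by rewrite ler_wpM2r ?invr_ge0// ler_norm.
  by rewrite ler_wpM2l//; exact: (invN_le_Delta2 q hp s pN).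
rewrite normrM (ger0_norm K0) -[leRHS]mulrA; apply: ler_wpM2l => //.
have q1' : `|q| <= 1 by rewrite ger0_norm.
apply: (le_trans (HC2 ov q (overlap_norm hp pN _ _) q1')).
apply: (@le_trans _ _ (`|C2| * (ov - q) ^+ 2)).
  by rewrite ler_wpM2r ?sqr_ge0// ler_norm.
rewrite ler_wpM2l// -(real_normK (num_real (ov - q))).
have D0 := Delta_ge0 q hp s pN.
by apply: lerXn2r; rewrite ?nnegrE//; exact: (Delta_ge_dev q hp s pN).
Qed.

(* covariance of [eps_a eps_b] and [eps_c eps_d] at the start of the interpolation *)
Definition kap (a b c d : nat) : R :=
  if (a == c) && (b == d) || (a == d) && (b == c) then 1 - q ^+ 2
  else if [|| a == c, a == d, b == c | b == d] then q - q ^+ 2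
  else r4 - q ^+ 2.

(** Coinciding replicas cancel since spins square to 1; what remains is a product over 0, 2 or 4
    distinct replicas, of mean 1, q or [tau 4]. *)
Lemma cm0_pairs N (i : 'I_N) a b c d (g : (nat -> config N) -> R) : flip_invariant i g ->
  (a < 8)%N -> (b < 8)%N -> (c < 8)%N -> (d < 8)%N -> a != b -> c != d ->
  cm i 0 8 (fun s => (spin R (s a) i * spin R (s b) i - q) * (spin R (s c) i * spin R (s d) i) * g s)
  = kap a b c d * cm i 0 8 g.
Proof.
move=> gi a8 b8 c8 d8 ab cd.
have two x y : (x < 8)%N -> (y < 8)%N -> x != y ->
    cm i 0 8 (fun s => spin R (s x) i * spin R (s y) i * g s) = q * cm i 0 8 g.
  move=> x8 y8 xy.
  have uxy : uniq [:: x; y] by rewrite /= inE xy.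
  have axy : all (fun l => (l < 8)%N) [:: x; y] by rewrite /= x8 y8.
  have := @cmean0_spins R p beta h q N i 8 g [:: x; y] gi uxy axy.
  rewrite -[size _]/2%N -hq => <-.
  by apply: eq_qmean => s; rewrite big_cons big_seq1.
have red x : cm i 0 8 (fun s => spin R (s a) i * spin R (s b) i * (spin R (s c) i * spin R (s d) i) * g s)
    = x * cm i 0 8 g ->
  cm i 0 8 (fun s => (spin R (s a) i * spin R (s b) i - q) * (spin R (s c) i * spin R (s d) i) * g s)
  = (x - q ^+ 2) * cm i 0 8 g.
  move=> H; rewrite mulrBl -H expr2 -mulrA -(two c d)// -cmZ -cmB.
  by apply: eq_qmean => s; ring.
have share x y z : (y < 8)%N -> (z < 8)%N -> y != z ->
   (forall s, spin R (s a) i * spin R (s b) i * (spin R (s c) i * spin R (s d) i) =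
     (spin R (s x) i * spin R (s x) i) * (spin R (s y) i * spin R (s z) i)) ->
   cm i 0 8 (fun s => spin R (s a) i * spin R (s b) i * (spin R (s c) i * spin R (s d) i) * g s)
    = q * cm i 0 8 g.
  move=> y8 z8 yz H; rewrite -(two y z)//; apply: eq_qmean => s.
  by rewrite H spin_sqr mul1r.
rewrite /kap; case: ifP => [same|].
  apply: red; rewrite mul1r; apply: eq_qmean => s.
  have -> : spin R (s a) i * spin R (s b) i * (spin R (s c) i * spin R (s d) i) =
    (spin R (s a) i * spin R (s a) i) * (spin R (s b) i * spin R (s b) i).
    by case/orP: same => /andP[/eqP -> /eqP ->]; ring.
  by rewrite !spin_sqr !mul1r.
have [ac|ac] := eqVneq a c.
  have bc : (b == c) = false by rewrite -ac eq_sym (negbTE ab).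
  rewrite /= bc andbF orbF => bd.
  by apply: red; apply: (share a b d) => //; [rewrite bd|move=> s; rewrite -ac; ring].
have [ad|ad] := eqVneq a d.
  rewrite /= => bc; apply: red; apply: (share a b c) => //; first by rewrite bc.
  by move=> s; rewrite -ad; ring.
have [bc|bc] := eqVneq b c.
  by move=> _ /=; apply: red; apply: (share b a d) => // s; rewrite -bc; ring.
have [bd|bd] := eqVneq b d.
  by move=> _ /=; apply: red; apply: (share b a c) => // s; rewrite -bd; ring.
have uxy : uniq [:: a; b; c; d] by rewrite /= !inE !negb_or ab ac ad bc bd cd.
have axy : all (fun l => (l < 8)%N) [:: a; b; c; d] by rewrite /= a8 b8 c8 d8.
move=> _ /=; apply: red.
have := @cmean0_spins R p beta h q N i 8 g [:: a; b; c; d] gi uxy axy.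
rewrite -[size _]/4%N => <-.
by apply: eq_qmean => s; rewrite !big_cons big_nil; ring.
Qed.

(** Pairs of replicas with their coefficients in the kernel for n = 4: the six old pairs, weight -n
    with the first new replica, and n (n+1) / 2 = 10 for the two new ones. *)
Definition kernel4_terms : seq (nat * nat * R) :=
  [:: ((0, 1)%N, 1); ((0, 2)%N, 1); ((0, 3)%N, 1); ((1, 2)%N, 1); ((1, 3)%N, 1);
      ((2, 3)%N, 1); ((0, 4)%N, - 4); ((1, 4)%N, - 4); ((2, 4)%N, - 4); ((3, 4)%N, - 4);
      ((4, 5)%N, 10)].

Lemma kernel4E N (i : 'I_N) s :
  ker i 4 s = \sum_(t <- kernel4_terms) t.2 * W i (s t.1.1) (s t.1.2).
Proof.
rewrite /kernel4_terms !big_cons big_nil/= /kernel !big_ord_recl !big_ord0/=.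
rewrite /bump/= !add1n !addr0.
rewrite (WcovC p beta q i (s 1) (s 0)) (WcovC p beta q i (s 2) (s 0)) (WcovC p beta q i (s 3) (s 0)).
rewrite (WcovC p beta q i (s 2) (s 1)) (WcovC p beta q i (s 3) (s 1)) (WcovC p beta q i (s 3) (s 2)).
rewrite (Wcov_diag p beta q i (s 1) (s 0)) (Wcov_diag p beta q i (s 2) (s 0)) (Wcov_diag p beta q i (s 3) (s 0)).
by field.
Qed.

End CavityExpansion.

(** * The cavity equation for mixed moments, and its linear system *)

Section CavityEquation.
Context {R : realType} (p : nat) (beta h q : R).
Hypothesis hp : (2 <= p)%N.
Hypothesis hsmall : 8 * p%:R ^+ 2 * beta ^+ 2 <= 1 / 2.
Hypothesis hq01 : 0 <= q <= 1.
Hypothesis hq : q = tau p beta h q 2.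

Local Notation cm i t n f := (cmean p beta h q i t n f).
Local Notation fm n f := (fmean p beta h q n f).
Local Notation W := (Wcov p beta q).
Local Notation ker i n s := (kernel p beta q i n s).
Local Notation chat := (cov_limit p beta q).
Local Notation dev := (odev q).
Local Notation devi := (devi q).
Local Notation rt := (@rt R).
Local Notation Delta := (Delta q).
Local Notation kap := (kap p beta h q).
Local Notation ecoef := (ecoef p beta q).

Let q0 : 0 <= q. Proof. by case/andP: hq01. Qed.
Let q1 : q <= 1. Proof. by case/andP: hq01. Qed.

Let e N (i : 'I_N) a b (s : nat -> config N) : R := spin R (s a) i * spin R (s b) i - q.

Let e_le2 N (i : 'I_N) a b s : `|e i a b s| <= 2.
Proof.
apply: (le_trans (ler_normB _ _)); rewrite spin2_norm (ger0_norm q0).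
by have := q1; lra.
Qed.

Lemma fm_order (k : nat) : exists2 C : R, 0 <= C &
  forall N (i : 'I_N) (A : R) (f : (nat -> config N) -> R), (p <= N)%N -> 0 <= A ->
    (forall s, `|f s| <= A * Delta s ^+ k) -> `|fm 8 f| <= A * C * rt N ^+ k.
Proof.
have [C C0 HC] := cm_order hp hsmall hq01 hq k; exists C => // N i A f pN A0 fA.
by rewrite -(cmean1 p beta h q i); apply: HC => //; rewrite lexx ler01.
Qed.

Section Pair.
Variables (a b c d : nat).
Hypotheses (a6 : (a < 6)%N) (b6 : (b < 6)%N) (c6 : (c < 6)%N) (d6 : (d < 6)%N).
Hypotheses (ab : a != b) (cd : c != d).

Let lt68 x : (x < 6)%N -> (x < 8)%N. Proof. by move=> H; rewrite (ltn_trans H). Qed.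

(** F is an expression in overlaps and G its approximation not seeing the spins at i. At t = 0 the
    spins factor out of G; going to F, and then to t = 1, costs one order each, in parallel. *)
Lemma cm0_pair_replace (k : nat) : exists2 C : R, 0 <= C &
  forall N (i : 'I_N) (A : R) (F G : (nat -> config N) -> R), (p <= N)%N -> 0 <= A ->
    local_at 6 F -> flip_invariant i G ->
    (forall s, `|F s| <= A * Delta s ^+ k) ->
    (forall s, `|F s - G s| <= A * Delta s ^+ k.+1) ->
    `|cm i 0 8 (fun s => e i a b s * (spin R (s c) i * spin R (s d) i) * G s) - kap a b c d * fm 8 F|
    <= A * C * rt N ^+ k.+1.
Proof.
have [C1 C10 H1] := cm_order hp hsmall hq01 hq k.+1.
have [C2 C20 H2] := cm_first_order hp hsmall hq01 hq k.
exists (`|kap a b c d| * (C1 + C2)) => [|N i A F G pN A0 lF fG FA FG].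
  by rewrite mulr_ge0// addr_ge0.
rewrite /e (cm0_pairs hq fG) ?lt68// -mulrBr normrM.
have -> : A * (`|kap a b c d| * (C1 + C2)) * rt N ^+ k.+1 =
  `|kap a b c d| * (A * C1 * rt N ^+ k.+1 + A * C2 * rt N ^+ k.+1) by ring.
apply: ler_wpM2l => //.
have H1' := H1 N i 0 A (fun s => F s - G s) pN; rewrite cmB lexx ler01 in H1'.
have := H2 N i A F pN A0 lF FA; have := H1' isT A0 FG.
move: (cm _ _ _ _) (cm _ _ _ _) (fm _ _) => x y z.
rewrite !ler_norml => /andP[? ?] /andP[? ?]; apply/andP; split; lra.
Qed.

Lemma fm_pair_replace (k : nat) : exists2 C : R, 0 <= C &
  forall N (i : 'I_N) (A : R) (F G : (nat -> config N) -> R), (p <= N)%N -> 0 <= A ->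
    local_at 6 F -> flip_invariant i G ->
    (forall s, `|F s| <= A * Delta s ^+ k) ->
    (forall s, `|F s - G s| <= A * Delta s ^+ k.+1) ->
    `|fm 8 (fun s => e i a b s * (spin R (s c) i * spin R (s d) i) * F s) - kap a b c d * fm 8 F|
    <= A * C * rt N ^+ k.+1.
Proof.
have [C1 C10 H1] := cm_order hp hsmall hq01 hq k.+1.
have [C2 C20 H2] := cm_first_order hp hsmall hq01 hq k.
have [C3 C30 H3] := cm0_pair_replace k.
exists (2 * C1 + 2 * C2 + C3) => [|N i A F G pN A0 lF fG FA FG].
  by rewrite !addr_ge0// mulr_ge0.
pose w (s : nat -> config N) := e i a b s * (spin R (s c) i * spin R (s d) i).
have w2 (s : nat -> config N) : `|w s| <= 2 by rewrite normrM spin2_norm mulr1.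
have A20 : 0 <= 2 * A by rewrite mulr_ge0.
have D1 : `|cm i 0 8 (fun s => w s * F s - w s * G s)| <= 2 * A * C1 * rt N ^+ k.+1.
  apply: H1 => // [|s]; first by rewrite lexx ler01.
  by rewrite -mulrBr normrM -mulrA; apply: ler_pM.
have lw : local_at 6 (fun s => w s * F s).
  by move=> s s' H; rewrite /w /e (lF _ _ H) !H.
have D2 : `|fm 8 (fun s => w s * F s) - cm i 0 8 (fun s => w s * F s)| <= 2 * A * C2 * rt N ^+ k.+1.
  apply: H2 => // s; rewrite normrM -mulrA; exact: ler_pM.
have := H3 N i A F G pN A0 lF fG FA FG; rewrite -/(w _).
move: D1 D2; rewrite cmB !mulrDr !mulrDl /w.
move: (cm _ _ _ _) (cm _ _ _ _) (fm _ _) (kap _ _ _ _ * _) => x y z t.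
rewrite !ler_norml => /andP[? ?] /andP[? ?] /andP[? ?]; apply/andP; split; lra.
Qed.

End Pair.

(** [Wcov] is eps_c eps_d times a covariance invariant under flips at i. The spins give [kap], and
    the linear part of the covariance gives [ecoef] times the deviation. *)
Lemma kernel_pair_replace (j a b c d : nat) : (a < 6)%N -> (b < 6)%N -> (c < 6)%N -> (d < 6)%N ->
  a != b -> c != d ->
  exists2 C : R, 0 <= C & forall N (i : 'I_N), (p <= N)%N ->
    `|cm i 0 8 (fun s => e i a b s * devi i 0 1 s ^+ j * W i (s c) (s d))
      - ecoef * kap a b c d * fm 8 (fun s : nat -> config N => dev c d s * dev 0 1 s ^+ j)| <= C * rt N ^+ j.+2.
Proof.
move=> a6 b6 c6 d6 ab cd.
have c8 : (c < 8)%N by rewrite (ltn_trans c6).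
have d8 : (d < 8)%N by rewrite (ltn_trans d6).
have [C3 C30 H3] := cm0_pair_replace a6 b6 c6 d6 ab cd j.+1.
have [C1 C10 HC1] := dev_pow_first hp hq01 j.
have [C2 C20 HC2] := cavity_cov_order beta hp hq01.
have [C4 C40 HC4] := cavity_cov_order2 beta hp hq01.
pose DM : R := 1 + @Dmax R; have DM0 : 0 <= DM by rewrite addr_ge0 ?Dmax_ge0.
pose A := `|ecoef| * DM ^+ j + C1 * C2 + DM ^+ j * C4.
have eD0 : 0 <= `|ecoef| * DM ^+ j by rewrite mulr_ge0// exprn_ge0.
have A10 : 0 <= C1 * C2 by rewrite mulr_ge0.
have A40 : 0 <= DM ^+ j * C4 by rewrite mulr_ge0 ?exprn_ge0.
have A0 : 0 <= A by rewrite !addr_ge0.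
exists (A * C3) => [|N i pN]; first by rewrite mulr_ge0.
pose F (s : nat -> config N) := ecoef * (dev c d s * dev 0 1 s ^+ j).
pose G (s : nat -> config N) := devi i 0 1 s ^+ j * (cavity_cov p beta i (s c) (s d) - chat).
have lF : local_at 6 F.
  by move=> s s' H; rewrite /F (local_dev (n := 6) _ _ _ H)// (local_dev (n := 6) _ _ _ H).
have fG : flip_invariant i G.
  move=> l s; rewrite /G (flip_invariant_devi q hp i 0 1 pN).
  congr (_ * (_ - _)); rewrite /flip_at; have [cl|cl] := eqVneq c l.
    by rewrite -cl upd_same upd_other 1?eq_sym// cavity_cov_flipl.
  rewrite [upd _ _ _ c]upd_other//; have [dl|dl] := eqVneq d l.
    by rewrite -dl upd_same cavity_cov_flipr.
  by rewrite upd_other.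
have DJ (s : nat -> config N) : `|dev 0 1 s ^+ j| <= DM ^+ j * Delta s ^+ j.
  rewrite normrX -exprMn; apply: lerXn2r; rewrite ?nnegrE//; last exact: (dev_le q hp pN).
  by rewrite mulr_ge0// (Delta_ge0 q hp).
have FA (s : nat -> config N) : `|F s| <= A * Delta s ^+ j.+1.
  have D0 := Delta_ge0 q hp s pN.
  have Dj0 : 0 <= Delta s ^+ j.+1 by rewrite exprn_ge0.
  apply: (@le_trans _ _ (`|ecoef| * DM ^+ j * Delta s ^+ j.+1)); last first.
    by apply: ler_wpM2r => //; rewrite /A -addrA lerDl addr_ge0.
  have H := Delta_ge_dev q hp s pN c8 d8 cd.
  rewrite /F [leLHS]normrM -[leRHS]mulrA; apply: ler_wpM2l => //.
  rewrite [leLHS]normrM exprS [leRHS]mulrCA; exact: ler_pM.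
have FG (s : nat -> config N) : `|F s - G s| <= A * Delta s ^+ j.+2.
  have D0 := Delta_ge0 q hp s pN.
  have Dj0 : 0 <= Delta s ^+ j.+2 by rewrite exprn_ge0.
  apply: (@le_trans _ _ ((C1 * C2 + DM ^+ j * C4) * Delta s ^+ j.+2)); last first.
    by apply: ler_wpM2r => //; rewrite /A -addrA lerDr.
  have -> : F s - G s =
     (dev 0 1 s ^+ j - devi i 0 1 s ^+ j) * (cavity_cov p beta i (s c) (s d) - chat)
     - dev 0 1 s ^+ j * (cavity_cov p beta i (s c) (s d) - chat - ecoef * dev c d s).
    rewrite /F /G; move: (dev 0 1 s ^+ j) (devi i 0 1 s ^+ j) (dev c d s) => x y z.
    by move: (cavity_cov p beta i (s c) (s d)) chat ecoef => u v w; ring.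
  apply: (le_trans (ler_normB _ _)); rewrite [leRHS]mulrDl; apply: lerD.
    rewrite normrM exprSr mulrACA; apply: ler_pM => //; first exact: HC1.
    exact: HC2.
  rewrite normrM -addn2 exprD mulrACA; apply: ler_pM => //; exact: HC4.
have := H3 N i A F G pN A0 lF fG FA FG.
rewrite /F fmZ [kap _ _ _ _ * (_ * _)]mulrA [kap _ _ _ _ * ecoef]mulrC.
congr (`|_ - _| <= _); apply: eq_qmean => s; rewrite /G /Wcov.
by move: (devi i 0 1 s ^+ j) (cavity_cov p beta i (s c) (s d) - chat) (e i a b s) => x y z; ring.
Qed.

(** Two contributions survive at this order: restoring site i in the j-th power gives the term in
    j/N, and the first t-derivative at 0 gives the sum over the pairs in the kernel. The value at t
    = 0 vanishes by centering. *)
Lemma cavity_equation (j a b : nat) : (a < 4)%N -> (b < 4)%N -> a != b ->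
  exists2 C : R, 0 <= C & forall N (i : 'I_N), (p <= N)%N ->
    `|fm 8 (fun s => e i a b s * dev 0 1 s ^+ j)
      - (j%:R / N%:R * kap a b 0 1 * fm 8 (fun s : nat -> config N => dev 0 1 s ^+ j.-1)
         + ecoef * \sum_(t <- kernel4_terms) t.2 * kap a b t.1.1 t.1.2 *
             fm 8 (fun s : nat -> config N => dev t.1.1 t.1.2 s * dev 0 1 s ^+ j))|
    <= C * rt N ^+ j.+2.
Proof.
move=> a4 b4 ab.
have a6 : (a < 6)%N by rewrite (ltn_trans a4).
have b6 : (b < 6)%N by rewrite (ltn_trans b4).
have a8 : (a < 8)%N by rewrite (ltn_trans a4).
have b8 : (b < 8)%N by rewrite (ltn_trans b4).
pose DM : R := 1 + @Dmax R; have DM0 : 0 <= DM by rewrite addr_ge0 ?Dmax_ge0.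
have DJ m N (s : nat -> config N) : (p <= N)%N -> `|@dev N 0 1 s ^+ m| <= DM ^+ m * Delta s ^+ m.
  move=> pN; rewrite normrX -exprMn; apply: lerXn2r; rewrite ?nnegrE//; last exact: (dev_le q hp pN).
  by rewrite mulr_ge0// (Delta_ge0 q hp).
have DJi m N i (s : nat -> config N) : (p <= N)%N -> `|@devi N i 0 1 s ^+ m| <= DM ^+ m * Delta s ^+ m.
  move=> pN; rewrite normrX -exprMn; apply: lerXn2r; rewrite ?nnegrE//; last exact: (devi_le hp hq01 i pN).
  by rewrite mulr_ge0// (Delta_ge0 q hp).
have [C1 C10 HC1] := dev_pow_second hp hq01 j.
have [C2 C20 HC2] := fm_order j.+2.
have E1 : exists2 C : R, 0 <= C & forall N (i : 'I_N), (p <= N)%N ->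
  `|j%:R / N%:R * fm 8 (fun s => e i a b s * (spin R (s 0) i * spin R (s 1) i) * dev 0 1 s ^+ j.-1)
    - j%:R / N%:R * kap a b 0 1 * fm 8 (fun s : nat -> config N => dev 0 1 s ^+ j.-1)| <= C * rt N ^+ j.+2.
  case: (j) => [|m]; first by exists 0 => // N i pN; rewrite !mul0r subrr normr0.
  have [C3 C30 HC3] := @fm_pair_replace a b 0 1 a6 b6 isT isT ab isT m.
  have [C4 C40 HC4] := dev_pow_first hp hq01 m.
  have M0 : 0 <= DM ^+ m by rewrite exprn_ge0.
  exists (m.+1%:R * ((DM ^+ m + C4) * C3)) => [|N i pN].
    by apply: mulr_ge0 => //; apply: mulr_ge0 => //; exact: addr_ge0.
  rewrite -[_ * kap _ _ _ _ * _]mulrA -mulrBr normrM /=.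
  have -> : `|m.+1%:R / N%:R| = m.+1%:R * rt N ^+ 2 :> R.
    by rewrite rt_sqr ger0_norm.
  have -> : m.+1%:R * ((DM ^+ m + C4) * C3) * rt N ^+ m.+3 =
    m.+1%:R * rt N ^+ 2 * ((DM ^+ m + C4) * C3 * rt N ^+ m.+1).
    by rewrite -[m.+3]addn2 [rt N ^+ (_ + 2)]exprD; move: (rt N ^+ 2) (rt N ^+ m.+1) => x y; ring.
  apply: ler_wpM2l; first by apply: mulr_ge0 => //; exact: sqr_ge0.
  apply: (HC3 N i _ _ (fun s => devi i 0 1 s ^+ m)) => //.
  - exact: addr_ge0.
  - by move=> s s' H; rewrite (local_dev (n := 6) _ _ _ H).
  - exact: (flip_invariant_comp (fun z => z ^+ m) (flip_invariant_devi q hp i 0 1 pN)).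
  - move=> s; apply: (le_trans (DJ m N s pN)); apply: ler_wpM2r; last by rewrite lerDl.
    by rewrite exprn_ge0// (Delta_ge0 q hp).
  - move=> s; apply: (le_trans (HC4 N i s pN)); apply: ler_wpM2r; last by rewrite lerDr.
    by rewrite exprn_ge0// (Delta_ge0 q hp).
have E2 : exists2 C : R, 0 <= C & forall N (i : 'I_N), (p <= N)%N ->
  `|cm i 0 8 (fun s => e i a b s * devi i 0 1 s ^+ j * ker i 4 s) -
    ecoef * \sum_(t <- kernel4_terms) t.2 * kap a b t.1.1 t.1.2 *
             fm 8 (fun s : nat -> config N => dev t.1.1 t.1.2 s * dev 0 1 s ^+ j)| <= C * rt N ^+ j.+2.
  have H : exists2 C : R, 0 <= C & forall N (i : 'I_N), (p <= N)%N ->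
     `|\sum_(t <- kernel4_terms) t.2 * cm i 0 8 (fun s => e i a b s * devi i 0 1 s ^+ j * W i (s t.1.1) (s t.1.2)) -
    ecoef * \sum_(t <- kernel4_terms) t.2 * kap a b t.1.1 t.1.2 *
             fm 8 (fun s : nat -> config N => dev t.1.1 t.1.2 s * dev 0 1 s ^+ j)| <= C * rt N ^+ j.+2.
    have : all (fun t : nat * nat * R => [&& (t.1.1 < 6)%N, (t.1.2 < 6)%N & t.1.1 != t.1.2])
      (kernel4_terms : seq (nat * nat * R)) by [].
    elim: (kernel4_terms : seq (nat * nat * R)) => [_|[[c d] w] l IH /= /andP[/and3P[c6 d6 cd] al]].
      by exists 0 => // N i pN; rewrite !big_nil mulr0 subrr normr0 mul0r.
    have [C3 C30 HC3] := kernel_pair_replace j a6 b6 c6 d6 ab cd.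
    have [C4 C40 HC4] := IH al.
    exists (`|w| * C3 + C4) => [|N i pN]; first by rewrite addr_ge0 ?mulr_ge0.
    have := HC4 N i pN; have := ler_wpM2l (normr_ge0 w) (HC3 N i pN).
    rewrite !big_cons /= -normrM mulrBr.
    move: (cm _ _ _ _) (fm _ _) (\sum_(_ <- _) _) (\sum_(_ <- _) _) (rt N ^+ _) => x y t z r X Y.
    have -> : w * x + z - ecoef * (w * kap a b c d * y + t) =
      (w * x - w * (ecoef * kap a b c d * y)) + (z - ecoef * t) by ring.
    by apply: (le_trans (ler_normD _ _)); rewrite [leRHS]mulrDl -[X in _ <= X + _]mulrA; exact: lerD.
  have [C C0 HC] := H; exists C => // N i pN; have := HC N i pN.
  congr (`|_ - _| <= _); rewrite /cmean.
  under eq_bigr do rewrite -qmeanZ ?uniq_coords//.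
  rewrite -qmean_sum ?uniq_coords//; apply: eq_qmean => s.
  by rewrite kernel4E mulr_sumr; apply: eq_bigr => t _; rewrite mulrCA.
have [C3 C30 HC3] := E1; have [C4 C40 HC4] := E2.
have [C5 C50 HC5] := cm_second_order hp hsmall hq01 hq j.
have M0 : 0 <= 2 * DM ^+ j by rewrite mulr_ge0 ?exprn_ge0.
exists (2 * C1 * C2 + C3 + C4 + 2 * DM ^+ j * C5) => [|N i pN].
  by rewrite !addr_ge0// mulr_ge0// mulr_ge0.
pose f (s : nat -> config N) := e i a b s * devi i 0 1 s ^+ j.
pose w (s : nat -> config N) := e i a b s * (spin R (s 0) i * spin R (s 1) i) * dev 0 1 s ^+ j.-1.
(* The power is split into its version without site i (f), the linear correction (w) and a remainder
   r of order j + 2. *)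
pose r (s : nat -> config N) := e i a b s * (dev 0 1 s ^+ j - devi i 0 1 s ^+ j
      - j%:R * (spin R (s 0) i * spin R (s 1) i / N%:R) * dev 0 1 s ^+ j.-1).
have -> : fm 8 (fun s => e i a b s * dev 0 1 s ^+ j) = fm 8 f + j%:R / N%:R * fm 8 w + fm 8 r.
  rewrite -fmZ -!fmD; apply: eq_qmean => s; rewrite /f /w /r.
  by move: (e i a b s) (dev 0 1 s ^+ j) (devi i 0 1 s ^+ j) (dev 0 1 s ^+ j.-1) => x1 x2 x3 x4; ring.
have Hr : `|fm 8 r| <= 2 * C1 * C2 * rt N ^+ j.+2.
  apply: HC2 => // [|s]; first by rewrite mulr_ge0.
  by rewrite /r normrM -[leRHS]mulrA; apply: ler_pM => //; exact: HC1.
have lf : local_at 4 f.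
  by move=> s s' H; rewrite /f (local_devi q i (n := 4) _ _ H)// /e !H.
have fA (s : nat -> config N) : `|f s| <= 2 * DM ^+ j * Delta s ^+ j.
  by rewrite /f normrM -[leRHS]mulrA; apply: ler_pM => //; exact: DJi.
have Hf := HC5 N i _ f pN M0 lf fA.
have c0 : cm i 0 8 f = 0.
  apply: (cm0_centered hq) => //.
  exact: (flip_invariant_comp (fun z => z ^+ j) (flip_invariant_devi q hp i 0 1 pN)).
rewrite c0 subr0 in Hf.
move: Hr Hf (HC3 N i pN) (HC4 N i pN); rewrite -/w /f !mulrDl.
move: (cm _ _ _ _) => x1; move: (fm _ r) => x2; move: (fm _ w) => x3.
move: (fm _ (fun s => e i a b s * _)) => x4; move: (fm _ _) => x5.
move: (\sum_(_ <- _) _) => x6.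
move: (j%:R / N%:R * x3) (j%:R / N%:R * kap a b 0 1 * x5) (ecoef * x6) => y1 y2 y3.
rewrite !ler_norml => /andP[? ?] /andP[? ?] /andP[? ?] /andP[? ?]; apply/andP; split; lra.
Qed.

End CavityEquation.

(** The system is triangular in u = x - 2y + z, v = y - z and z, with diagonal entries 1 - e la, 1 -
    e mu, 1 - e mu: u solves its own equation, v involves u, and z involves both. Since x = u + 2v +
    z, the variance has the shape A + 2B + C. *)
Lemma cavity_system_solution (R : realType) (e q r : R) :
  let la := 1 - 2 * q + r in let mu := 1 - 4 * q + 3 * r in
  let A := la / (1 - e * la) in
  let B := (q - r) * (1 + e * A) / (1 - e * mu) in
  let C := ((r - q ^+ 2) * (1 + e * A) + 2 * e * (2 * q + q ^+ 2 - 3 * r) * B) / (1 - e * mu) in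
  1 - e * la != 0 -> 1 - e * mu != 0 ->
  exists2 K : R, 0 <= K & forall x y z m E : R,
    `|x - ((1 - q ^+ 2) * m + e * ((1 - q ^+ 2) * x - 4 * (q - q ^+ 2) * y + 3 * (r - q ^+ 2) * z))| <= E ->
    `|y - ((q - q ^+ 2) * m + e * ((q - q ^+ 2) * x
        + ((1 - q ^+ 2) - 2 * (q - q ^+ 2) - 3 * (r - q ^+ 2)) * y
        + (6 * (r - q ^+ 2) - 3 * (q - q ^+ 2)) * z))| <= E ->
    `|z - ((r - q ^+ 2) * m + e * ((r - q ^+ 2) * x
        + (4 * (q - q ^+ 2) - 8 * (r - q ^+ 2)) * y
        + ((1 - q ^+ 2) - 8 * (q - q ^+ 2) + 10 * (r - q ^+ 2)) * z))| <= E ->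
    `|x - (A + 2 * B + C) * m| <= K * E.
Proof.
move=> la mu A B C n1 n2.
pose Ku := 4 * `|(1 - e * la)^-1|.
pose Kv := `|(1 - e * mu)^-1| * (`|(q - r) * e| * Ku + 2).
pose Kz := `|(1 - e * mu)^-1| * (`|(r - q ^+ 2) * e| * Ku + `|2 * e * (2 * q + q ^+ 2 - 3 * r)| * Kv + 1).
have Ku0 : 0 <= Ku by rewrite mulr_ge0.
have Kv0 : 0 <= Kv by rewrite mulr_ge0// addr_ge0// mulr_ge0.
have Kz0 : 0 <= Kz by rewrite mulr_ge0// !addr_ge0// mulr_ge0.
exists (Ku + 2 * Kv + Kz) => [|x y z m E].
  by rewrite !addr_ge0// mulr_ge0.
set d1 := x - _; set d2 := y - _; set d3 := z - _ => H1 H2 H3.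
have uE : (x - 2 * y + z) - A * m = (1 - e * la)^-1 * (d1 - 2 * d2 + d3).
  by rewrite /A /d1 /d2 /d3 /la; field; rewrite -/la.
have vE : (y - z) - B * m = (1 - e * mu)^-1 * ((q - r) * e * ((x - 2 * y + z) - A * m) + (d2 - d3)).
  rewrite /B; clear C B; clearbody A.
  by rewrite /d2 /d3 /mu; field; rewrite -/mu.
have zE : z - C * m = (1 - e * mu)^-1 * ((r - q ^+ 2) * e * ((x - 2 * y + z) - A * m)
    + 2 * e * (2 * q + q ^+ 2 - 3 * r) * ((y - z) - B * m) + d3).
  rewrite /C; clear C; clear vE uE; clearbody B; clearbody A.
  by rewrite /d3 /mu; field; rewrite -/mu.
have uB : `|(x - 2 * y + z) - A * m| <= Ku * E.
  rewrite uE normrM /Ku -[leRHS]mulrA [leRHS]mulrCA; apply: ler_wpM2l => //.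
  move: H1 H2 H3; rewrite !ler_norml => /andP[? ?] /andP[? ?] /andP[? ?]; apply/andP; split; lra.
have vB : `|(y - z) - B * m| <= Kv * E.
  rewrite vE normrM /Kv -[leRHS]mulrA; apply: ler_wpM2l => //.
  apply: (le_trans (ler_normD _ _)); rewrite [leRHS]mulrDl; apply: lerD.
    by rewrite normrM -[leRHS]mulrA; apply: ler_wpM2l.
  by move: H2 H3; rewrite !ler_norml => /andP[? ?] /andP[? ?]; apply/andP; split; lra.
have zB : `|z - C * m| <= Kz * E.
  rewrite zE normrM /Kz -[leRHS]mulrA; apply: ler_wpM2l => //.
  apply: (le_trans (ler_normD _ _)); rewrite [leRHS]mulrDl mul1r; apply: lerD => //.
  apply: (le_trans (ler_normD _ _)); rewrite [leRHS]mulrDl; apply: lerD.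
    by rewrite normrM -[leRHS]mulrA; apply: ler_wpM2l.
  by rewrite normrM -[leRHS]mulrA; apply: ler_wpM2l.
have -> : x - (A + 2 * B + C) * m =
  ((x - 2 * y + z) - A * m) + 2 * ((y - z) - B * m) + (z - C * m) by ring.
have -> : (Ku + 2 * Kv + Kz) * E = Ku * E + 2 * (Kv * E) + Kz * E by ring.
move: uB vB zB; move: (_ - A * m) (_ - B * m) (_ - C * m) (Ku * E) (Kv * E) (Kz * E) => a b c k1 k2 k3.
by rewrite !ler_norml => /andP[? ?] /andP[? ?] /andP[? ?]; apply/andP; split; lra.
Qed.

(** * Moment recursion and its Gaussian limit *)

Section LimitMoments.
Context {R : realType} (p : nat) (beta h q : R).
Hypothesis hp : (2 <= p)%N.
Hypothesis hsmall : 8 * p%:R ^+ 2 * beta ^+ 2 <= 1 / 2.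
Hypothesis hq01 : 0 <= q <= 1.
Hypothesis hq : q = tau p beta h q 2.

Local Notation fm n f := (fmean p beta h q n f).
Local Notation dev := (odev q).
Local Notation rt := (@rt R).
Local Notation r4 := (tau p beta h q 4).
Local Notation kap := (kap p beta h q).
Local Notation ecoef := (ecoef p beta q).

Let q0 : 0 <= q. Proof. by case/andP: hq01. Qed.
Let q1 : q <= 1. Proof. by case/andP: hq01. Qed.

Definition cross_moment N j a b : R :=
  fm 8 (fun s : nat -> config N => dev a b s * dev 0 1 s ^+ j).
Local Notation X N := (cross_moment N).
Local Notation mom N k := (fm 8 (fun s : nat -> config N => dev 0 1 s ^+ k)).

Lemma cross_moment_equation (j a b : nat) : (a < 4)%N -> (b < 4)%N -> a != b ->
  exists2 C : R, 0 <= C & forall N, (p <= N)%N ->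
    `|X N j a b - (j%:R / N%:R * kap a b 0 1 * mom N j.-1
       + ecoef * \sum_(t <- kernel4_terms) t.2 * kap a b t.1.1 t.1.2 * X N j t.1.1 t.1.2)|
    <= C * rt N ^+ j.+2.
Proof.
move=> a4 b4 ab; have [C C0 HC] := cavity_equation hp hsmall hq01 hq j a4 b4 ab.
exists C => // N pN; have N1 := @Nge1 R p hp N pN.
have N0 : N%:R != 0 :> R by rewrite gt_eqF// (lt_le_trans _ N1).
set Y := (_ * mom N j.-1 + _).
have -> : X N j a b = N%:R^-1 * \sum_(i < N)
    fm 8 (fun s : nat -> config N => (spin R (s a) i * spin R (s b) i - q) * dev 0 1 s ^+ j).
  rewrite -fm_sum -fmZ; apply: eq_qmean => s.
  by rewrite (dev_average q hp a b s pN) -mulrA mulr_suml.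
have -> : Y = N%:R^-1 * \sum_(i < N) Y by rewrite sumr_const card_ord -[Y *+ N]mulr_natl mulKf.
rewrite -mulrBr -sumrB normrM ger0_norm ?invr_ge0//.
rewrite ler_pdivrMl ?(lt_le_trans _ N1)//.
apply: (le_trans (ler_norm_sum _ _ _)).
apply: (@le_trans _ _ (\sum_(i < N) C * rt N ^+ j.+2)); last first.
  by rewrite sumr_const card_ord -[_ *+ N]mulr_natl.
by apply: ler_sum => i _; exact: HC.
Qed.

(** Exchanging replicas other than 0 and 1 leaves the power of the (0,1) deviation fixed. *)
Lemma cross_moment_swap N j k l c d : (1 < k < 8)%N -> (1 < l < 8)%N -> k != l ->
  X N j c d = X N j (swap k l c) (swap k l d).
Proof.
move=> /andP[k1 k8] /andP[l1 l8] kl; rewrite /cross_moment /fmean -(qmean_swap _ _ _ _ _ _ k8 l8 kl).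
apply: eq_qmean => s; rewrite /odev /= /swap.
by move: k l k1 l1 {k8 l8 kl} => [//|[//|k]] [//|[//|l]].
Qed.

Lemma cross_moment_swap01 N j c d : X N j c d = X N j (swap 0 1 c) (swap 0 1 d).
Proof.
pose f (s : nat -> config N) := dev c d s * dev 0 1 s ^+ j.
transitivity (fm 8 (fun s => f (s \o swap 0 1))).
  exact/esym/(@qmean_swap _ _ _ _ _ _ _ _ 8 0 1 f isT isT isT).
apply: eq_qmean => s; rewrite /f /odev /=; congr (_ * (_ - _) ^+ _); exact: overlapC.
Qed.

(** The bound is read off a system with one site, where [tau 4] is the mean at t = 0 of a product of
    four spins. *)
Lemma tau4_le1 : r4 <= 1.
Proof.
have inv : @flip_invariant R 1 ord0 (fun=> 1) by [].
have := @cmean0_spins R p beta h q 1 ord0 8 _ [:: 0; 1; 2; 3]%N inv isT isT.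
rewrite cm_cst mulr1 -[size _]/4%N => <-; rewrite -[leRHS](cm_cst p beta h q (@ord0 0) 0 8).
apply: cm_le => s; rewrite mulr1; apply: (le_trans (ler_norm _)).
by rewrite normr_prod !big_cons big_nil !spin_norm !mulr1.
Qed.

(** This and the next two are A^2, B^2 and C^2 with the factor ((p-1) q^(p-2))^2 removed. *)
Definition Alim : R := (1 - 2 * q + r4) / (1 - ecoef * (1 - 2 * q + r4)).
Definition Blim : R := (q - r4) * (1 + ecoef * Alim) / (1 - ecoef * (1 - 4 * q + 3 * r4)).
Definition Clim : R := ((r4 - q ^+ 2) * (1 + ecoef * Alim)
   + 2 * ecoef * (2 * q + q ^+ 2 - 3 * r4) * Blim) / (1 - ecoef * (1 - 4 * q + 3 * r4)).
Definition Vlim : R := Alim + 2 * Blim + Clim.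

Lemma limit_denominators :
  0 < 1 - ecoef * (1 - 2 * q + r4) /\ 0 < 1 - ecoef * (1 - 4 * q + 3 * r4).
Proof.
have /andP[e0 e1] := ecoef_bounds hsmall hq01; have r1 := tau4_le1.
have H y : y <= 4 -> 0 < 1 - ecoef * y.
  by move=> y4; have := ler_wpM2l e0 y4; lra.
by split; apply: H; have := q0; lra.
Qed.

(** The equations for the pairs (0,1), (0,2) and (2,3) form the system of [cavity_system_solution],
    with source (j/N) times the moment of order j - 1. *)
Lemma moment_recursion (j : nat) : exists2 C : R, 0 <= C & forall N, (p <= N)%N ->
  `|mom N j.+1 - Vlim * (j%:R * rt N ^+ 2 * mom N j.-1)| <= C * rt N ^+ j.+2.
Proof.
have [d1 d2] := limit_denominators.
have [K K0 HK] := @cavity_system_solution R ecoef q r4 (lt0r_neq0 d1) (lt0r_neq0 d2).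
have [C1 C10 H1] := @cross_moment_equation j 0 1 isT isT isT.
have [C2 C20 H2] := @cross_moment_equation j 0 2 isT isT isT.
have [C3 C30 H3] := @cross_moment_equation j 2 3 isT isT isT.
exists (K * (C1 + C2 + C3)) => [|N pN]; first by rewrite mulr_ge0// !addr_ge0.
have r0 : 0 <= rt N ^+ j.+2 by rewrite exprn_ge0// ltW// (rt_gt0 hp pN).
have X01 : mom N j.+1 = X N j 0 1 by apply: eq_qmean => s; rewrite exprS.
(* A pair other than (0,1) meets {0, 1} in one replica or in none; exchangeability leaves a single
   unknown for each kind. *)
have X03 : X N j 0 3 = X N j 0 2 := @cross_moment_swap N j 2 3 0 3 isT isT isT.
have X04 : X N j 0 4 = X N j 0 2 := @cross_moment_swap N j 2 4 0 4 isT isT isT.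
have X12 : X N j 1 2 = X N j 0 2 := cross_moment_swap01 N j 1 2.
have X13 : X N j 1 3 = X N j 0 3 := cross_moment_swap01 N j 1 3.
have X14 : X N j 1 4 = X N j 0 4 := cross_moment_swap01 N j 1 4.
have X24 : X N j 2 4 = X N j 2 3 := @cross_moment_swap N j 3 4 2 4 isT isT isT.
have X34 : X N j 3 4 = X N j 2 4 := @cross_moment_swap N j 2 3 3 4 isT isT isT.
have X45 : X N j 4 5 = X N j 3 4.
  apply: (etrans (@cross_moment_swap N j 3 5 4 5 isT isT isT)).
  exact: (@cross_moment_swap N j 3 4 4 3 isT isT isT).
have W1 : C1 <= C1 + C2 + C3 by rewrite -addrA lerDl addr_ge0.
have W2 : C2 <= C1 + C2 + C3 by rewrite addrAC lerDr addr_ge0.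
have W3 : C3 <= C1 + C2 + C3 by rewrite lerDr addr_ge0.
have Q := HK (mom N j.+1) (X N j 0 2) (X N j 2 3) (j%:R * rt N ^+ 2 * mom N j.-1) ((C1 + C2 + C3) * rt N ^+ j.+2).
rewrite -[leRHS]mulrA; apply: Q.
- apply: (le_trans _ (ler_wpM2r r0 W1)); have := H1 N pN.
  rewrite /kernel4_terms !big_cons big_nil /kap/= X45 X34 X24 X14 X13 X12 X04 X03 -X01 rt_sqr.
  congr (`|_ - _| <= _).
  by move: (mom N j.+1) (mom N j.-1) (X N j 0 2) (X N j 2 3) ecoef r4 => *; ring.
- apply: (le_trans _ (ler_wpM2r r0 W2)); have := H2 N pN.
  rewrite /kernel4_terms !big_cons big_nil /kap/= X45 X34 X24 X14 X13 X12 X04 X03 -X01 rt_sqr.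
  congr (`|_ - _| <= _).
  by move: (mom N j.+1) (mom N j.-1) (X N j 0 2) (X N j 2 3) ecoef r4 => *; ring.
- apply: (le_trans _ (ler_wpM2r r0 W3)); have := H3 N pN.
  rewrite /kernel4_terms !big_cons big_nil /kap/= X45 X34 X24 X14 X13 X12 X04 X03 -X01 rt_sqr.
  congr (`|_ - _| <= _).
  by move: (mom N j.+1) (mom N j.-1) (X N j 0 2) (X N j 2 3) ecoef r4 => *; ring.
Qed.

(** Moments and Gaussian moments obey the same two-step recursion, up to the scaling Vlim / N. Order
    0 is exact, and order 1 is the recursion with vanishing source. *)
Lemma limit_moment (k : nat) : exists2 C : R, 0 <= C & forall N, (p <= N)%N ->
  `|mom N k - gaussE (fun y : R => y ^+ k) * Vlim ^+ k./2 * rt N ^+ k| <= C * rt N ^+ k.+1.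
Proof.
have cst1 N : mom N 0 = 1 by rewrite -[RHS](fm_cst p beta h q N 8).
elim/ltn_ind: k => -[_|[_|k IH]].
- exists 0 => // N pN; rewrite cst1 (_ : gaussE _ = 1).
    by rewrite mul0r !expr0 !mulr1 subrr normr0.
  by rewrite -[RHS](@gaussE_cst R).
- have [C C0 HC] := moment_recursion 0; exists C => // N pN.
  have := HC N pN; rewrite mul0r mul0r mulr0 subr0.
  by rewrite gaussE_odd// !mul0r subr0.
have [C C0 HC] := IH k (ltnW (ltnSn _)).
have [C1 C10 HC1] := moment_recursion k.+1.
exists (C1 + `|Vlim * k.+1%:R| * C) => [|N pN]; first by rewrite addr_ge0 ?mulr_ge0.
rewrite gaussE_exprSS.
have -> : mom N k.+2 - k.+1%:R * gaussE (fun y : R => y ^+ k) * Vlim ^+ k.+2./2 * rt N ^+ k.+2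
  = (mom N k.+2 - Vlim * (k.+1%:R * rt N ^+ 2 * mom N k)) +
    Vlim * k.+1%:R * (rt N ^+ 2 * (mom N k - gaussE (fun y : R => y ^+ k) * Vlim ^+ k./2 * rt N ^+ k)).
  rewrite /= [Vlim ^+ _.+1]exprS -[k.+2]addn2 exprD.
  by move: (Vlim ^+ k./2) (rt N ^+ 2) (rt N ^+ k) (gaussE _) => x1 x2 x3 x4; ring.
apply: (le_trans (ler_normD _ _)); rewrite [leRHS]mulrDl; apply: lerD; first exact: HC1.
rewrite normrM -[leRHS]mulrA; apply: ler_wpM2l => //.
rewrite normrM ger0_norm ?sqr_ge0//.
have -> : C * rt N ^+ k.+3 = rt N ^+ 2 * (C * rt N ^+ k.+1) by rewrite -[k.+3]/(2 + k.+1)%N exprD mulrCA.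
by apply: ler_wpM2l; [exact: sqr_ge0|exact: HC].
Qed.

(** Vlim is the limit of N times a second moment. The sign is needed to take real powers of the
    variance in the statement. *)
Lemma Vlim_ge0 : 0 <= Vlim.
Proof.
have [C C0 HC] := limit_moment 2.
rewrite leNgt; apply/negP => V0.
(* N is large enough for the error C N^(-3/2) to be smaller than - Vlim / N, and at least p. *)
have [N HN] : exists N : nat, (C / - Vlim) ^+ 2 + p%:R < N%:R.
  by exists (Num.truncn ((C / - Vlim) ^+ 2 + p%:R)).+1; rewrite truncnS_gt.
have pN : (p <= N)%N.
  by rewrite -(ler_nat R) ltW// (le_lt_trans _ HN)// lerDr sqr_ge0.
have r0 := @rt_gt0 R p hp N pN.
have m2 : 0 <= mom N 2 by apply: fm_ge0 => s; exact: sqr_ge0.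
have g2 : gaussE (fun y : R => y ^+ 2) = 1 by rewrite gaussE_sqr.
have := HC N pN; rewrite g2 mul1r expr1 ler_norml => /andP[_ H].
have {}H : - Vlim <= C * rt N.
  have r2 : 0 < rt N ^+ 2 by rewrite exprn_gt0.
  rewrite -(ler_pM2r r2) -mulrA -exprS; move: H m2; rewrite mulNr; lra.
have nV0 : 0 < - Vlim by rewrite oppr_gt0.
have c0 : 0 <= C / - Vlim by rewrite divr_ge0// ltW.
have crt : C / - Vlim * rt N < 1.
  have ltN : (C / - Vlim) ^+ 2 < N%:R by apply: le_lt_trans HN; rewrite lerDl.
  have N0 : 0 < N%:R :> R by apply: le_lt_trans ltN; exact: sqr_ge0.
  rewrite -(@expr_lt1 _ 2)//; last by rewrite mulr_ge0// ltW.
  by rewrite exprMn rt_sqr ltr_pdivrMr// mul1r.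
suff : C * rt N < - Vlim by move/(le_lt_trans H); rewrite ltxx.
have -> : C * rt N = - Vlim * (C / - Vlim * rt N).
  by field; rewrite -oppr_eq0 gt_eqF.
by rewrite -[ltRHS]mulr1 ltr_pM2l.
Qed.

End LimitMoments.

(** * From the abstract disorder to iterated integrals *)

Section BoundedMean.
Context {d : measure_display} {T : measurableType d} {R : realType} (P : probability T R).
Implicit Types (f g : T -> R).

Lemma bounded_integrable f (B : R) : measurable_fun [set: T] f -> (forall w, `|f w| <= B) ->
  P.-integrable [set: T] (EFin \o f).
Proof.
move=> mf fB; apply: measurable_bounded_integrable => //.
  by apply: le_lt_trans (ltry 1); exact: probability_le1.
exists B; split; first exact: num_real.
by move=> M BM w _; exact: le_trans (fB w) (ltW BM).
Qed.

Lemma cvg_bounded_mean (F : (T -> R)^nat) f (B : R) : (forall n, measurable_fun [set: T] (F n)) ->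
  (forall n w, `|F n w| <= B) -> (forall w, F n w @[n --> \oo] --> f w) ->
  (\int[P]_w F n w)%R @[n --> \oo] --> (\int[P]_w f w)%R.
Proof.
move=> mF FB Ff.
have fB w : `|f w| <= B.
  have /cvg_lim <- // : (`|F n w|) @[n --> \oo] --> `|f w| by apply: cvg_norm; exact: Ff.
  apply: limr_le; last by apply: nearW => n; exact: FB.
  by apply/cvg_ex; exists `|f w|; apply: cvg_norm; exact: Ff.
have mf : measurable_fun [set: T] f by apply: (measurable_fun_cvg mF) => w _; exact: Ff.
have If := bounded_integrable mf fB.
have H : (\int[P]_w (F n w)%:E)%E @[n --> \oo] --> (\int[P]_w (f w)%:E)%E.
  apply: (@dominated_cvg _ _ _ _ _ _ _ _ (cst B%:E)) => //.
  - by move=> n; apply/measurable_EFinP.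
  - by move=> w _; apply: cvg_EFin; [apply: nearW|exact: Ff].
  - exact: finite_measure_integrable_cst.
  - by move=> n w _; rewrite abse_EFin lee_fin.
have E : (\int[P]_w (f w)%:E)%E = ((\int[P]_w f w)%R)%:E.
  by rewrite /Rintegral fineK//; exact: integrable_fin_num.
by rewrite E in H; exact: fine_cvg H.
Qed.

Lemma mean_sum (K : Type) (r : seq K) (F : K -> T -> R) :
  (forall k, P.-integrable [set: T] (EFin \o F k)) ->
  (\int[P]_w \sum_(k <- r) F k w)%R = \sum_(k <- r) (\int[P]_w F k w)%R.
Proof.
move=> iF; have iS s : P.-integrable [set: T] (EFin \o (fun w => \sum_(k <- s) F k w)).
  elim: s => [|k s IHs].
    by under eq_fun do rewrite big_nil; exact: finite_measure_integrable_cst.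
  by under eq_fun do rewrite big_cons; exact: (integrableD measurableT (iF k) IHs).
elim: r => [|k r IH].
  under eq_Rintegral do rewrite big_nil.
  by rewrite Rintegral_cst// mul0r big_nil.
under eq_Rintegral do rewrite big_cons.
by rewrite RintegralD// IH big_cons.
Qed.

End BoundedMean.

Import HBSimple.

Lemma sfun_expand (R : realType) (D : {sfun R >-> R}) (H : R -> R) (y : R) :
  H (D y) = \sum_(v <- finmap.enum_fset (fset_set (range D))) \1_(D @^-1` [set v]) y * H v.
Proof.
have Dy : D y \in finmap.enum_fset (fset_set (range D)).
  have : D y \in range D by apply/mem_set; exists y.
  by rewrite -in_fset_set//; exact: fimfunP.
rewrite (bigD1_seq (D y) Dy (finmap.fset_uniq _))/= big1 ?addr0; last first.
  move=> v vD; rewrite indicE memNset ?mul0r//= => E; move: vD.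
  by rewrite E eqxx.
by rewrite indicE mem_set ?mul1r.
Qed.

Lemma smooth_family_continuous (R : realType) (I : eqType) (J : Type) (d : I -> J -> J) (B : J -> R)
  (D : pred I) F i j x : smooth_family d B D F -> D i -> continuous (fun y : R => F j (upd x i y)).
Proof.
move=> sF Di; have [gb gt] := smooth_family_slice j x sF Di.
apply: (is_derive_continuous (df := fun y => F (d i j) (upd x i y))) => z.
apply: (@is_derive_taylor _ _ _ _ (B (d i (d i j))) 1) => // h _.
exact: (gt 0%N).
Qed.

Section Independence.
Context {R : realType} {dT : measure_display} {T : measurableType dT} (P : probability T R).
Context {I : finType} (X : I -> {RV P >-> R}).
Hypothesis iidX : iid_standard_gaussian X.
Context {J : Type} (d : I -> J -> J) (B : J -> R) (F : J -> (I -> R) -> R).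
Hypothesis sF : smooth_family d B predT F.
Hypothesis mF : forall (d' : measure_display) (T' : measurableType d') j (Y : I -> T' -> R),
  (forall k, measurable_fun [set: T'] (Y k)) ->
  measurable_fun [set: T'] (fun w => F j (fun k => Y k w)).

Let Xpre (k : I) (C : set R) : measurable C -> measurable (X k @^-1` C).
Proof. by move=> mC; rewrite -[_ @^-1` _]setTI; exact: measurable_funP. Qed.

Definition mix (l : seq I) (x : I -> R) (w : T) : I -> R := fun k => if k \in l then X k w else x k.

Lemma mix_upd l x i y w : i \notin l -> mix l (upd x i y) w = upd (mix l x w) i y.
Proof.
move=> il; apply/funext => k; rewrite /mix /upd.
by have [->|] := eqVneq k i; rewrite ?(negbTE il).
Qed.

Lemma mix_cons l x i w : i \notin l -> mix (i :: l) x w = upd (mix l x w) i (X i w).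
Proof.
move=> il; apply/funext => k; rewrite /mix /upd inE.
by have [->|] := eqVneq k i.
Qed.

(** An event on the coordinates not yet integrated. Carrying it through the induction allows
    independence, an assumption on events, to be used once at the end. *)
Definition outside (l : seq I) (C : I -> set R) : set T :=
  \bigcap_(k in [set` [set k | k \notin l]%SET]) X k @^-1` C k.

Lemma outside_cons l i (C : I -> set R) (A : set R) : i \notin l ->
  outside l (upd C i A) = outside (i :: l) C `&` X i @^-1` A.
Proof.
move=> il; apply/seteqP; split=> [w H|w [H1 H2] k].
  split=> [k|]; last by have := H i; rewrite /= upd_same; apply; rewrite inE.
  rewrite /= !inE negb_or => /andP[ki kl]; have := H k.
  by rewrite /= upd_other//; apply; rewrite inE.
rewrite /= inE => kl; have [->|ki] := eqVneq k i; first by rewrite upd_same.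
by rewrite upd_other//; apply: H1; rewrite /= !inE negb_or ki.
Qed.

Lemma measurable_outside l C : (forall k, measurable (C k)) -> measurable (outside l C).
Proof.
move=> mC; apply: fin_bigcap_measurable => [|k _]; first exact: finite_finset.
exact: Xpre.
Qed.

Lemma measurable_mix l x j : measurable_fun [set: T] (fun w => F j (mix l x w)).
Proof.
apply: (@mF _ _ j (fun k w => mix l x w k)) => k; rewrite /mix.
by case: (k \in l) => //; exact: measurable_cst.
Qed.

Lemma gaussian_law i (A : set R) : measurable A ->
  fine (P (X i @^-1` A)) = gaussE (\1_A : R -> R).
Proof.
move=> mA; rewrite /gaussE expectation_indic//.
by have [_ H] := iidX; congr fine; exact: H.
Qed.

(** Fubini for independent variables, by induction on l. When X i is replaced by a simple function
    of it, its level sets become new constraints in [outside] and the case of the shorter list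
    applies; bounded convergence removes the replacement. *)
Lemma independent_gmean l : uniq l -> forall j x C, (forall k, measurable (C k)) ->
  (\int[P]_w (\1_(outside l C) w * F j (mix l x w)))%R =
  \prod_(k | k \notin l) fine (P (X k @^-1` C k)) * gmean l (fun=> 1) (F j) x.
Proof.
elim: l => [_ j x C mC|i l IH /= /andP[il ul] j x C mC].
  have mo := measurable_outside [::] mC.
  have -> : (fun w => \1_(outside [::] C) w * F j (mix [::] x w)) =
      (fun w => F j x * \1_(outside [::] C) w).
    by apply/funext => w; rewrite mulrC.
  rewrite RintegralZl//; last first.
    apply: (@bounded_integrable _ _ _ _ _ 1) => [|w]; first exact: measurable_indic.
    by rewrite indicE; case: (_ \in _); rewrite ?normr1 ?normr0.
  rewrite mulrC /=; congr (_ * _); rewrite /Rintegral integral_indic// setIT.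
  have [indep _] := iidX.
  transitivity (fine (\prod_(k in [set k : I | k \notin [::]]%SET) P (X k @^-1` C k))%E).
    by congr fine; exact: indep.
  rewrite (eq_bigr (fun k => (fine (P (X k @^-1` C k)))%:E)) => [|k _]; last first.
    by rewrite fineK//; apply: fin_num_measure; exact: Xpre.
  by rewrite prodEFin /=; apply: eq_bigl => k; rewrite inE.
have sl := smooth_family_gmean (fun=> 1) ul sF.
pose pr := \prod_(k | k \notin i :: l) fine (P (X k @^-1` C k)).
(* The identity for D (X i): each value v contributes the case of l with C i set to the preimage of
   v, and the law of X i reassembles a Gaussian integral. *)
have step (D : {sfun R >-> R}) :
  (\int[P]_w (\1_(outside (i :: l) C) w * F j (mix l (upd x i (D (X i w))) w)))%R =
  pr * gaussE (fun y => gmean l (fun=> 1) (F j) (upd x i (D y))).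
  pose V := finmap.enum_fset (fset_set (range D)).
  have mD v : measurable (D @^-1` [set v]) by exact: measurable_sfunP.
  have mC' v k : measurable (upd C i (D @^-1` [set v]) k).
    by rewrite /upd; case: (k == i).
  have i1 v : gint (\1_(D @^-1` [set v]) : R -> R).
    apply: (@bounded_integrable _ _ _ _ _ 1) => [|w].
      by apply: measurable_indic; exact: mD.
    by rewrite indicE; case: (_ \in _); rewrite ?normr1 ?normr0.
  have -> : (fun w => \1_(outside (i :: l) C) w * F j (mix l (upd x i (D (X i w))) w)) =
    (fun w => \sum_(v <- V) \1_(outside l (upd C i (D @^-1` [set v]))) w * F j (mix l (upd x i v) w)).
    apply/funext => w; rewrite (sfun_expand D (fun v => F j (mix l (upd x i v) w))) mulr_sumr.
    apply: eq_bigr => v _; rewrite mulrA; congr (_ * _).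
    by rewrite outside_cons// indicI.
  rewrite mean_sum; last first.
    move=> v; apply: (@bounded_integrable _ _ _ _ _ (B j)) => [|w].
      apply: measurable_funM; last exact: measurable_mix.
      by apply: measurable_indic; exact: measurable_outside.
    rewrite normrM indicE; have [FB _] := sF.
    case: (_ \in _); first by rewrite normr1 mul1r; exact: FB.
    by rewrite normr0 mul0r; exact: le_trans (normr_ge0 _) (FB j (mix l x w)).
  have -> : (fun y => gmean l (fun=> 1) (F j) (upd x i (D y))) =
    (fun y => \sum_(v <- V) \1_(D @^-1` [set v]) y * gmean l (fun=> 1) (F j) (upd x i v)).
    by apply/funext => y; rewrite (sfun_expand D (fun v => gmean l (fun=> 1) (F j) (upd x i v))).
  rewrite gaussE_sum; last first.
    move=> v; under eq_fun do rewrite mulrC; exact: gintZ.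
  rewrite mulr_sumr; apply: eq_bigr => v _.
  under [in RHS]eq_fun do rewrite mulrC.
  rewrite gaussEZ// IH// (bigD1 i)//= upd_same gaussian_law//.
  rewrite (_ : \prod_(k | _) _ = pr); last first.
    apply: eq_big => k; first by rewrite inE negb_or andbC.
    by move=> /andP[_ ki]; rewrite upd_other.
  by move: (gaussE _) pr (gmean _ _ _ _) => u1 u2 u3; ring.
have mid : measurable_fun [set: R] (EFin \o @id R) by apply/measurable_EFinP.
have [g Hg] := approximation_sfun measurableT mid.
have gc (y : R) : g n y @[n --> \oo] --> y.
  exact: fine_cvg (Hg y Logic.I).
have FB := sF.1.
have b1 w z : `|\1_(outside (i :: l) C) w * F j z| <= B j.
  rewrite normrM indicE.
  case: (_ \in _); first by rewrite normr1 mul1r; exact: FB.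
  by rewrite normr0 mul0r; exact: le_trans (normr_ge0 _) (FB j z).
(* Simple functions g n converge to the identity; F is bounded and continuous in coordinate i, so
   both sides of [step] converge. *)
have L1 : (\int[P]_w (\1_(outside (i :: l) C) w * F j (mix l (upd x i (g n (X i w))) w)))%R @[n --> \oo] -->
  (\int[P]_w (\1_(outside (i :: l) C) w * F j (mix (i :: l) x w)))%R.
  apply: (cvg_bounded_mean (B := B j)) => [n|n w|w]; last 1 first.
  - apply: cvgM; first exact: cvg_cst.
    rewrite mix_cons//; under eq_fun do rewrite mix_upd//.
    have H := @smooth_family_continuous _ _ _ _ _ _ _ i j (mix l x w) sF isT (X i w).
    exact: (cvg_comp _ _ (gc (X i w)) H).
  - apply: measurable_funM; first by apply: measurable_indic; exact: measurable_outside.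
    apply: (@mF _ _ j (fun k w => mix l (upd x i (g n (X i w))) w k)) => k; rewrite /mix /upd.
    case: (k \in l); first exact: measurable_funP.
    case: (k == i); last exact: measurable_cst.
    by apply: measurableT_comp; exact: measurable_funP.
  - exact: b1.
have L2 : gaussE (fun y => gmean l (fun=> 1) (F j) (upd x i (g n y))) @[n --> \oo] -->
  gaussE (fun y => gmean l (fun=> 1) (F j) (upd x i y)).
  under eq_fun do rewrite gaussEE; rewrite gaussEE.
  apply: (cvg_bounded_mean (B := B j)) => [n|n w|y].
  - apply: (@measurableT_comp _ _ _ _ _ _ (fun y : R => gmean l (fun=> 1) (F j) (upd x i y))).
      apply: continuous_measurable_fun.
      exact: (@smooth_family_continuous _ _ _ _ _ _ _ i j x sl il).
    exact: (@measurable_funP _ _ _ _ _ (g n)).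
  - exact: sl.1.
  - have H := @smooth_family_continuous _ _ _ _ _ _ _ i j x sl il y.
    exact: (cvg_comp _ _ (gc y) H).
have L3 : (\int[P]_w (\1_(outside (i :: l) C) w * F j (mix l (upd x i (g n (X i w))) w)))%R @[n --> \oo] -->
  pr * gaussE (fun y => gmean l (fun=> 1) (F j) (upd x i y)).
  rewrite (_ : (fun n => _) = fun n => pr * gaussE (fun y => gmean l (fun=> 1) (F j) (upd x i (g n y)))).
    by apply: cvgM; [exact: cvg_cst|exact: L2].
  by apply/funext => n; exact: step.
rewrite (cvg_unique _ L1 L3)//; congr (_ * gaussE _); apply/funext => y.
by rewrite sqrtr1 mul1r.
Qed.

Lemma expectation_gmean j :
  fine 'E_P[fun w => F j (fun k => X k w)]%E = gmean (index_enum I) (fun=> 1) (F j) (fun=> 0).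
Proof.
rewrite unlock.
have := independent_gmean (index_enum_uniq I) j (fun=> 0) (fun _ => measurableT).
rewrite big_pred0 ?mul1r => [<-|k]; last by rewrite mem_index_enum.
congr fine; apply: eq_integral => w _; congr EFin.
rewrite indicE mem_set ?mul1r; last by move=> k _.
by congr (F j _); apply/funext => k; rewrite /mix mem_index_enum.
Qed.

End Independence.

(** * Identification of [nu] with the quenched mean at t = 1 *)

Section GibbsTransfer.
Context {R : realType}.

Lemma measurable_avg (d : measure_display) (T : measurableType d) (S : finType) (s0 : S)
  (w : T -> S -> R) n f : (forall c, measurable_fun [set: T] (w^~ c)) ->
  measurable_fun [set: T] (fun x => avg s0 (w x) n f).
Proof.
move=> mw; elim: n f => [|n IH] f /=; first exact: measurable_cst.
apply: measurable_sum => c; apply: measurable_funM; first exact: mw.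
exact: IH.
Qed.

Lemma measurable_gfam (d : measure_display) (T : measurableType d) (S I : finType) (s0 : S)
  (a : I -> S -> R) (b : S -> R) j (Y : I -> T -> R) : (forall k, measurable_fun [set: T] (Y k)) ->
  measurable_fun [set: T] (fun w => gfam s0 a b j (fun k => Y k w)).
Proof.
move=> mY; apply: measurable_avg => c.
have mE e : measurable_fun [set: T] (fun w => expR (energy a b (fun k => Y k w) e)).
  apply: measurableT_comp => //; apply: measurable_funD; last exact: measurable_cst.
  by apply: measurable_sum => k; apply: measurable_funM => //; exact: measurable_cst.
(* The inverse of the positive partition function is written exp(-ln Z), a composition of measurable
   maps. *)
have -> : (fun w => gweight a b (fun k => Y k w) c) = (fun w => expR (energy a b (fun k => Y k w) c) *
   expR (- ln (\sum_e expR (energy a b (fun k => Y k w) e)))).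
  apply/funext => w; rewrite expRN lnK// posrE; exact: (gibbs_Z_gt0 c).
apply: measurable_funM => //; apply: measurableT_comp => //; apply: measurableT_comp => //.
by apply: measurableT_comp => //; exact: measurable_sum.
Qed.

Lemma gmean_inl (K I : eqType) (l : seq K) (F : (K + I -> R) -> R) (v : K + I -> R) x :
  gmean [seq inl k | k <- l] v F x =
  gmean l (v \o inl) (fun y => F (fun k => match k with inl m => y m | inr _ => x k end)) (x \o inl).
Proof.
elim: l x => [|i l IH] x /=; first by congr F; apply/funext => -[].
congr gaussE; apply/funext => y; rewrite IH; congr gmean.
by apply/funext => z; congr F; apply/funext => -[].
Qed.

Lemma gmean_zero_var (I : eqType) (l m : seq I) (v : I -> R) (F : (I -> R) -> R) x :
  {in l, v =1 fun=> 0} -> {in l, x =1 fun=> 0} -> gmean (l ++ m) v F x = gmean m v F x.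
Proof.
elim: l => //= i l IH v0 x0; rewrite v0 ?mem_head//.
have -> : (fun y : R => gmean (l ++ m) v F (upd x i (Num.sqrt 0 * y))) = (fun=> gmean m v F x).
  apply/funext => y; rewrite sqrtr0 mul0r -(x0 i (mem_head _ _)) upd_id; apply: IH.
    by move=> k kl; apply: v0; rewrite inE kl orbT.
  by move=> k kl; apply: x0; rewrite inE kl orbT.
exact: gaussE_cst.
Qed.

Lemma sum_pair_ffun (S : finType) (F : {ffun 'I_2 -> S} -> R) :
  \sum_s F s = \sum_a \sum_b F [ffun i : 'I_2 => if i == ord0 then a else b].
Proof.
rewrite pair_big/= (reindex (fun ab : S * S => [ffun i : 'I_2 => if i == ord0 then ab.1 else ab.2]))//=.
exists (fun s : {ffun 'I_2 -> S} => (s ord0, s ord_max)) => [[a b] _|s _]; first by rewrite !ffunE.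
apply/ffunP => i; rewrite ffunE; have [->//|i0] := eqVneq i ord0.
by congr (s _); apply: val_inj; case: i i0 => -[//|[|]].
Qed.

Variables (p : nat) (beta h q : R) (N : nat).
Local Notation coup := (fun A : increasing_tuple N p => @coupling R p beta q N (inl A)).
Local Notation s0 := ([ffun=> false] : config N).

Lemma negH_energy x c : negH beta h x c = energy coup (external h (N:=N)) x c.
Proof.
rewrite /negH /energy /external mulr_sumr; congr (_ + _).
by apply: eq_bigr => A _; rewrite /coupling; ring.
Qed.

Lemma gibbs_avg x (G : config N -> config N -> R) :
  gibbs beta h x (fun s : {ffun 'I_2 -> config N} => G (s ord0) (s ord_max)) =
  gfam s0 coup (external h (N:=N)) (2, fun s => G (s 0) (s 1))%N x.
Proof.
have ZE : partition_function beta h x = \sum_c expR (energy coup (external h (N:=N)) x c).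
  by apply: eq_bigr => c _; rewrite negH_energy.
rewrite /gibbs sum_pair_ffun /gfam/= exchange_big/= mulr_sumr.
apply: eq_bigr => b _; rewrite !mulr_sumr; apply: eq_bigr => a _.
rewrite !ffunE /= big_ord_recl big_ord_recl big_ord0 addr0 !ffunE/= !negH_energy.
rewrite [expR (_ + _)]expRD.
rewrite upd_same upd_other// upd_same /gweight ZE expr2 invfM.
by move: (\sum_c _)^-1 => z; ring.
Qed.

(** [expectation_gmean] gives an iterated mean over the couplings; the auxiliary fields of [fmean]
    have variance 0 and drop out. *)
Lemma nu_fmean (d : measure_display) (T : measurableType d) (P : probability T R)
  (g : increasing_tuple N p -> {RV P >-> R}) (G : config N -> config N -> R) :
  iid_standard_gaussian g ->
  nu beta h g (fun s : {ffun 'I_2 -> config N} => G (s ord0) (s ord_max)) =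
  fmean p beta h q 2 (fun s : nat -> config N => G (s 0%N) (s 1%N)).
Proof.
move=> ig; rewrite /nu; under eq_fun do rewrite gibbs_avg.
have mF := fun d' (T' : measurableType d') => @measurable_gfam d' T' _ _ s0 coup (external h (N:=N)).
rewrite (expectation_gmean ig (gfam_smooth s0 coup (external h (N:=N))) mF).
rewrite /fmean /qmean /coords gmean_zero_var; first last.
- by [].
- by move=> _ /mapP[i _ ->].
rewrite gmean_inl; congr gmean; apply/funext => y; rewrite /gfam /=.
have eE c : energy coup (external h (N:=N)) y c =
    energy (coupling beta q (N:=N)) (external h (N:=N))
      (fun k => match k with inl A => y A | inr _ => 0 end) c.
  rewrite /energy big_sumType/= [X in _ = _ + X + _]big1 ?addr0// => i _.
  by rewrite mul0r.
have -> : gweight coup (external h (N:=N)) y = gweight (coupling beta q (N:=N)) (external h (N:=N))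
    (fun k => match k with inl A => y A | inr _ => 0 end).
  apply/funext => c; rewrite /gweight eE; congr (_ / _).
  by apply: eq_bigr => e _; rewrite eE.
by [].
Qed.

End GibbsTransfer.

(** * The constants, and the conclusion *)

Section LimitConstants.
Context {R : realType} (p : nat) (beta h q : R).
Hypothesis hp : (2 <= p)%N.
Hypothesis hsmall : 8 * p%:R ^+ 2 * beta ^+ 2 <= 1 / 2.
Hypothesis hq01 : 0 <= q <= 1.
Hypothesis hq : q = tau p beta h q 2.

Lemma constants_Vlim :
  Asq p beta h q + 2 * Bsq p beta h q + Csq p beta h q =
  ((p%:R - 1) * q ^+ (p - 2)) ^+ 2 * Vlim p beta h q.
Proof.
have [d1 d2] := limit_denominators h hsmall hq01.
have pE : p.-1%:R = p%:R - 1 :> R by rewrite -[in RHS](ltn_predK hp) -natr1 addrK.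
have eE : ecoef p beta q = beta ^+ 2 * (p%:R / 2) * (p%:R - 1) * q ^+ (p - 2).
  by rewrite /ecoef /kap0 pE subn2.
have n1 := lt0r_neq0 d1; have n2 := lt0r_neq0 d2.
rewrite /Vlim /Clim /Blim /Alim /Csq /Bsq /Asq /q4 -/(tau p beta h q 4).
rewrite mulnC exprM eE in n1 n2 *.
move: (tau p beta h q 4) (q ^+ (p - 2)) (p%:R : R) n1 n2 => r Q P n1 n2.
field; apply/andP; split.
  by rewrite (_ : _ - _ = 2 * (1 - beta ^+ 2 * (P / 2) * (P - 1) * Q * (1 - 4 * q + 3 * r))) ?mulf_neq0//; field.
by rewrite (_ : _ - _ = 2 * (1 - beta ^+ 2 * (P / 2) * (P - 1) * Q * (1 - 2 * q + r))) ?mulf_neq0//; field.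
Qed.

End LimitConstants.

Lemma powR_half (R : realType) (x : R) (k : nat) : 0 <= x -> x `^ (k%:R / 2) = Num.sqrt x ^+ k.
Proof.
by move=> x0; rewrite mulrC powRrM powR12_sqrt// powR_mulrn// sqrtr_ge0.
Qed.

Theorem corollary7p6 (R : realType) (p : nat) (h beta betap q : R)
  (hp : (2 <= p)%N) (hh : 0 < h)
  (hbetap : 0 < betap)
  (hbetapE : 8 * p%:R ^+ 2 * betap ^+ 2 * expR (16 * betap ^+ 2 * p%:R) = 1 / 2)
  (hbeta : 0 < beta < betap)
  (hq : q_equation p beta h q) (k : nat) :
  exists L : R,
    forall (N : nat), (p <= N)%N ->
    forall (d : measure_display) (T : measurableType d) (P : probability T R)
           (g : increasing_tuple N p -> {RV P >-> R}),
      iid_standard_gaussian g ->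
      `| nu beta h g (fun s : {ffun 'I_2 -> config N} =>
                        (overlap R (s ord0) (s ord_max) - q) ^+ k)
         - 1 / N%:R `^ (k%:R / 2) * gaussE (fun y : R => y ^+ k)
           * ((Asq p beta h q + 2 * Bsq p beta h q + Csq p beta h q)
                `^ (k%:R / 2)
              / ((p%:R - 1) * q ^+ (p - 2)) ^+ k) |
      <= L / N%:R `^ ((k%:R + 1) / 2).
Proof.
have [q01 qE] := hq; have /andP[q0 q1] := q01; have /andP[b0 bb] := hbeta.
(* The exponential factor in the equation for beta_p is at least 1. *)
have hsmall : 8 * p%:R ^+ 2 * beta ^+ 2 <= 1 / 2.
  rewrite -hbetapE.
  have b2 : beta ^+ 2 <= betap ^+ 2 by rewrite lerXn2r ?nnegrE ?ltW.
  have c0 : 0 <= 8 * p%:R ^+ 2 :> R by apply: mulr_ge0 => //; exact: sqr_ge0.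
  apply: (le_trans (ler_wpM2l c0 b2)); apply: ler_peMr.
    by apply: mulr_ge0 => //; exact: sqr_ge0.
  by rewrite -expR0 ler_expR; apply: mulr_ge0 => //; apply: mulr_ge0 => //; exact: sqr_ge0.
have p1 : 1 < p%:R :> R by rewrite ltr1n.
(* For q = 0 the field has variance 0 and the equation reads 0 = tanh^2 h, against h > 0. Positivity
   is needed to divide by the power of q^(p-2). *)
have q_gt0 : 0 < q.
  rewrite lt_neqAle q0 andbT eq_sym; apply/eqP => qz; move: qE.
  rewrite /tanh_moment qz powR0 ?mulr0; last by rewrite gt_eqF// divr_gt0// subr_gt0.
  under eq_fun do rewrite mul0r add0r.
  rewrite gaussE_cst => /eqP; rewrite eq_sym sqrf_eq0 /tanh mulf_eq0 invr_eq0.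
  rewrite subr_eq0 gt_eqF ?gt_eqF ?addr_gt0 ?expR_gt0//.
  by rewrite ltr_expR; lra.
have [C C0 HC] := limit_moment hp hsmall q01 qE k.
have V0 := Vlim_ge0 hp hsmall q01 qE.
exists C => N pN d T P g ig.
rewrite (nu_fmean beta h q (fun c e => (overlap R c e - q) ^+ k) ig).
have -> : fmean p beta h q 2 (fun s : nat -> config N => (overlap R (s 0%N) (s 1%N) - q) ^+ k) =
    fmean p beta h q 8 (fun s : nat -> config N => odev q 0 1 s ^+ k).
  symmetry; apply: qmean_local => // s s' H.
  by rewrite (local_dev (n := 2) _ _ _ H).
have N0 : 0 <= N%:R :> R by [].
have rE : Num.sqrt N%:R ^+ k = (rt N ^+ k)^-1 :> R by rewrite /rt exprVn invrK.
have kap_gt0 : 0 < (p%:R - 1) * q ^+ (p - 2) by rewrite mulr_gt0 ?exprn_gt0// subr_gt0.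
rewrite natr1 !powR_half// ?constants_Vlim//; last first.
  by rewrite mulr_ge0// sqr_ge0.
move: (_ * q ^+ _) kap_gt0 => ka ka_gt0.
rewrite sqrtrM ?sqr_ge0// sqrtr_sqr (gtr0_norm ka_gt0) exprMn [_ ^+ k * _ / _]mulrAC mulfV; last first.
  by rewrite expf_neq0// gt_eqF.
rewrite !div1r mul1r.
(* For odd k the powers of Vlim on the two sides differ, but the Gaussian moment is 0; for even k
   they agree because Vlim is nonnegative. *)
have -> : (Num.sqrt N%:R ^+ k)^-1 * gaussE (fun y : R => y ^+ k) * Num.sqrt (Vlim p beta h q) ^+ k =
  gaussE (fun y : R => y ^+ k) * Vlim p beta h q ^+ k./2 * rt N ^+ k.
  have [ko|ke] := boolP (odd k); first by rewrite gaussE_odd// mulr0 !mul0r.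
  rewrite -{3}(even_halfK ke) -mul2n exprM sqr_sqrtr// rE invrK; ring.
have -> : C / Num.sqrt N%:R ^+ k.+1 = C * rt N ^+ k.+1 by rewrite /rt exprVn.
exact: HC.
Qed.
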